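(* Let $\{\mathbf X_i\}_{i=1}^n$, $\boldsymbol\Sigma$, $\gamma_s$, $R^*(s,p)$ and $R_n^{\rm MB}(s,p)$ be as described in the context. Assume that $(s,p,n)$ satisfies $1\le s\le p$ and $s\log(\gamma_s pn)=o(n^{1/5})$. Then as $n\to\infty$, $$\sup_{t\ge0}\Big|\mathbb P\big\{R^*(s,p)\le t\big\}-\mathbb P\big\{R_n^{\rm MB}(s,p)\le t\,\big|\,\mathbf X_1,\dots,\mathbf X_n\big\}\Big|\to 0\quad\text{in probability.}$$
   Context: Norms: for a random variable $X$, $\|X\|_{\psi_2}=\sup_{q\ge1}q^{-1/2}(\mathbb E|X|^q)^{1/q}$. For a vector $\mathbf u$, $|\mathbf u|_2$ is the Euclidean norm and $|\mathbf u|_0$ the number of nonzero coordinates; $\mathbb S^{p-1}$ is the unit Euclidean sphere of $\mathbb R^p$. Data: $\varepsilon_1,\dots,\varepsilon_n$ are i.i.d. copies of a real random variable $\varepsilon$ with $\mathbb E\varepsilon=0$, $\mathbb E\varepsilon^2=1$, $K_0:=\|\varepsilon\|_{\psi_2}<\infty$. $\mathbf X_1,\dots,\mathbf X_n$ are i.i.d. copies of a random vector $\mathbf X\in\mathbb R^p$ with $\mathbf X=\boldsymbol\Sigma^{1/2}\mathbf U$, where $\mathbb E\mathbf U=\mathbf 0$, $\mathbb E(\mathbf U\mathbf U^{\rm T})=\mathbf I_p$ and $K_1:=\sup_{\boldsymbol\alpha\in\mathbb S^{p-1}}\|\boldsymbol\alpha^{\rm T}\mathbf U\|_{\psi_2}<\infty$.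 The samples $\{\varepsilon_i\}$ and $\{\mathbf X_i\}$ are independent. $\boldsymbol\Sigma=\mathbb E(\mathbf X\mathbf X^{\rm T})$ is a correlation matrix, i.e. has unit diagonal. Sparse condition number: $\phi_{\min}(s)$ and $\phi_{\max}(s)$ are the minimum and maximum of $\mathbf u^{\rm T}\boldsymbol\Sigma\mathbf u/|\mathbf u|_2^2$ over $\mathbf u\in\mathbb R^p$ with $1\le|\mathbf u|_0\le s$, and $\gamma_s=\sqrt{\phi_{\max}(s)/\phi_{\min}(s)}$; it is implicit that $\phi_{\min}(s)>0$. Let $\mathcal V=\{\boldsymbol\alpha\in\mathbb S^{p-1}:|\boldsymbol\alpha|_0=s\}$ and, with $\mathbf Z\sim N(\mathbf 0,\boldsymbol\Sigma)$, $R^*(s,p)=\sup_{\boldsymbol\alpha\in\mathcal V}\boldsymbol\alpha^{\rm T}\mathbf Z/\sqrt{\boldsymbol\alpha^{\rm T}\boldsymbol\Sigma\boldsymbol\alpha}$. Multiplier bootstrap: let $\bar{\mathbf X}_n=n^{-1}\sum_i\mathbf X_i$, $\widehat{\boldsymbol\Sigma}_n=n^{-1}\sum_{i=1}^n(\mathbf X_i-\bar{\mathbf X}_n)(\mathbf X_i-\bar{\mathbf X}_n)^{\rm T}$, let $\xi_1,\dots,\xi_n$ be i.i.d. $N(0,1)$ independent of $\{\varepsilon_i\}$ and $\{\mathbf X_i\}$, set $\mathbf Z_n=n^{-1/2}\sum_{i=1}^n\xi_i(\mathbf X_i-\bar{\mathbf X}_n)$ and $$R_n^{\rm MB}(s,p)=\sup_{\boldsymbol\alpha\in\mathcal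 V}\frac{\boldsymbol\alpha^{\rm T}\mathbf Z_n}{\sqrt{\boldsymbol\alpha^{\rm T}\widehat{\boldsymbol\Sigma}_n\boldsymbol\alpha}} .$$ As $n\to\infty$, $p=p_n$ and $s=s_n$ (and the law of $\mathbf X$) may vary with $n$, while $K_0,K_1$ are treated as constants (bounded in $n$). *)

(* Defs.v *)
From HB Require Import structures.
From mathcomp Require Import all_boot all_order all_algebra.
From mathcomp Require Import all_classical all_reals all_analysis.

Set Implicit Arguments.
Unset Strict Implicit.
Unset Printing Implicit Defensive.

Import Order.TTheory GRing.Theory Num.Theory.
Import numFieldNormedType.Exports.

Local Open Scope classical_set_scope.
Local Open Scope ring_scope.

(* Matrices carry the product sigma-algebra, generated by the entry maps, just
   as n.-tuple does. *)
Definition measure_mx_display : measure_display -> measure_display.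
Proof. exact. Qed.

Section matrix_measurable.
Context {d} {T : sigmaRingType d} {m n : nat}.

Let entries_sigma : set (set 'M[T]_(m, n)) :=
  <<s \bigcup_(ij in [set: 'I_m * 'I_n])
        preimage_set_system setT (fun x : 'M[T]_(m, n) => x ij.1 ij.2)
          measurable >>.

Let mx_set0 : entries_sigma set0.
Proof. exact: sigma_algebra0. Qed.

Let mx_setC A : entries_sigma A -> entries_sigma (~` A).
Proof. exact: sigma_algebraC. Qed.

Let mx_bigcup (F : (set 'M[T]_(m, n))^nat) :
  (forall i, entries_sigma (F i)) -> entries_sigma (\bigcup_i F i).
Proof. exact: sigma_algebra_bigcup. Qed.

HB.instance Definition _ := @isMeasurable.Build (measure_mx_display d)
  'M[T]_(m, n) entries_sigma mx_set0 mx_setC mx_bigcup.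

End matrix_measurable.

Section vectors.
Context {R : realType}.

Definition dotv p (u v : 'cV[R]_p) : R := (u^T *m v) ord0 ord0.
Definition qform p (A : 'M[R]_p) (u : 'cV[R]_p) : R := dotv u (A *m u).
Definition l2norm p (u : 'cV[R]_p) : R := Num.sqrt (\sum_j u j ord0 ^+ 2).
Definition l0norm p (u : 'cV[R]_p) : nat := #|[pred j | u j ord0 != 0]|.

Definition psd p (A : 'M[R]_p) : Prop :=
  A^T = A /\ forall u : 'cV[R]_p, 0 <= qform A u.

Definition is_psd_sqrt p (B A : 'M[R]_p) : Prop := psd B /\ B *m B = A.

Definition sparse_rayleigh p (A : 'M[R]_p) (s : nat) : set R :=
  [set qform A u / l2norm u ^+ 2 | u in [set u | (1 <= l0norm u <= s)%N]].
(* The infimum and the supremum are attained when [1 <= s <= p]. *)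
Definition phi_min p (A : 'M[R]_p) (s : nat) : R := inf (sparse_rayleigh A s).
Definition phi_max p (A : 'M[R]_p) (s : nat) : R := sup (sparse_rayleigh A s).
Definition sparse_cond p (A : 'M[R]_p) (s : nat) : R :=
  Num.sqrt (phi_max A s / phi_min A s).

Definition sparse_sphere p (s : nat) : set 'cV[R]_p :=
  [set a | l2norm a = 1 /\ l0norm a = s].

(* Where [qform A a = 0] the quotient is 0, as [x / 0 = 0]; in the bootstrap
   statistic the numerator [dotv a z] is then also 0. *)
Definition sup_stat p (s : nat) (A : 'M[R]_p) (z : 'cV[R]_p) : R :=
  sup [set dotv a z / Num.sqrt (qform A a) | a in @sparse_sphere p s].

Definition sample_mean n p (x : 'I_n -> 'cV[R]_p) : 'cV[R]_p :=
  n%:R^-1 *: \sum_i x i.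

Definition sample_cov n p (x : 'I_n -> 'cV[R]_p) : 'M[R]_p :=
  n%:R^-1 *: \sum_i (x i - sample_mean x) *m (x i - sample_mean x)^T.

Definition bootstrap_vec n p (xi : 'I_n -> R) (x : 'I_n -> 'cV[R]_p) :
    'cV[R]_p :=
  (Num.sqrt n%:R)^-1 *: \sum_i xi i *: (x i - sample_mean x).

Definition mb_stat n p (s : nat) (xi : 'I_n -> R) (x : 'I_n -> 'cV[R]_p) : R :=
  sup_stat s (sample_cov x) (bootstrap_vec xi x).

End vectors.

Section probability.
Context {R : realType}.

Definition has_law d d' (T : measurableType d) (E : measurableType d')
    (P : probability T R) (Y : T -> E) (mu : set E -> \bar R) : Prop :=
  forall B, measurable B -> P (Y @^-1` B) = mu B.

Definition indep_rv d d' (T : measurableType d) (E : measurableType d')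
    (P : probability T R) (I : finType) (Y : I -> T -> E) : Prop :=
  forall (J : {set I}) (B : I -> set E), (forall i, measurable (B i)) ->
    P (\bigcap_(i in [set` J]) (Y i @^-1` B i)) =
    (\prod_(i in J) P (Y i @^-1` B i))%E.

Definition iid d d' (T : measurableType d) (E : measurableType d')
    (P : probability T R) (I : finType) (Y : I -> T -> E)
    (mu : set E -> \bar R) : Prop :=
  indep_rv P Y /\ forall i, has_law P (Y i) mu.

Definition indep_sigma d (T : measurableType d) (P : probability T R)
    (F G : set (set T)) : Prop :=
  forall A B, F A -> G B -> P (A `&` B) = (P A * P B)%E.

Definition psi2_norm d (T : measurableType d) (P : probability T R)
    (Y : T -> R) : \bar R :=
  ereal_sup [set ((q `^ (- 2^-1))%:E * 'N[P]_q%:E [EFin \o Y])%E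
            | q in [set q : R | 1 <= q]].

Definition psi2_norm_vec d (T : measurableType d) (P : probability T R) p
    (U : T -> 'cV[R]_p) : \bar R :=
  ereal_sup [set psi2_norm P (fun w => dotv a (U w))
            | a in [set a : 'cV[R]_p | l2norm a = 1]].

(* [Z ~ N(0, S)], [S] possibly singular: [Z] is distributed as [A g] with
   [A A^T = S] and [g] a vector of i.i.d. standard normal variables. *)
Definition centered_gaussian d (T : measurableType d) (P : probability T R) p
    (Z : T -> 'cV[R]_p) (S : 'M[R]_p) : Prop :=
  exists (m : nat) (A : 'M[R]_(p, m)) (d' : measure_display)
    (T' : measurableType d') (P' : probability T' R)
    (g : 'I_m -> {RV P' >-> R}),
  [/\ A *m A^T = S,
      iid P' g (normal_prob 0 1) &
      has_law P Z (pushforward P' (fun w => A *m \col_j g j w))].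

(* [kappa] is a regular conditional distribution under [P] of the real random
   variable [Y] given the sigma-algebra generated by [G]. *)
Definition is_cond_law d (T : measurableType d) (P : probability T R)
    (G : set (set T)) (Y : T -> R)
    (kappa : R.-pker (g_sigma_algebraType G) ~> R) : Prop :=
  forall (A : set T) (B : set R), <<s G >> A -> measurable B ->
    P (A `&` Y @^-1` B) = (\int[P]_(w in A) kappa w B)%E.

Definition cdf_dist (mu nu : set R -> \bar R) : \bar R :=
  ereal_sup [set `|mu [set r | (r <= t)%R] - nu [set r | (r <= t)%R]|%E
            | t in [set t : R | 0 <= t]].

Definition cvg_prob0 (d : nat -> measure_display)
    (T : forall n, measurableType (d n)) (P : forall n, probability (T n) R)
    (D : forall n, T n -> \bar R) : Prop :=
  forall e : R, 0 < e -> P n [set w | (e%:E < `|D n w|)%E] @[n --> \oo] --> 0%E.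

End probability.

(* Main.v *)
Require Import Defs.
From HB Require Import structures.
From mathcomp Require Import all_boot all_order all_algebra.
From mathcomp Require Import all_classical all_reals all_analysis.
From mathcomp Require Import measurable_realfun simple_functions measurable_fun_approximation.
From mathcomp Require Import ring lra.

Set Implicit Arguments.
Unset Strict Implicit.
Unset Printing Implicit Defensive.

Import Order.TTheory GRing.Theory Num.Theory.
Import numFieldNormedType.Exports.

Local Open Scope classical_set_scope.
Local Open Scope ring_scope.

Section transfer.
Local Open Scope ereal_scope.
Context {R : realType}.
Import HBNNSimple.

Let weighted_integral_lim d d' (T : measurableType d) (E : measurableType d')
    (mu : {measure set T -> \bar R}) (phi : T -> E) (g : T -> R)
    (f : E -> \bar R) (mf : measurable_fun setT f) :
  measurable_fun setT phi -> measurable_fun setT g ->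
  (forall x, 0 <= g x)%R -> (forall y, 0 <= f y) ->
  \int[mu]_x (f (phi x) * (g x)%:E) =
  limn (fun n => \sum_(k \in range (nnsfun_approx measurableT mf n))
    (k%:E * \int[mu]_(x in phi @^-1` (nnsfun_approx measurableT mf n @^-1` [set k])) (g x)%:E)).
Proof.
move=> mphi mg g0 f0; set h := nnsfun_approx measurableT mf.
have mG : measurable_fun setT (EFin \o g) by exact/measurable_EFinP.
have fg x : f (phi x) * (g x)%:E = limn (fun n => (h n (phi x))%:E * (g x)%:E).
  apply/esym/cvg_lim => //; apply: cvgeZr => //.
  by apply: cvg_nnsfun_approx => //.
have mh n : measurable_fun setT (fun x => (h n (phi x))%:E).
  by apply/measurable_EFinP; apply: measurableT_comp.
under eq_integral => x _ do rewrite fg.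
rewrite monotone_convergence//; last 3 first.
- by move=> n; apply: emeasurable_funM.
- by move=> n x _; rewrite mule_ge0 ?lee_fin.
- move=> x _ a b ab; rewrite lee_wpmul2r ?lee_fin//; exact/lefP/nd_nnsfun_approx.
congr (limn _); apply/funext => n.
have mhk k : measurable (phi @^-1` (h n @^-1` [set k])).
  by rewrite -[X in measurable X]setTI; apply: mphi.
under eq_integral => x _.
  rewrite fimfunE -fsumEFin// ge0_mule_fsuml; last first.
    by move=> i; exact: (nnfun_muleindic_ge0 (h n)).
  over.
rewrite /= ge0_integral_fsum//; last 2 first.
- move=> k; apply: emeasurable_funM => //; apply/measurable_EFinP.
  apply: measurable_funM => //.
  have -> : (fun t => \1_(h n @^-1` [set k]) (phi t)) = (\1_(phi @^-1` (h n @^-1` [set k])) : T -> R).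
    by apply/funext => t; rewrite !indicE.
  exact: measurable_indic.
- by move=> k x _; rewrite mule_ge0 ?lee_fin//; exact: (nnfun_muleindic_ge0 (h n)).
apply: eq_fsbigr => k; rewrite inE => -[y _ <-].
rewrite [in RHS]integral_mkcond epatch_indic -ge0_integralZl//; last 3 first.
- by apply: emeasurable_funM => //; apply/measurable_EFinP; exact: measurable_indic.
- by move=> x _; rewrite mule_ge0 ?lee_fin.
- by rewrite lee_fin.
apply: eq_integral => x _.
by rewrite EFinM -muleA [_ * (g x)%:E]muleC !indicE/=.
Qed.

(* Two weighted image measures that agree on sets integrate alike. *)
Lemma ge0_integral_transfer d1 d2 d (T1 : measurableType d1)
    (T2 : measurableType d2) (E : measurableType d)
    (m1 : {measure set T1 -> \bar R}) (m2 : {measure set T2 -> \bar R})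
    (phi1 : T1 -> E) (phi2 : T2 -> E) (g1 : T1 -> R) (g2 : T2 -> R)
    (f : E -> \bar R) :
  measurable_fun setT phi1 -> measurable_fun setT phi2 ->
  measurable_fun setT g1 -> measurable_fun setT g2 ->
  (forall x, 0 <= g1 x)%R -> (forall x, 0 <= g2 x)%R ->
  (forall B, measurable B -> \int[m1]_(x in phi1 @^-1` B) (g1 x)%:E =
                             \int[m2]_(x in phi2 @^-1` B) (g2 x)%:E) ->
  measurable_fun setT f -> (forall y, 0 <= f y) ->
  \int[m1]_x (f (phi1 x) * (g1 x)%:E) = \int[m2]_x (f (phi2 x) * (g2 x)%:E).
Proof.
move=> mp1 mp2 mg1 mg2 g10 g20 H mf f0.
rewrite (weighted_integral_lim m1 mf mp1 mg1)// (weighted_integral_lim m2 mf mp2 mg2)//.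
congr (limn _); apply/funext => n; apply: eq_fsbigr => k _.
by rewrite H.
Qed.

Lemma eq_ge0_integral_law d1 d2 d (T1 : measurableType d1)
    (T2 : measurableType d2) (E : measurableType d)
    (m1 : {measure set T1 -> \bar R}) (m2 : {measure set T2 -> \bar R})
    (phi1 : T1 -> E) (phi2 : T2 -> E) (f : E -> \bar R) :
  measurable_fun setT phi1 -> measurable_fun setT phi2 ->
  (forall B, measurable B -> m1 (phi1 @^-1` B) = m2 (phi2 @^-1` B)) ->
  measurable_fun setT f -> (forall y, 0 <= f y) ->
  \int[m1]_x f (phi1 x) = \int[m2]_x f (phi2 x).
Proof.
move=> mp1 mp2 H mf f0.
have := @ge0_integral_transfer _ _ _ _ _ _ m1 m2 phi1 phi2 (cst 1%R) (cst 1%R) f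
  mp1 mp2 (measurable_cst _) (measurable_cst _).
have E1 d' (T' : measurableType d') (F : T' -> \bar R) (m : {measure set T' -> \bar R}) :
    \int[m]_x (F x * (cst 1%R x)%:E) = \int[m]_x F x.
  by apply: eq_integral => x _; rewrite mule1.
rewrite !E1; apply => //.
have E2 d' (T' : measurableType d') (m : {measure set T' -> \bar R}) D :
    measurable D -> \int[m]_(x in D) (cst 1%R x)%:E = m D.
  by move=> mD; rewrite -[RHS]mul1e -integral_cst.
move=> B mB; rewrite !E2 ?H//.
- by rewrite -[X in measurable X]setTI; apply: mp2.
- by rewrite -[X in measurable X]setTI; apply: mp1.
Qed.

End transfer.

Section gauss1.
Local Open Scope ereal_scope.
Context {R : realType}.
Local Notation leb := (@lebesgue_measure R).
Local Notation gamma1 := (@normal_prob R 0 1).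

Lemma normal_pdf_neq0E (m s x : R) : (s != 0)%R ->
  (normal_pdf m s x = normal_peak s * expR (- (x - m) ^+ 2 / (s ^+ 2 *+ 2)))%R.
Proof. by move=> s0; rewrite /normal_pdf (negbTE s0). Qed.

Lemma integral_normal_prob (m s : R) (f : R -> \bar R) :
  measurable_fun setT f -> (forall x, 0 <= f x) ->
  \int[normal_prob m s]_x f x = \int[leb]_x (f x * (normal_pdf m s x)%:E).
Proof.
move=> mf f0.
rewrite -(@ge0_integral_transfer R _ _ _ _ _ _ (normal_prob m s) leb id id (cst 1%R)
  (normal_pdf m s) f)//.
- by apply: eq_integral => x _; rewrite mule1.
- exact: measurable_normal_pdf.
- exact: normal_pdf_ge0.
- by move=> B mB; rewrite /= (integral_cst _ _ 1%:E)// mul1e.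
Qed.

Lemma lebesgue_measure_affine (a b : R) (f : R -> \bar R) : (0 < a)%R ->
  measurable_fun setT f -> (forall x, 0 <= f x) ->
  \int[leb]_x f x = a%:E * \int[leb]_x f (a * x + b)%R.
Proof.
move=> a0 mf f0.
pose h : R -> measurableTypeR R := fun x => (a * x + b)%R.
have mh : measurable_fun setT (h : R -> R).
  by apply: measurable_funD => //; apply: measurable_funM.
have H B : measurable B -> leb B = a%:E * leb (h @^-1` B).
  have mh' : @measurable_fun _ _ (measurableTypeR R) (measurableTypeR R) setT h by exact: mh.
  pose ph : {mfun (measurableTypeR R) >-> (measurableTypeR R)} :=
    HB.pack h (isMeasurableFun.Build _ _ (measurableTypeR R) (measurableTypeR R) h mh').
  move=> mB; rewrite (@lebesgue_measure_unique R (mscale (NngNum (ltW a0)) (pushforward leb ph)) _ B mB)//=.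
  move=> _ [[u v]] _ <-; rewrite /mscale /pushforward/=.
  have E : h @^-1` `]u, v] = [set` `](u - b) / a, (v - b) / a]%R] :> set R.
    apply/seteqP; split => x /=; rewrite !in_itv/= /h.
      by rewrite ltr_pdivrMr// ler_pdivlMr// ltrBlDr lerBrDr mulrC.
    by rewrite ltr_pdivrMr// ler_pdivlMr// ltrBlDr lerBrDr mulrC.
  transitivity (a%:E * leb (h @^-1` `]u, v])) => //.
  rewrite E !lebesgue_measure_itv/= !lte_fin ltr_pM2r ?invr_gt0// ltrBlDr subrK.
  case: ifPn => _; last by rewrite mule0.
  rewrite -!EFinB -EFinM -mulrBl mulrCA divff ?gt_eqF// mulr1; congr EFin; ring.
have E : \int[leb]_x (f x * (cst 1%R x)%:E) =
    \int[leb]_x (f (h x) * (cst a x)%:E).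
  apply: (@ge0_integral_transfer R _ _ _ _ _ _ leb leb id h (cst 1%R) (cst a)) => //.
  - by move=> x; exact: ltW.
  - move=> B mB; rewrite /= (integral_cst _ _ 1%:E)// (integral_cst _ _ a%:E)//.
      by rewrite mul1e; exact: H.
    by rewrite -[X in measurable X]setTI; apply: mh.
rewrite -ge0_integralZl//; last 2 first.
- exact: (measurableT_comp mf mh).
- by rewrite lee_fin ltW.
transitivity (\int[leb]_x (f x * (cst 1%R x)%:E)).
  by apply: eq_integral => x _; rewrite mule1.
by rewrite E; apply: eq_integral => x _; rewrite muleC.
Qed.

Lemma normal_prob_sym (f : R -> \bar R) :
  measurable_fun setT f -> (forall x, 0 <= f x) ->
  \int[gamma1]_x f (- x)%R = \int[gamma1]_x f x.
Proof.
move=> mf f0.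
rewrite !integral_normal_prob//; last exact: measurableT_comp.
have -> : (fun x => f (- x)%R * (normal_pdf 0 1 x)%:E) =
    (fun x => (fun y => f y * (normal_pdf 0 1 y)%:E) (- x)%R).
  apply/funext => x /=; congr (_ * (_)%:E).
  by rewrite !normal_pdf_neq0E ?oner_eq0// !subr0 sqrrN.
apply: (@eq_ge0_integral_law R _ _ _ _ _ _ leb leb (-%R) id
   (fun y => f y * (normal_pdf 0 1 y)%:E)) => //.
- by move=> B mB; exact: (lebesgue_measureN mB).
- apply: emeasurable_funM => //; apply/measurable_EFinP; exact: measurable_normal_pdf.
- by move=> y; rewrite mule_ge0// lee_fin normal_pdf_ge0.
Qed.

Lemma normal_pdf_scale (m s x : R) : (0 < s)%R ->
  normal_pdf m s x = (s^-1 * normal_pdf 0 1 ((x - m) / s))%R.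
Proof.
move=> s0; rewrite !normal_pdf_neq0E ?oner_eq0 ?gt_eqF// /normal_peak.
rewrite subr0 expr1n mul1r -[(_ * pi *+ 2)%R]mulrnAr sqrtrM ?sqr_ge0// sqrtr_sqr gtr0_norm//.
rewrite invfM -mulrA; congr (_ * (_ * expR _))%R.
by field; rewrite gt_eqF.
Qed.

Lemma integral_normal_scale (a b : R) (f : R -> \bar R) : (0 < a)%R ->
  measurable_fun setT f -> (forall x, 0 <= f x) ->
  \int[gamma1]_x f (a * x + b)%R = \int[normal_prob b a]_x f x.
Proof.
move=> a0 mf f0.
have mh : measurable_fun setT (fun x : R => (a * x + b)%R).
  by apply: measurable_funD => //; apply: measurable_funM.
have mpdf m s : measurable_fun setT (fun x : R => (@normal_pdf R m s x)%:E).
  by apply/measurable_EFinP; exact: measurable_normal_pdf.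
have p0 m s x : 0 <= (@normal_pdf R m s x)%:E by rewrite lee_fin normal_pdf_ge0.
rewrite [RHS](integral_normal_prob b a mf f0).
rewrite [LHS](integral_normal_prob 0 1 (measurableT_comp mf mh)); last by move=> x; exact: f0.
rewrite [RHS](@lebesgue_measure_affine a b)//; last 2 first.
- by apply: emeasurable_funM.
- by move=> x; rewrite mule_ge0.
rewrite -ge0_integralZl//; last 3 first.
- apply: emeasurable_funM; first exact: (measurableT_comp mf mh).
  by apply: (measurableT_comp (mpdf _ _) mh).
- by move=> x _; rewrite mule_ge0.
- by rewrite lee_fin ltW.
apply: eq_integral => x _; rewrite (normal_pdf_scale b _ a0) addrK mulrAC divff ?gt_eqF//.
rewrite mul1r muleCA; congr (_ * _).
by rewrite -EFinM mulrA divff ?gt_eqF// mul1r.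
Qed.

Let normal_pdf_conv (a b x w : R) : (0 < a)%R ->
  (normal_pdf (b * w) a x * normal_pdf 0 1 w =
   normal_pdf 0 (Num.sqrt (a ^+ 2 + b ^+ 2)) x *
   normal_pdf (b * x / (a ^+ 2 + b ^+ 2)) (a / Num.sqrt (a ^+ 2 + b ^+ 2)) w)%R.
Proof.
move=> a0.
have c20 : (0 < a ^+ 2 + b ^+ 2)%R by rewrite ltr_pwDl ?exprn_gt0 ?sqr_ge0.
set c := Num.sqrt (a ^+ 2 + b ^+ 2).
have c0 : (0 < c)%R by rewrite sqrtr_gt0.
have cE : (c ^+ 2 = a ^+ 2 + b ^+ 2)%R by rewrite sqr_sqrtr// ltW.
rewrite (normal_pdf_scale _ _ a0) (normal_pdf_scale _ _ c0).
rewrite (@normal_pdf_scale _ (a / c)) ?divr_gt0//.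
rewrite !normal_pdf_neq0E ?oner_eq0 // !subr0.
set k := normal_peak 1.
transitivity (a^-1 * k * k * expR (- ((x - b * w) / a) ^+ 2 / (1 ^+ 2 *+ 2) + - w ^+ 2 / (1 ^+ 2 *+ 2)))%R.
  rewrite expRD; ring.
transitivity (a^-1 * k * k * expR (- (x / c) ^+ 2 / (1 ^+ 2 *+ 2) + - ((w - b * x / (a ^+ 2 + b ^+ 2)) / (a / c)) ^+ 2 / (1 ^+ 2 *+ 2)))%R; last first.
  by rewrite expRD; field; rewrite !gt_eqF.
congr (_ * expR _)%R.
rewrite -cE; apply/eqP; rewrite -subr_eq0; apply/eqP.
have -> : (- ((x - b * w) / a) ^+ 2 / (1 ^+ 2 *+ 2) + - w ^+ 2 / (1 ^+ 2 *+ 2) -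
  (- (x / c) ^+ 2 / (1 ^+ 2 *+ 2) +
   - ((w - b * x / c ^+ 2) / (a / c)) ^+ 2 / (1 ^+ 2 *+ 2)) =
   (c ^+ 2 - (a ^+ 2 + b ^+ 2)) * (w ^+ 2 * c ^+ 2 - x ^+ 2) / (2 * a ^+ 2 * c ^+ 2))%R.
  by field; rewrite !gt_eqF.
by rewrite cE subrr !mul0r.
Qed.

Let stability_pos (a b : R) (f : R -> \bar R) : (0 < a)%R ->
  measurable_fun setT f -> (forall x, 0 <= f x) ->
  \int[gamma1]_w \int[gamma1]_z f (a * z + b * w)%R =
  \int[gamma1]_z f (Num.sqrt (a ^+ 2 + b ^+ 2) * z)%R.
Proof.
move=> a0 mf f0.
have c20 : (0 < a ^+ 2 + b ^+ 2)%R by rewrite ltr_pwDl ?exprn_gt0 ?sqr_ge0.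
set c := Num.sqrt (a ^+ 2 + b ^+ 2).
have c0 : (0 < c)%R by rewrite sqrtr_gt0.
have mpdf m s : measurable_fun setT (fun x : R => (@normal_pdf R m s x)%:E).
  by apply/measurable_EFinP; exact: measurable_normal_pdf.
have p0 m s x : 0 <= (@normal_pdf R m s x)%:E by rewrite lee_fin normal_pdf_ge0.
transitivity (\int[gamma1]_w \int[leb]_x (f x * (normal_pdf (b * w) a x)%:E)).
  by apply: eq_integral => w _; rewrite integral_normal_scale// integral_normal_prob.
have mK : measurable_fun setT (fun xw : R * R => f xw.1 * (normal_pdf (b * xw.2) a xw.1)%:E).
  apply: emeasurable_funM; first exact: measurableT_comp.
  apply/measurable_EFinP.
  have -> : (fun x : R * R => normal_pdf (b * x.2) a x.1) =
      (fun x => a^-1 * normal_pdf 0 1 ((x.1 - b * x.2) / a))%R.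
    by apply/funext => x; rewrite normal_pdf_scale.
  apply: measurable_funM => //; apply: (measurableT_comp (measurable_normal_pdf 0 1)).
  apply: measurable_funM => //; apply: measurable_funB => //.
  by apply: measurable_funM => //.
have mK2 : measurable_fun setT (fun xw : R * R => f xw.1 * (normal_pdf (b * xw.2) a xw.1)%:E * (normal_pdf 0 1 xw.2)%:E).
  by apply: emeasurable_funM => //; exact: (measurableT_comp (mpdf 0%R 1%R)).
have K0 xw : 0 <= f xw.1 * (normal_pdf (b * xw.2) a xw.1)%:E.
  by rewrite mule_ge0.
rewrite integral_normal_prob//; last 2 first.
- exact: (measurable_fun_fubini_tonelli_G (m1 := leb) _ mK).
- by move=> w; apply: integral_ge0 => x _; exact: (K0 (x, w)).
transitivity (\int[leb]_w \int[leb]_x (f x * (normal_pdf (b * w) a x)%:E * (normal_pdf 0 1 w)%:E)).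
  apply: eq_integral => w _; rewrite -ge0_integralZr//.
  - exact: (measurableT_comp mK (measurable_pair2 w)).
  - by move=> x _; exact: (K0 (x, w)).
rewrite -(@fubini_tonelli _ _ _ _ _ leb leb (fun xw : R * R => f xw.1 * (normal_pdf (b * xw.2) a xw.1)%:E * (normal_pdf 0 1 xw.2)%:E))//=; last first.
  by move=> xw; rewrite mule_ge0.
transitivity (\int[leb]_x (f x * (normal_pdf 0 c x)%:E)); last first.
  rewrite -[LHS](integral_normal_prob 0 c mf f0) -[LHS](integral_normal_scale 0 c0 mf f0).
  by apply: eq_integral => x _; rewrite addr0.
apply: eq_integral => x _.
under eq_integral => w _ do rewrite -muleA -EFinM normal_pdf_conv// EFinM muleA.
rewrite ge0_integralZl//; [by rewrite integral_normal_pdf mule1|exact: mpdf|by rewrite mule_ge0].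
Qed.

Lemma integral_normal_norm (a : R) (f : R -> \bar R) :
  measurable_fun setT f -> (forall x, 0 <= f x) ->
  \int[gamma1]_x f (a * x)%R = \int[gamma1]_x f (`|a| * x)%R.
Proof.
move=> mf f0; have [a0|a0] := leP 0%R a; first by rewrite ger0_norm.
rewrite ltr0_norm// -[LHS](@normal_prob_sym (fun x => f (a * x)%R))//.
- by apply: eq_integral => x _; rewrite mulrN mulNr.
- by apply: (measurableT_comp mf); apply: measurable_funM.
Qed.

Lemma normal_stability (a b : R) (f : R -> \bar R) :
  measurable_fun setT f -> (forall x, 0 <= f x) ->
  \int[gamma1]_w \int[gamma1]_z f (a * z + b * w)%R =
  \int[gamma1]_z f (Num.sqrt (a ^+ 2 + b ^+ 2) * z)%R.
Proof.
move=> mf f0; have [a0|a0] := eqVneq a 0%R.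
  rewrite a0 expr0n add0r sqrtr_sqr -integral_normal_norm//.
  apply: eq_integral => w _; rewrite -[RHS]mule1 -(@probability_setT _ _ _ gamma1) -integral_cst//.
  by apply: eq_integral => z _; rewrite mul0r add0r.
rewrite -[in RHS](real_normK (num_real a)) -stability_pos ?normr_gt0//.
apply: eq_integral => w _; apply: (@integral_normal_norm a (fun y => f (y + b * w)%R)) => //.
by apply: (measurableT_comp mf); apply: measurable_funD.
Qed.

End gauss1.

Section matrix_measurability.
Context {R : realType}.

Lemma measurable_mx_entry d (T : measurableType d) m n (i : 'I_m) (j : 'I_n) :
  measurable_fun setT (fun x : 'M[T]_(m, n) => x i j).
Proof.
move=> _ B mB; rewrite setTI; apply: sub_sigma_algebra.
by exists (i, j) => //; exists B => //; rewrite setTI.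
Qed.

Lemma measurable_mxP d d' (T : measurableType d) (T' : measurableType d') m n
    (f : T' -> 'M[T]_(m, n)) :
  (forall i j, measurable_fun setT (fun w => f w i j)) -> measurable_fun setT f.
Proof.
move=> mf; apply: (@measurability _ _ _ _ _ _
  (\bigcup_(ij in [set: 'I_m * 'I_n])
     preimage_set_system setT (fun x : 'M[T]_(m, n) => x ij.1 ij.2) measurable)) => //.
move=> _ [_ [ij _ [B mB <-]] <-]; rewrite !setTI.
by rewrite -[X in measurable X]setTI; apply: (mf ij.1 ij.2).
Qed.

Lemma measurable_mulmx d (T : measurableType d) m n q (A : 'M[R]_(m, n)) (f : T -> 'M[R]_(n, q)) :
  measurable_fun setT f -> measurable_fun setT (fun w => A *m f w).
Proof.
move=> mf; apply: measurable_mxP => i j.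
rewrite (_ : (fun w => _) = (fun w => \sum_k A i k * f w k j)); last first.
  by apply/funext => w; rewrite mxE.
apply: measurable_sum => k; apply: measurable_funM => //.
exact: (measurableT_comp (measurable_mx_entry k j) mf).
Qed.

Lemma measurable_addmx d (T : measurableType d) m n (f g : T -> 'M[R]_(m, n)) :
  measurable_fun setT f -> measurable_fun setT g ->
  measurable_fun setT (fun w => f w + g w).
Proof.
move=> mf mg; apply: measurable_mxP => i j.
rewrite (_ : (fun w => _) = (fun w => f w i j + g w i j)); last first.
  by apply/funext => w; rewrite mxE.
by apply: measurable_funD; exact: (measurableT_comp (measurable_mx_entry i j)).
Qed.

Lemma dotvE p (u v : 'cV[R]_p) : dotv u v = \sum_j u j ord0 * v j ord0.
Proof. by rewrite /dotv mxE; apply: eq_bigr => j _; rewrite !mxE. Qed.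

Lemma measurable_dotv d (T : measurableType d) m (u : 'cV[R]_m) (f : T -> 'cV[R]_m) :
  measurable_fun setT f -> measurable_fun setT (fun w => dotv u (f w)).
Proof.
move=> mf; rewrite (_ : (fun w => _) = (fun w => (u^T *m f w) ord0 ord0)) //.
apply: (measurableT_comp (measurable_mx_entry ord0 ord0)).
exact: measurable_mulmx.
Qed.

Definition orthant N (t : 'I_N -> R) : set 'cV[R]_N :=
  [set x | forall i, x i ord0 <= t i].

Lemma measurable_orthant N (t : 'I_N -> R) : measurable (orthant t).
Proof.
have -> : orthant t = \bigcap_(i in [set: 'I_N]) [set x | x i ord0 <= t i].
  by apply/seteqP; split => [x xt i _|x xt i]; exact: xt.
apply: fin_bigcap_measurable => // i _; rewrite -[X in measurable X]setTI.
have := @measurable_mx_entry _ R N 1 i ord0 measurableT `]-oo, t i]%classic (measurable_itv _).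
by congr (measurable (_ `&` _)); apply/seteqP; split => x /=; rewrite in_itv.
Qed.

Lemma orthant_measurableE N :
  @measurable _ 'cV[R]_N = <<s range (@orthant N) >>.
Proof.
apply/seteqP; split; last first.
  apply: smallest_sub; first exact: sigma_algebra_measurable.
  by move=> _ [t _ <-]; exact: measurable_orthant.
apply: smallest_sub; first exact: smallest_sigma_algebra.
move=> _ [[i j] _ [B mB <-]].
have mi : measurable_fun [set: g_sigma_algebraType (range (@orthant N))]
    (fun x : 'cV[R]_N => x i j).
  apply: (measurability _ (RGenOInfty.measurableE R)).
  move=> _ [_ [x ->] <-]; rewrite setTI.
  rewrite (_ : _ @^-1` _ = ~` (\bigcup_(k : nat) orthant (fun i' => if i' == i then x else k%:R))).
    apply: measurableC; apply: bigcupT_measurable => k.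
    by apply: sub_sigma_algebra; exists (fun i' => if i' == i then x else k%:R).
  apply/seteqP; split => y /=; rewrite in_itv/= andbT ord1.
    by move=> xy [k _ /(_ i)]; rewrite eqxx leNgt xy.
  rewrite ltNge => H; apply/negP => yx; apply: H.
  pose M := \sum_i' `|y i' ord0|.
  exists (Num.truncn M).+1 => // i'; case: ifPn => [/eqP -> //|_].
  apply: le_trans (ltW (truncnS_gt _)); apply: le_trans (ler_norm _) _.
  by rewrite /M (bigD1 i')//= lerDl sumr_ge0.
by have := mi measurableT B mB; rewrite setTI.
Qed.

Lemma eq_measure_orthant N (m1 m2 : {measure set 'cV[R]_N -> \bar R}) :
  (m1 setT < +oo)%E -> (forall t, m1 (orthant t) = m2 (orthant t)) ->
  forall B, measurable B -> m1 B = m2 B.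
Proof.
move=> fin1 H B mB.
apply: (measure_unique (range (@orthant N)) (fun k => orthant (fun=> k%:R))) => //.
- exact: orthant_measurableE.
- move=> _ _ [t _ <-] [u _ <-]; exists (fun i => Order.min (t i) (u i)) => //.
  apply/seteqP; split => [x xt|x [xt xu] i]; last by rewrite le_min xt xu.
  by split => i; have := xt i; rewrite le_min => /andP[].
- apply/seteqP; split => // y _.
  pose M := \sum_i' `|y i' ord0|.
  exists (Num.truncn M).+1 => // i'.
  apply: le_trans (ltW (truncnS_gt _)); apply: le_trans (ler_norm _) _.
  by rewrite /M (bigD1 i')//= lerDl sumr_ge0.
- by move=> _ [t _ <-].
- move=> k; apply: le_lt_trans fin1; apply: le_measure; rewrite ?inE//.
  exact: measurable_orthant.
Qed.

End matrix_measurability.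

Lemma integral_cst_probability {R : realType} d (T : measurableType d)
  (P : probability T R) (c : \bar R) : (\int[P]_x c = c)%E.
Proof. by rewrite integral_cst//= probability_setT mule1. Qed.

Section gauss_def.
Context {R : realType}.
Local Notation gamma1 := (@normal_prob R 0 1).

Definition col_cons m (zy : measurableTypeR R * 'cV[R]_m) : 'cV[R]_m.+1 :=
  col_mx (zy.1)%:M zy.2.

Lemma col_consE m (z : R) (y : 'cV[R]_m) i :
  col_cons (z, y) i ord0 = oapp (fun j => y j ord0) z (unlift ord0 i).
Proof.
rewrite /col_cons mxE; case: unliftP => [j ->|->] /=.
  have -> : lift ord0 j = rshift 1 j by apply: val_inj.
  by rewrite (unsplitK (inr _)).
have -> : ord0 = lshift m (ord0 : 'I_1) by apply: val_inj.
by rewrite (unsplitK (inl _)) /= mxE eqxx.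
Qed.

Let measurable_col_cons m : measurable_fun setT (@col_cons m).
Proof.
apply: measurable_mxP => i j; rewrite ord1.
rewrite (_ : (fun zy : measurableTypeR R * 'cV[R]_m => col_cons zy i ord0) =
    (fun zy : measurableTypeR R * 'cV[R]_m => oapp (fun k : 'I_m => zy.2 k ord0) zy.1 (unlift ord0 i))); last first.
  by apply/funext => -[z y]; rewrite col_consE.
case: (unlift ord0 i) => [k|]; last exact: measurable_fst.
exact: (measurableT_comp (measurable_mx_entry k ord0) measurable_snd).
Qed.

HB.instance Definition _ m := isMeasurableFun.Build _ _ _ _ _ (@measurable_col_cons m).

Fixpoint gauss_rec m : probability 'cV[R]_m R :=
  match m with
  | 0 => dirac (0 : 'cV[R]_0)
  | m'.+1 => distribution (gamma1 \x gauss_rec m')%E (@col_cons m')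
  end.

(* Locking keeps unification from unfolding the recursion. *)
Definition gauss := locked gauss_rec.

Local Open Scope ereal_scope.

Lemma integral_gaussS m (f : 'cV[R]_m.+1 -> \bar R) :
  measurable_fun setT f -> (forall x, 0 <= f x) ->
  \int[gauss m.+1]_y f y = \int[gamma1]_z \int[gauss m]_y f (col_cons (z, y)).
Proof.
move=> mf f0; rewrite /gauss -lock.
rewrite [LHS](@ge0_integral_pushforward _ _ _ _ _ (@col_cons m) (@measurable_funPT _ _ _ _ (@col_cons m)) _ setT f)//.
have mfc : measurable_fun setT (f \o @col_cons m) by exact: measurableT_comp.
rewrite preimage_setT (@fubini_tonelli1 _ _ _ _ _ gamma1 (gauss_rec m) _ mfc)//.
by move=> x; exact: f0.
Qed.

Lemma dotv_col_cons m (w : 'cV[R]_m.+1) z (y : 'cV[R]_m) :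
  dotv w (col_cons (z, y)) = (w ord0 ord0 * z + dotv (\col_i w (lift ord0 i) ord0) y)%R.
Proof.
rewrite !dotvE big_ord_recl col_consE unlift_none /=; congr (_ + _)%R.
by apply: eq_bigr => i _; rewrite col_consE liftK/= mxE.
Qed.

Lemma l2norm_ge0 m (w : 'cV[R]_m) : (0 <= l2norm w)%R.
Proof. exact: sqrtr_ge0. Qed.

Lemma sqr_l2norm m (w : 'cV[R]_m) : (l2norm w ^+ 2 = dotv w w)%R.
Proof.
rewrite /l2norm sqr_sqrtr ?sumr_ge0//; last by move=> i _; exact: sqr_ge0.
by rewrite dotvE; apply: eq_bigr => i _; rewrite expr2.
Qed.

Lemma gauss_dotv m (w : 'cV[R]_m) (f : R -> \bar R) :
  measurable_fun setT f -> (forall x, 0 <= f x) ->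
  \int[gauss m]_y f (dotv w y) = \int[gamma1]_z f (l2norm w * z)%R.
Proof.
elim: m w f => [|m IH] w f mf f0.
  rewrite -[RHS](@integral_cst_probability R _ _ (gauss 0)).
  apply: eq_integral => y _; rewrite dotvE big_ord0 -[LHS](@integral_cst_probability R _ _ gamma1).
  by apply: eq_integral => z _; rewrite /l2norm big_ord0 sqrtr0 mul0r.
have mw : measurable_fun setT (fun y => f (dotv w y)).
  by apply: (measurableT_comp mf); apply: measurable_dotv.
rewrite integral_gaussS//.
set w' := \col_i w (lift ord0 i) ord0.
transitivity (\int[gamma1]_z \int[gamma1]_u f (w ord0 ord0 * z + l2norm w' * u)%R).
  apply: eq_integral => z _.
  under eq_integral => y _ do rewrite dotv_col_cons -/w'.
  apply: (IH w' (fun x => f (w ord0 ord0 * z + x)%R)) => //.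
  by apply: (measurableT_comp mf); apply: measurable_funD.
transitivity (\int[gamma1]_u \int[gamma1]_z f (l2norm w' * z + w ord0 ord0 * u)%R).
  by apply: eq_integral => u _; apply: eq_integral => z _; rewrite addrC.
rewrite normal_stability//; apply: eq_integral => z _; congr (f (_ * _)%R).
rewrite sqr_l2norm dotvE /l2norm big_ord_recl addrC; congr (Num.sqrt (_ + _))%R.
by apply: eq_bigr => i _; rewrite mxE expr2.
Qed.

Lemma gauss_orthant m (t : 'I_m -> R) :
  gauss m (orthant t) = \prod_(i < m) gamma1 `]-oo, t i].
Proof.
rewrite /gauss -lock; elim: m t => [|m IH] t.
  by rewrite big_ord0 /= diracE mem_set// => -[].
rewrite big_ord_recl -IH -[RHS]product_measure1E//; last exact: measurable_orthant.
rewrite /= /distribution /pushforward /=; congr ((_ \x _) _).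
apply/seteqP; split => [[z y] /= H|[z y] [/= zt yt] i].
  split; first by have := H ord0; rewrite col_consE unlift_none /= in_itv.
  by move=> i; have := H (lift ord0 i); rewrite col_consE liftK.
rewrite col_consE; case: unliftP => [j ->|->]/=; first exact: yt.
by move: zt; rewrite in_itv.
Qed.

Lemma indep_rv_gauss d (T : measurableType d) (P : probability T R) m
    (g : 'I_m -> {mfun T >-> R}) :
  iid P g gamma1 ->
  forall B, measurable B -> P ((fun w => \col_j g j w) @^-1` B) = gauss m B.
Proof.
move=> [ind law].
have mg : measurable_fun setT (fun w => \col_j g j w).
  by apply: measurable_mxP => i j; under eq_fun do rewrite mxE; exact: measurable_funPT.
pose G : {mfun T >-> 'cV[R]_m} := HB.pack (fun w => \col_j g j w)
  (isMeasurableFun.Build _ _ _ _ _ mg).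
move=> B mB; apply: (@eq_measure_orthant R m (distribution P G) (gauss m)) => //.
  by rewrite (le_lt_trans (probability_le1 _ _))// ltry.
move=> t; transitivity (P ((fun w => \col_j g j w) @^-1` orthant t)) => //; rewrite [RHS](gauss_orthant t).
transitivity (P (\bigcap_(i in [set` [set: 'I_m]%SET]) (g i @^-1` `]-oo, t i]))).
  congr (P _); apply/seteqP; split => w /= H i.
    by move=> _ /=; have := H i; rewrite mxE in_itv.
  by have := H i; rewrite /= in_itv /= mxE; apply; rewrite inE.
rewrite ind//; apply: eq_big => [i|i _]; first by rewrite inE.
exact: law.
Qed.

End gauss_def.

Section gumbel_taylor.
Context {R : realType}.

Lemma variation_le_derive (g dg : R -> R) (K : R) :
  (forall x, is_derive x (1 : R) g (dg x)) ->
  (forall x, x \in `[0, 1] -> `|dg x| <= K) ->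
  forall t, t \in `[0, 1] -> `|g t - g 0| <= K * t.
Proof.
move=> gdg K0 t; rewrite in_itv/= => /andP[t0 t1].
have Hc : {within `[0, t], continuous g}.
  by apply: derivable_within_continuous => y _; exact: ex_derive.
have [c c0t ->] := @MVT_segment R g dg 0 t t0 (fun x _ => gdg x) Hc.
rewrite subr0 normrM (ger0_norm t0) ler_wpM2r// K0//.
move: c0t; rewrite !in_itv/= => /andP[c0 ct].
by rewrite c0 (le_trans ct).
Qed.

Lemma taylor3_le (g g1 g2 g3 : R -> R) (K : R) :
  (forall x, is_derive x (1 : R) g (g1 x)) ->
  (forall x, is_derive x (1 : R) g1 (g2 x)) ->
  (forall x, is_derive x (1 : R) g2 (g3 x)) ->
  (forall x, x \in `[0, 1] -> `|g3 x| <= K) ->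
  `|g 1 - g 0 - g1 0 - g2 0 / 2| <= K.
Proof.
move=> d1 d2 d3 K3.
have I01 : (1 : R) \in `[0, 1] by rewrite in_itv/= ler01 lexx.
have K0 : 0 <= K by apply: le_trans (K3 _ I01).
have leK t : t \in `[0, 1] -> K * t <= K.
  by rewrite in_itv/= => /andP[t0 t1]; rewrite ler_piMr.
have H2 x : x \in `[0, 1] -> `|g2 x - g2 0| <= K.
  by move=> x01; apply: le_trans (leK _ x01); exact: (variation_le_derive d3).
pose h1 := g1 - (fun x => x * g2 0).
have dh1 x : is_derive x (1 : R) h1 (g2 x - g2 0).
  by apply: is_deriveB; apply: is_derive_eq; rewrite scaler0 add0r scaler1 ?mul1r//= mulrC /= ?scale1r.
have H1 x : x \in `[0, 1] -> `|g1 x - x * g2 0 - g1 0| <= K.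
  move=> x01; apply: le_trans (leK _ x01).
  have := variation_le_derive dh1 H2 x01.
  by rewrite /h1 !fctE mul0r subr0.
pose h0 := g - (fun x => x * g1 0) - (fun x => x ^+ 2 * (g2 0 / 2)).
have dh0 x : is_derive x (1 : R) h0 (g1 x - x * g2 0 - g1 0).
  rewrite addrAC; apply: is_deriveB.
    by apply: is_deriveB; apply: is_derive_eq; rewrite scaler0 add0r scaler1.
  apply: is_derive_eq; rewrite scaler0 add0r /= /GRing.scale/=; by field.
have := variation_le_derive dh0 H1 I01.
rewrite /h0 !fctE expr1n expr0n !mul0r !subr0 !mul1r mulr1.
congr (`| _ | <= _); ring.
Qed.

Let expR_pow_le k (S : R) : 0 <= S -> S ^+ k.+1 * expR (- S) <= k.+1`!%:R.
Proof.
move=> S0; rewrite expRN ler_pdivrMr ?expR_gt0//.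
have F0 : (0 : R) < k.+1`!%:R by rewrite ltr0n fact_gt0.
rewrite mulrC -ler_pdivrMr//; apply: le_trans (expR_ge1Dxn k S0).
by rewrite lerDr.
Qed.

Definition gumbel N (y : 'I_N -> R) : R := expR (- \sum_a expR (y a)).

(* The bound is uniform in [x] because [S^j exp(-S)] is bounded on [S >= 0]. *)
Lemma gumbel_taylor N (x h : 'I_N -> R) :
  `| gumbel (fun a => x a + h a) - gumbel x
     + gumbel x * (\sum_a expR (x a) * h a)
     - gumbel x * ((\sum_a expR (x a) * h a) ^+ 2
                   - \sum_a expR (x a) * h a ^+ 2) / 2 |
  <= 13 * \sum_a `|h a| ^+ 3.
Proof.
pose e a := expR (x a); set f := @gumbel N.
pose S j t := \sum_a e a * h a ^+ j * expR (h a * t).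
have dS j t : is_derive t (1 : R) (S j) (S j.+1 t).
  have -> : S j = \sum_a (fun t => e a * h a ^+ j * expR (h a * t)).
    by apply/funext => u; rewrite fct_sumE.
  apply: is_derive_sum => a.
  have E : (fun t => e a * h a ^+ j * expR (h a * t)) = (e a * h a ^+ j) *: (expR \o ( *%R (h a))).
    by apply/funext => u.
  rewrite E; have D : is_derive t (1 : R) ( *%R (h a)) (h a).
    have -> : *%R (h a) = h a *: (@id R) by apply/funext => u.
    by apply: is_derive_eq; rewrite scaler1.
  apply: is_derive_eq; rewrite /GRing.scale/= exprSr; ring.
pose p t := expR (- S 0 t).
have dp t : is_derive t (1 : R) p (- S 1 t * p t).
  have -> : p = expR \o (- S 0) by apply/funext.
  by apply: is_derive_eq; rewrite mulrC.
have d1 t : is_derive t (1 : R) (fun t => - S 1 t * p t) ((S 1 t ^+ 2 - S 2 t) * p t).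
  have -> : (fun t => - S 1 t * p t) = (- S 1) * p by apply/funext.
  apply: is_derive_eq; rewrite /GRing.scale/= fctE; ring.
have d2 t : is_derive t (1 : R) (fun t => (S 1 t ^+ 2 - S 2 t) * p t)
    ((- S 1 t ^+ 3 + 3 * S 1 t * S 2 t - S 3 t) * p t).
  have -> : (fun t => (S 1 t ^+ 2 - S 2 t) * p t) = (S 1 ^+ 2 - S 2) * p.
    by apply/funext => u; rewrite !fctE.
  apply: is_derive_eq; rewrite /GRing.scale/= !fctE; ring.
pose H := \sum_a `|h a|.
have H0 : 0 <= H by apply: sumr_ge0.
pose M := \big[Order.max/0]_a `|h a|.
have hM a : `|h a| <= M by apply: le_bigmax.
have M0 : 0 <= M by apply: bigmax_ge_id.
have M3 : M ^+ 3 <= \sum_a `|h a| ^+ 3.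
  have [|[a ->]] : M = 0 \/ exists a, M = `|h a|.
  - rewrite /M; elim/big_ind : _ => [|u v IHu IHv|a _]; [by left| |by right; exists a].
    by rewrite /Order.max; case: ifP.
  - by move=> ->; rewrite expr0n/= sumr_ge0// => a _; rewrite exprn_ge0.
  - by rewrite (bigD1 a)//= lerDl sumr_ge0// => b _; rewrite exprn_ge0.
have S00 t : 0 <= S 0 t.
  by apply: sumr_ge0 => a _; rewrite expr0 mulr1 mulr_ge0 ?expR_ge0.
have Sj j t : `|S j t| <= M ^+ j * S 0 t.
  rewrite mulr_sumr; apply: le_trans (ler_norm_sum _ _ _) _; apply: ler_sum => a _.
  rewrite !normrM !(ger0_norm (expR_ge0 _)) normrX expr0 mulr1 [M ^+ j * _]mulrA.
  rewrite ler_wpM2r ?expR_ge0// mulrC ler_wpM2r ?expR_ge0//.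
  by rewrite lerXn2r ?nnegrE.
have pE : f x = p 0.
  by rewrite /f /gumbel /p /S; congr expR; congr (- _); apply: eq_bigr => a _; rewrite expr0 mulr1 mulr0 expR0 mulr1.
have p1E : f (fun a => x a + h a) = p 1.
  rewrite /f /gumbel /p /S; congr expR; congr (- _); apply: eq_bigr => a _.
  by rewrite expr0 mulr1 mulr1 expRD.
have SE j : S j 0 = \sum_a e a * h a ^+ j.
  by apply: eq_bigr => a _; rewrite mulr0 expR0 mulr1.
apply: (@le_trans _ _ (13 * M ^+ 3)); last by rewrite ler_wpM2l.
have S1E : \sum_a expR (x a) * h a = S 1 0.
  by rewrite SE; apply: eq_bigr => a _; rewrite expr1.
have S2E : \sum_a expR (x a) * h a ^+ 2 = S 2 0 by rewrite SE.
rewrite S1E S2E pE p1E.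
rewrite (_ : p 1 - p 0 + p 0 * S 1 0 - p 0 * (S 1 0 ^+ 2 - S 2 0) / 2 =
   p 1 - p 0 - (- S 1 0 * p 0) - (S 1 0 ^+ 2 - S 2 0) * p 0 / 2); last by ring.
apply: (taylor3_le dp d1 d2) => t _; rewrite normrM (ger0_norm (expR_ge0 _)).
set s := S 0 t.
have B3 : `|- S 1 t ^+ 3 + 3 * S 1 t * S 2 t - S 3 t| <= M ^+ 3 * (s ^+ 3 + 3 * s ^+ 2 + s).
  apply: le_trans (ler_normB _ _) _; apply: le_trans (lerD (ler_normD _ _) (lexx _)) _.
  rewrite normrN normrX !normrM (ger0_norm (_ : (0 : R) <= 3))//.
  have A1 := Sj 1 t; have A2 := Sj 2 t; have A3 := Sj 3 t.
  rewrite expr1 in A1.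
  rewrite !mulrDr; apply: lerD => //; apply: lerD.
    by rewrite -exprMn lerXn2r ?nnegrE// mulr_ge0// S00.
  rewrite [leRHS](_ : _ = 3 * (M * s) * (M ^+ 2 * s)); last by ring.
  by rewrite ler_pM ?mulr_ge0// ler_wpM2l.
apply: le_trans (ler_wpM2r (expR_ge0 _) B3) _.
rewrite -mulrA mulrC ler_wpM2r ?exprn_ge0//.
have E1 := @expR_pow_le 0 s (S00 t); have E2 := @expR_pow_le 1 s (S00 t).
have E3 := @expR_pow_le 2 s (S00 t).
rewrite expr1 (_ : 1`! = 1)%N // in E1; rewrite (_ : 2`! = 2)%N // in E2; rewrite (_ : 3`! = 6)%N // in E3.
move: E1 E2 E3; rewrite -/s; set q := expR (- s) => E1 E2 E3.
have : (s ^+ 3 + 3 * s ^+ 2 + s) * q = s ^+ 3 * q + 3 * (s ^+ 2 * q) + s * q by ring.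
move=> ->; lra.
Qed.

End gumbel_taylor.

Section gauss_operator.
Context {R : realType}.
Local Open Scope ereal_scope.
Local Notation gamma1 := (@normal_prob R 0 1).

Definition gop N m (V : 'M[R]_(N, m)) (F : 'cV[R]_N -> \bar R) (x : 'cV[R]_N) :=
  \int[gauss m]_y F (x + V *m y)%R.

Definition nnm N (F : 'cV[R]_N -> \bar R) :=
  measurable_fun setT F /\ forall x, 0 <= F x.

Lemma measurable_translate N m (V : 'M[R]_(N, m)) (x : 'cV[R]_N) :
  measurable_fun setT (fun y => x + V *m y)%R.
Proof. by apply: measurable_addmx => //; exact: measurable_mulmx. Qed.

Lemma nnm_translate N m (V : 'M[R]_(N, m)) F x : nnm F -> nnm (fun y => F (x + V *m y)%R).
Proof. by move=> [mF F0]; split => //; exact: (measurableT_comp mF (measurable_translate V x)). Qed.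

Lemma nnm_gop N m (V : 'M[R]_(N, m)) F : nnm F -> nnm (gop V F).
Proof.
move=> [mF F0]; split => [|x]; last by apply: integral_ge0.
apply: (measurable_fun_fubini_tonelli_F (m2 := gauss m)
  (fun xy : 'cV[R]_N * 'cV[R]_m => F (xy.1 + V *m xy.2)%R)) => //.
apply: (measurableT_comp mF); apply: measurable_addmx; first exact: measurable_fst.
exact: measurable_mulmx measurable_snd.
Qed.

Lemma gop_comm N m m' (V : 'M[R]_(N, m)) (W : 'M[R]_(N, m')) F x : nnm F ->
  gop V (gop W F) x = gop W (gop V F) x.
Proof.
move=> [mF F0]; rewrite /gop.
have mf : measurable_fun setT
    (fun yz : 'cV[R]_m * 'cV[R]_m' => F (x + V *m yz.1 + W *m yz.2)%R).
  apply: (measurableT_comp mF); apply: measurable_addmx; last exact: measurable_mulmx measurable_snd.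
  by apply: measurable_addmx; [exact: measurable_cst|exact: measurable_mulmx measurable_fst].
transitivity (\int[gauss m']_z \int[gauss m]_y F (x + V *m y + W *m z)%R).
  exact: (@fubini_tonelli _ _ _ _ _ (gauss m) (gauss m') _ mf (fun=> F0 _)).
by apply: eq_integral => y _; apply: eq_integral => z _; rewrite addrAC.
Qed.

Lemma gop_le N m (V : 'M[R]_(N, m)) F G x : nnm F -> nnm G ->
  (forall x, F x <= G x) -> gop V F x <= gop V G x.
Proof.
move=> nF nG FG.
have [mF F0] := nnm_translate V x nF; have [mG G0] := nnm_translate V x nG.
by apply: ge0_le_integral => //.
Qed.

Lemma gop_addr N m (V : 'M[R]_(N, m)) F (c : \bar R) x : nnm F -> 0 <= c ->
  gop V (fun x => F x + c) x = gop V F x + c.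
Proof.
move=> nF c0; have [mF F0] := nnm_translate V x nF.
by rewrite /gop ge0_integralD// integral_cst_probability.
Qed.

Lemma mulmx_col_cons N m (V : 'M[R]_(N, m.+1)) z (y : 'cV[R]_m) :
  (V *m col_cons (z, y) = z *: col ord0 V + col' ord0 V *m y)%R.
Proof.
apply/colP => i; rewrite !mxE big_ord_recl col_consE unlift_none /= mulrC; congr (_ + _)%R.
by apply: eq_bigr => j _; rewrite col_consE liftK/= !mxE.
Qed.

Lemma gopS N m (V : 'M[R]_(N, m.+1)) F x : nnm F ->
  gop V F x = \int[gamma1]_z gop (col' ord0 V) F (x + z *: col ord0 V)%R.
Proof.
move=> nF; have [mF F0] := nnm_translate V x nF.
rewrite [LHS](integral_gaussS mF F0); apply: eq_integral => z _; apply: eq_integral => y _.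
by rewrite mulmx_col_cons addrA.
Qed.

Lemma measurable_line N (x v : 'cV[R]_N) : measurable_fun setT (fun z : R => x + z *: v)%R.
Proof.
apply: measurable_mxP => i j; under eq_fun do rewrite !mxE.
by apply: measurable_funD => //; apply: measurable_funM.
Qed.

Lemma gop_half N m (V : 'M[R]_(N, m)) F x (c : R) : nnm F -> (c ^+ 2 + c ^+ 2 = 1)%R ->
  gop (c *: V) (gop (c *: V) F) x = gop V F x.
Proof.
move=> + c1; elim: m V F x => [|m IH] V F x nF.
  rewrite /gop; transitivity (\int[gauss 0]_y \int[gauss 0]_z F (x + V *m z)%R).
    apply: eq_integral => y _; apply: eq_integral => z _.
    by congr (F _); apply/colP => i; rewrite !mxE !big_ord0 !addr0.
  by rewrite integral_cst_probability.
have E : col' ord0 (c *: V)%R = (c *: col' ord0 V)%R by apply/matrixP => i j; rewrite !mxE.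
have E' : col ord0 (c *: V)%R = (c *: col ord0 V)%R by apply/matrixP => i j; rewrite !mxE.
have nV := nnm_gop (c *: col' ord0 V)%R nF.
rewrite !(gopS _ _ nF) gopS; last exact: nnm_gop.
rewrite E E'; set v := col ord0 V; set W := col' ord0 V.
pose H := gop W F; have [mH H0] : nnm H by exact: nnm_gop.
transitivity (\int[gamma1]_z \int[gamma1]_z' H (x + z *: (c *: v) + z' *: (c *: v))%R).
  apply: eq_integral => z _.
  have [mG G0] := nV.
  have step x0 y : gop (c *: V) F (x0 + (c *: W) *m y)%R =
      \int[gamma1]_z' gop (c *: W) F (x0 + z' *: (c *: v) + (c *: W) *m y)%R.
    rewrite [LHS](gopS (c *: V)%R (x0 + (c *: W) *m y)%R nF) E E' -/v -/W.
    by apply: eq_integral => z' _; rewrite addrAC.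
  transitivity (\int[gauss m]_y \int[gamma1]_z' gop (c *: W) F (x + z *: (c *: v) + z' *: (c *: v) + (c *: W) *m y)%R).
    by rewrite {1}/gop; apply: eq_integral => y _; exact: step.
  have mf : measurable_fun setT (fun zy : measurableTypeR R * 'cV[R]_m =>
      gop (c *: W) F (x + z *: (c *: v) + zy.1 *: (c *: v) + (c *: W) *m zy.2)%R).
    apply: (measurableT_comp mG); apply: measurable_addmx; last first.
      exact: measurable_mulmx measurable_snd.
    apply: (measurableT_comp (@measurable_line N (x + z *: (c *: v))%R (c *: v)%R)).
    exact: measurable_fst.
  transitivity (\int[gamma1]_z' \int[gauss m]_y gop (c *: W) F (x + z *: (c *: v) + z' *: (c *: v) + (c *: W) *m y)%R).
    exact: (esym (@fubini_tonelli _ _ _ _ _ gamma1 (gauss m) _ mf (fun=> G0 _))).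
  by apply: eq_integral => z' _; exact: IH.
transitivity (\int[gamma1]_z \int[gamma1]_z' H (x + (c * z' + c * z) *: v)%R).
  apply: eq_integral => z _; apply: eq_integral => z' _; congr (H _).
  by rewrite !scalerA -addrA -scalerDl [(z * c)%R]mulrC [(z' * c)%R]mulrC [(c * z + _)%R]addrC.
have mL := measurable_line x v.
have mHL : measurable_fun setT (fun u : R => H (x + u *: v)%R) by exact: (measurableT_comp mH).
transitivity (\int[gamma1]_z (fun u : R => H (x + u *: v)%R) (Num.sqrt (c ^+ 2 + c ^+ 2) * z)%R).
  exact: (normal_stability c c mHL (fun u : R => H0 _)).
by rewrite c1 sqrtr1; apply: eq_integral => z _; rewrite mul1r.
Qed.

Lemma gauss_sym m (f : 'cV[R]_m -> \bar R) :
  measurable_fun setT f -> (forall x, 0 <= f x) ->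
  \int[gauss m]_y f (- y)%R = \int[gauss m]_y f y.
Proof.
elim: m f => [|m IH] f mf f0.
  by apply: eq_integral => y _; congr f; apply/colP => -[].
have mN n : measurable_fun setT (fun y : 'cV[R]_n => - y)%R.
  apply: measurable_mxP => i j; under eq_fun do rewrite mxE.
  by apply: measurableT_comp => //; exact: measurable_mx_entry.
have mfc : measurable_fun setT (fun zy : measurableTypeR R * 'cV[R]_m => f (col_cons zy)).
  by apply: (measurableT_comp mf); exact: measurable_funPT.
have mfN : measurable_fun setT (fun y : 'cV[R]_m.+1 => f (- y)%R) by exact: (measurableT_comp mf (mN _)).
rewrite [LHS](integral_gaussS mfN (fun y => f0 _)) [RHS](integral_gaussS mf f0).
have NE z (y : 'cV[R]_m) : (- col_cons (z, y) = col_cons (- z, - y))%R.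
  apply/colP => i; rewrite mxE !col_consE.
  by case: (unlift ord0 i) => [k|]//=; rewrite mxE.
transitivity (\int[gamma1]_z (fun z' => \int[gauss m]_y f (col_cons (z', y))) (- z)%R).
  apply: eq_integral => z _; under eq_integral do rewrite NE.
  apply: (IH (fun y => f (col_cons (- z, y)%R))) => //.
  exact: (measurableT_comp mfc (measurable_pair1 (- z)%R)).
apply: normal_prob_sym; last by move=> z; apply: integral_ge0.
exact: (measurable_fun_fubini_tonelli_F (m2 := gauss m) _ mfc).
Qed.

Lemma integral_expR_sqr4 : \int[gamma1]_z (expR (z ^+ 2 / 4))%:E = (Num.sqrt 2)%:E.
Proof.
rewrite integral_normal_prob//; last first.
  apply/measurable_EFinP; apply: measurableT_comp => //.
  by apply: measurable_funM => //; exact: measurable_funX.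
transitivity (\int[lebesgue_measure]_z ((Num.sqrt 2)%:E * (@normal_pdf R 0 (Num.sqrt 2) z)%:E)).
  apply: eq_integral => z _; rewrite -!EFinM; congr EFin.
  have s2 : (0 < Num.sqrt 2 :> R)%R by rewrite sqrtr_gt0.
  rewrite (normal_pdf_scale _ _ s2) mulrA divff ?gt_eqF// mul1r.
  rewrite !normal_pdf_neq0E ?oner_eq0// !subr0 mulrCA -expRD; congr (_ * expR _)%R.
  rewrite exprMn exprVn sqr_sqrtr//; by field.
transitivity ((Num.sqrt 2)%:E * \int[lebesgue_measure]_z (@normal_pdf R 0 (Num.sqrt 2) z)%:E).
  rewrite -ge0_integralZl//.
  - by apply/measurable_EFinP; exact: measurable_normal_pdf.
  - by move=> x _; rewrite lee_fin normal_pdf_ge0.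
by rewrite integral_normal_pdf mule1.
Qed.

Lemma norm_pow_integral (k : nat) : (k <= 3)%N ->
  exists2 c : R, (0 <= c)%R & \int[gamma1]_z (`|z| ^+ k)%:E = c%:E.
Proof.
move=> k3; have I0 : 0 <= \int[gamma1]_z (`|z| ^+ k)%:E.
  by apply: integral_ge0 => z _; rewrite lee_fin exprn_ge0.
suff : \int[gamma1]_z (`|z| ^+ k)%:E <= (64%:R * Num.sqrt 2)%:E.
  move: I0; case: (\int[gamma1]_z (`|z| ^+ k)%:E) => [c| |]//.
  by rewrite lee_fin => c0 _; exists c.
have mE : measurable_fun setT (fun z : R => (expR (z ^+ 2 / 4))%:E).
  apply/measurable_EFinP; apply: measurableT_comp => //.
  by apply: measurable_funM => //; exact: measurable_funX.
rewrite EFinM -integral_expR_sqr4 -ge0_integralZl//.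
apply: ge0_le_integral => //.
- by apply/measurable_EFinP; apply: (measurable_funX k (@normr_measurable R setT)).
- by apply: emeasurable_funM.
move=> z _; rewrite -EFinM lee_fin.
set u := (`|z|)%R; have u0 : (0 <= u)%R by exact: normr_ge0.
have -> : (z ^+ 2 = u ^+ 2)%R by rewrite real_normK// num_real.
have H1 : (1 + (u ^+ 2 / 4) ^+ 2 / 2%:R <= expR (u ^+ 2 / 4))%R.
  have := @expR_ge1Dxn R (u ^+ 2 / 4) 1; apply; by rewrite mulr_ge0 ?sqr_ge0.
apply: (@le_trans _ _ (64%:R * (1 + (u ^+ 2 / 4) ^+ 2 / 2%:R))%R); last by rewrite ler_wpM2l.
case: k k3 {I0} => [|[|[|[|//]]]] _; rewrite ?expr0 ?expr1.
- have := sqr_ge0 (u ^+ 2 / 4); lra.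
- have := sqr_ge0 (u - 1)%R; have := sqr_ge0 (u ^+ 2 - 1)%R; nra.
- have := sqr_ge0 (u ^+ 2 - 1)%R; nra.
- have := sqr_ge0 (u - 1)%R; have := sqr_ge0 (u ^+ 2 - u)%R; have := sqr_ge0 (u ^+ 2 - 1)%R; nra.
Qed.

End gauss_operator.

Section slepian.
Context {R : realType}.
Local Open Scope ereal_scope.
Local Notation gamma1 := (@normal_prob R 0 1).

Lemma nnm_iter N m (V : 'M[R]_(N, m)) k F : nnm F -> nnm (iter k (gop V) F).
Proof. by move=> nF; elim: k => //= k IH; exact: nnm_gop. Qed.

Lemma iter_gop_comm N m m' (V : 'M[R]_(N, m)) (W : 'M[R]_(N, m')) k F x : nnm F ->
  gop V (iter k (gop W) F) x = iter k (gop W) (gop V F) x.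
Proof.
move=> nF; elim: k x => //= k IH x; rewrite gop_comm; last exact: nnm_iter.
by congr (gop W _ x); apply/funext.
Qed.

Lemma iter_gop_le N m m' (V : 'M[R]_(N, m)) (W : 'M[R]_(N, m')) k F (c : R) :
  nnm F -> (0 <= c)%R -> (forall x, gop V F x <= gop W F x + c%:E) ->
  forall x, iter k (gop V) F x <= iter k (gop W) F x + (k%:R * c)%:E.
Proof.
move=> nF c0 H; elim: k => [|k IH] x; first by rewrite mul0r adde0.
have kc0 : (0 <= k%:R * c)%R by rewrite mulr_ge0.
have nkV : nnm (iter k (gop V) F) by exact: nnm_iter.
have nkW : nnm (iter k (gop W) F) by exact: nnm_iter.
have nnm_add G (a : R) : nnm G -> (0 <= a)%R -> nnm (fun x : 'cV[R]_N => G x + a%:E).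
  move=> [mG G0] a0; split; first by apply: emeasurable_funD.
  by move=> y; rewrite adde_ge0.
apply: le_trans (gop_le V x nkV (nnm_add _ _ nkW kc0) IH) _.
rewrite gop_addr// (iter_gop_comm V W k x nF).
have -> : (k.+1%:R * c = k%:R * c + c)%R by rewrite -natr1 mulrDl mul1r.
rewrite EFinD [(k%:R * c)%:E + c%:E]addeC addeA leeD2r//.
elim: k {IH kc0 nkV nkW} x => [|k IH] x /=; first exact: H.
have nWF : nnm (iter k (gop W) (gop V F)) by apply: nnm_iter; exact: nnm_gop.
have nWW : nnm (iter k.+1 (gop W) F) by exact: nnm_iter.
apply: le_trans (gop_le W x nWF (nnm_add _ _ nWW c0) IH) _.
by rewrite gop_addr.
Qed.

Definition sqrt_half : R := Num.sqrt 2^-1.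
Local Notation c := sqrt_half.

Lemma sqrt_half2 : (c ^+ 2 + c ^+ 2 = 1)%R.
Proof. by rewrite sqr_sqrtr ?invr_ge0//; lra. Qed.

Lemma iter_gop_half N m (V : 'M[R]_(N, m)) F r x : nnm F ->
  iter (2 ^ r) (gop (c ^+ r *: V)) F x = gop V F x.
Proof.
move=> nF; elim: r V x => [|r IH] V x; first by rewrite expr0 scale1r.
rewrite -(IH V x).
have -> : (2 ^ r.+1 = 2 ^ r * 2)%N by rewrite expnSr.
move: (2 ^ r)%N => j; elim: j x => [//|k IHk] x.
rewrite mulSn /=.
have nI : nnm (iter (k * 2) (gop (c ^+ r.+1 *: V)) F) by exact: nnm_iter.
have -> : c ^+ r.+1 *: V = c *: (c ^+ r *: V) by rewrite scalerA -exprS.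
rewrite [LHS](gop_half (c ^+ r *: V) x _ sqrt_half2); last first.
  by have := nI; rewrite exprS scalerA.
by congr (gop _ _ x); apply/funext => y; rewrite -IHk exprS scalerA.
Qed.

Definition gumbelv N (x : 'cV[R]_N) : R := gumbel (fun a => x a ord0).

Lemma gumbelv_ge0 N (x : 'cV[R]_N) : (0 <= gumbelv x)%R.
Proof. exact: expR_ge0. Qed.

Lemma gumbelv_le1 N (x : 'cV[R]_N) : (gumbelv x <= 1)%R.
Proof. by rewrite expR_le1 oppr_le0 sumr_ge0// => a _; exact: expR_ge0. Qed.

Lemma measurable_gumbelv N : measurable_fun setT (@gumbelv N).
Proof.
apply: measurableT_comp => //; apply: measurableT_comp => //.
apply: measurable_sum => a; apply: measurableT_comp => //.
exact: measurable_mx_entry.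
Qed.

Lemma nnm_gumbelv N : nnm (EFin \o @gumbelv N).
Proof.
split; first by apply/measurable_EFinP; exact: measurable_gumbelv.
by move=> x; rewrite lee_fin gumbelv_ge0.
Qed.

Lemma mulmx_dotv N m (V : 'M[R]_(N, m)) (y : 'cV[R]_m) a :
  ((V *m y) a ord0 = dotv (row a V)^T y)%R.
Proof. by rewrite dotvE mxE; apply: eq_bigr => j _; rewrite !mxE. Qed.

Lemma dotv_trmx_mul N m (V : 'M[R]_(N, m)) (e : 'cV[R]_N) (y : 'cV[R]_m) :
  dotv (V^T *m e) y = dotv e (V *m y).
Proof. by rewrite /dotv trmx_mul trmxK mulmxA. Qed.

Lemma sqr_l2norm_row N m (V : 'M[R]_(N, m)) a :
  (l2norm (row a V)^T ^+ 2 = (V *m V^T) a a)%R.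
Proof. by rewrite sqr_l2norm dotvE mxE; apply: eq_bigr => j _; rewrite !mxE. Qed.

Lemma gauss_dotv_norm_pow m (w : 'cV[R]_m) k (kap : R) :
  \int[gamma1]_z (`|z| ^+ k)%:E = kap%:E ->
  \int[gauss m]_y (`|dotv w y| ^+ k)%:E = (l2norm w ^+ k * kap)%:E.
Proof.
move=> kE.
have mk : measurable_fun setT (fun z : R => (`|z| ^+ k)%:E).
  by apply/measurable_EFinP; apply: (measurable_funX k (@normr_measurable R setT)).
rewrite (@gauss_dotv R m w (fun z => (`|z| ^+ k)%:E))//.
rewrite EFinM -kE -ge0_integralZl//; last by rewrite lee_fin exprn_ge0// l2norm_ge0.
apply: eq_integral => z _; rewrite normrM exprMn (ger0_norm (l2norm_ge0 w)).
by rewrite EFinM.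
Qed.

Definition nn_measurable m (f : 'cV[R]_m -> R) :=
  measurable_fun setT f /\ forall y, (0 <= f y)%R.

Lemma gauss_integralD m (f g : 'cV[R]_m -> R) :
  nn_measurable f -> nn_measurable g ->
  \int[gauss m]_y (f y + g y)%:E = \int[gauss m]_y (f y)%:E + \int[gauss m]_y (g y)%:E.
Proof.
move=> [mf f0] [mg g0].
have := @ge0_integralD _ _ _ (gauss m) setT measurableT (EFin \o f) (EFin \o g).
apply; first by move=> y _; rewrite lee_fin.
- exact/measurable_EFinP.
- by move=> y _; rewrite lee_fin.
- exact/measurable_EFinP.
Qed.

Lemma gauss_integralZ m (f : 'cV[R]_m -> R) (k : R) :
  nn_measurable f -> (0 <= k)%R ->
  \int[gauss m]_y (k * f y)%:E = k%:E * \int[gauss m]_y (f y)%:E.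
Proof.
move=> [mf f0] k0.
have mf' : measurable_fun setT (EFin \o f) by exact/measurable_EFinP.
rewrite -(@ge0_integralZl _ _ _ (gauss m) _ measurableT _ mf')//; last by move=> y _; rewrite lee_fin.
Qed.

Lemma gauss_integral_le m (f g : 'cV[R]_m -> R) :
  nn_measurable f -> nn_measurable g -> (forall y, f y <= g y)%R ->
  \int[gauss m]_y (f y)%:E <= \int[gauss m]_y (g y)%:E.
Proof.
move=> [mf f0] [mg g0] fg; apply: ge0_le_integral => //.
- by move=> y _; rewrite lee_fin.
- exact/measurable_EFinP.
- exact/measurable_EFinP.
- by move=> y _; rewrite lee_fin.
Qed.

Lemma nn_measurableD m (f g : 'cV[R]_m -> R) :
  nn_measurable f -> nn_measurable g -> nn_measurable (fun y => f y + g y)%R.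
Proof.
by move=> [mf f0] [mg g0]; split => [|y]; [exact: measurable_funD|rewrite addr_ge0].
Qed.

Lemma nn_measurableZ m (f : 'cV[R]_m -> R) (k : R) :
  nn_measurable f -> (0 <= k)%R -> nn_measurable (fun y => k * f y)%R.
Proof.
by move=> [mf f0] k0; split => [|y]; [exact: measurable_funM|rewrite mulr_ge0].
Qed.

Lemma nn_measurable_cst m (k : R) : (0 <= k)%R -> nn_measurable (fun _ : 'cV[R]_m => k).
Proof. by move=> k0; split. Qed.

Lemma nn_measurable_sum m N (f : 'I_N -> 'cV[R]_m -> R) :
  (forall a, nn_measurable (f a)) -> nn_measurable (fun y => \sum_a f a y)%R.
Proof.
move=> nf; split; first by apply: measurable_sum => a; have [] := nf a.
by move=> y; rewrite sumr_ge0// => a _; have [_] := nf a; apply.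
Qed.

Lemma gauss_integral_sum m N (f : 'I_N -> 'cV[R]_m -> R) :
  (forall a, nn_measurable (f a)) ->
  \int[gauss m]_y (\sum_a f a y)%:E = \sum_a \int[gauss m]_y (f a y)%:E.
Proof.
move=> nf; under eq_integral do rewrite -sumEFin.
have := @ge0_integral_sum _ _ _ (gauss m) setT measurableT _ (fun a y => (f a y)%:E).
apply => [a|a y _]; first by apply/measurable_EFinP; have [] := nf a.
by rewrite lee_fin; have [_] := nf a; apply.
Qed.

Let norm_two_sided (t q1 q2 r g : R) : (`|t - 2 * g - (q1 - q2)| <= r ->
  t + q2 <= 2 * g + q1 + r /\ 2 * g + q1 <= t + q2 + r)%R.
Proof. rewrite ler_norml => /andP[h1 h2]; split; lra. Qed.

Section one_step.
Variables (N m : nat) (V : 'M[R]_(N, m)) (x : 'cV[R]_N) (k2 k3 : R).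
Hypothesis k2E : \int[gamma1]_z (`|z| ^+ 2)%:E = k2%:E.
Hypothesis k3E : \int[gamma1]_z (`|z| ^+ 3)%:E = k3%:E.

Let e := (\col_a expR (x a ord0))%R : 'cV[R]_N.
Let A := fine (gop V (EFin \o @gumbelv N) x).
Let Q1 : R := (gumbelv x * (k2 * l2norm (V^T *m e) ^+ 2))%R.
Let Q2 : R := (gumbelv x * (k2 * \sum_a e a ord0 * l2norm (row a V)^T ^+ 2))%R.
Let E3 : R := (26 * (k3 * \sum_a l2norm (row a V)^T ^+ 3))%R.

Let mV a : measurable_fun setT (fun y : 'cV[R]_m => (V *m y) a ord0)%R.
Proof. exact: (measurableT_comp (measurable_mx_entry a ord0) (measurable_mulmx V (@measurable_id _ _ _))). Qed.

Lemma gop_gumbelv_fin : A%:E = gop V (EFin \o @gumbelv N) x.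
Proof.
rewrite fineK// ge0_fin_numE; last by apply: integral_ge0 => y _; rewrite lee_fin gumbelv_ge0.
apply: (@le_lt_trans _ _ 1); last exact: ltry.
rewrite -[leRHS](@integral_cst_probability R _ _ (gauss m)).
have [mF F0] := nnm_translate V x (nnm_gumbelv N).
by apply: ge0_le_integral => // y _; rewrite lee_fin gumbelv_le1.
Qed.

Let T (y : 'cV[R]_m) := (gumbelv (x + V *m y) + gumbelv (x - V *m y))%R.
Let q1 (y : 'cV[R]_m) := (gumbelv x * dotv (V^T *m e) y ^+ 2)%R.
Let q2 (y : 'cV[R]_m) := (gumbelv x * \sum_a e a ord0 * (V *m y) a ord0 ^+ 2)%R.
Let r3 (y : 'cV[R]_m) := (26 * \sum_a `|(V *m y) a ord0| ^+ 3)%R.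

Let taylor y : (`|T y - 2 * gumbelv x - (q1 y - q2 y)| <= r3 y)%R.
Proof.
have := @gumbel_taylor R N (fun a => x a ord0) (fun a => (V *m y)%R a ord0).
have := @gumbel_taylor R N (fun a => x a ord0) (fun a => (- (V *m y)%R a ord0)%R).
have E1 : gumbel (fun a => x a ord0 + (V *m y)%R a ord0)%R = gumbelv (x + V *m y)%R.
  by rewrite /gumbelv; congr gumbel; apply/funext => a; rewrite [RHS]mxE.
have E2 : gumbel (fun a => x a ord0 + - (V *m y)%R a ord0)%R = gumbelv (x - V *m y)%R.
  by rewrite /gumbelv; congr gumbel; apply/funext => a; rewrite [RHS]mxE; congr (_ + _)%R; rewrite [RHS]mxE.
rewrite E1 E2 -/(gumbelv x) /T /q1 /q2 /r3 dotv_trmx_mul dotvE.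
have -> : (\sum_j e j ord0 * (V *m y) j ord0 = \sum_a expR (x a ord0) * (V *m y) a ord0)%R.
  by apply: eq_bigr => a _; rewrite mxE.
have -> : (\sum_a e a ord0 * (V *m y) a ord0 ^+ 2 = \sum_a expR (x a ord0) * (V *m y) a ord0 ^+ 2)%R.
  by apply: eq_bigr => a _; rewrite mxE.
have -> : (\sum_a expR (x a ord0) * - (V *m y) a ord0 = - \sum_a expR (x a ord0) * (V *m y) a ord0)%R.
  by rewrite -sumrN; apply: eq_bigr => a _; rewrite mulrN.
have -> : (\sum_a expR (x a ord0) * (- (V *m y) a ord0) ^+ 2 = \sum_a expR (x a ord0) * (V *m y) a ord0 ^+ 2)%R.
  by apply: eq_bigr => a _; rewrite sqrrN.
have -> : (\sum_a `|- (V *m y) a ord0| ^+ 3 = \sum_a `|(V *m y) a ord0| ^+ 3)%R.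
  by apply: eq_bigr => a _; rewrite normrN.
set S := (\sum_a expR (x a ord0) * (V *m y) a ord0)%R.
set S2 := (\sum_a expR (x a ord0) * (V *m y) a ord0 ^+ 2)%R.
set S3 := (\sum_a `|(V *m y) a ord0| ^+ 3)%R.
set f := gumbelv x; set fp := gumbelv _; set fm := gumbelv _.
rewrite sqrrN mulrN => H1 H2.
have -> : (fm + fp - 2 * f - (f * S ^+ 2 - f * S2) =
   (fm - f + f * S - f * (S ^+ 2 - S2) / 2) + (fp - f - f * S - f * (S ^+ 2 - S2) / 2))%R by field.
apply: le_trans (ler_normD _ _) _; apply: le_trans (lerD H2 H1) _.
by rewrite -mulrDl -natrD.
Qed.

Let nn_gumbel : nn_measurable (fun y => gumbelv (x + V *m y)%R).
Proof.
split => [|y]; last exact: gumbelv_ge0.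
exact: (measurableT_comp (@measurable_gumbelv N) (measurable_translate V x)).
Qed.

Let nn_gumbelN : nn_measurable (fun y => gumbelv (x - V *m y)%R).
Proof.
split => [|y]; last exact: gumbelv_ge0.
have -> : (fun y : 'cV[R]_m => gumbelv (x - V *m y)%R) = (fun y => gumbelv (x + (- V) *m y)%R).
  by apply/funext => y; rewrite mulNmx.
exact: (measurableT_comp (@measurable_gumbelv N) (measurable_translate (- V)%R x)).
Qed.

Let nn_pow a k : nn_measurable (fun y => `|(V *m y) a ord0| ^+ k)%R.
Proof.
split => [|y]; last by rewrite exprn_ge0.
by apply: measurable_funX; apply: (measurableT_comp (@normr_measurable R setT)).
Qed.

Let nn_dot : nn_measurable (fun y => `|dotv (V^T *m e) y| ^+ 2)%R.
Proof.
split => [|y]; last by rewrite exprn_ge0.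
apply: measurable_funX; apply: (measurableT_comp (@normr_measurable R setT)).
exact: (measurable_dotv _ (@measurable_id _ _ _)).
Qed.

Let e0 a : (0 <= e a ord0)%R. Proof. by rewrite mxE expR_ge0. Qed.

Let nnT : nn_measurable T. Proof. exact: nn_measurableD. Qed.

Let q1E : q1 = (fun y => gumbelv x * `|dotv (V^T *m e) y| ^+ 2)%R.
Proof. by apply/funext => y; rewrite /q1 real_normK// num_real. Qed.

Let q2E : q2 = (fun y => gumbelv x * \sum_a e a ord0 * `|(V *m y) a ord0| ^+ 2)%R.
Proof.
apply/funext => y; rewrite /q2; congr (_ * _)%R; apply: eq_bigr => a _.
by rewrite real_normK// num_real.
Qed.

Let nn_sum : nn_measurable (fun y => \sum_a e a ord0 * `|(V *m y) a ord0| ^+ 2)%R.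
Proof. by apply: nn_measurable_sum => a; exact: nn_measurableZ. Qed.

Let nnq1 : nn_measurable q1.
Proof. by rewrite q1E; apply: nn_measurableZ => //; exact: gumbelv_ge0. Qed.

Let nnq2 : nn_measurable q2.
Proof. by rewrite q2E; apply: nn_measurableZ => //; exact: gumbelv_ge0. Qed.

Let nnr3 : nn_measurable r3.
Proof. by apply: nn_measurableZ => //; exact: nn_measurable_sum. Qed.

Let iA : \int[gauss m]_y (gumbelv (x + V *m y)%R)%:E = A%:E.
Proof. exact: (esym gop_gumbelv_fin). Qed.

Let iAN : \int[gauss m]_y (gumbelv (x - V *m y)%R)%:E = A%:E.
Proof.
have [mF F0] := nnm_translate V x (nnm_gumbelv N).
apply: etrans iA; apply: etrans (gauss_sym mF F0).
by apply: eq_integral => y _; rewrite mulmxN.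
Qed.

Let iT : \int[gauss m]_y (T y)%:E = (2 * A)%:E.
Proof.
apply: etrans (gauss_integralD nn_gumbel nn_gumbelN) _.
by apply: etrans (f_equal2 (fun a b => a + b) iA iAN) _; rewrite /= mulr_natl mulr2n EFinD.
Qed.

Let iq1 : \int[gauss m]_y (q1 y)%:E = Q1%:E.
Proof.
rewrite q1E [LHS](gauss_integralZ nn_dot (gumbelv_ge0 x)).
by rewrite (gauss_dotv_norm_pow _ k2E) -EFinM /Q1 [(k2 * _)%R]mulrC.
Qed.

Let iq2 : \int[gauss m]_y (q2 y)%:E = Q2%:E.
Proof.
rewrite q2E [LHS](gauss_integralZ nn_sum (gumbelv_ge0 x)).
rewrite (@gauss_integral_sum _ _ (fun a y => e a ord0 * `|(V *m y) a ord0| ^+ 2)%R); last first.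
  by move=> a; exact: nn_measurableZ.
rewrite /Q2 mulr_sumr EFinM -sumEFin; congr (_ * _); apply: eq_bigr => a _.
rewrite [LHS](gauss_integralZ (nn_pow a 2) (e0 a)).
have -> : \int[gauss m]_y (`|(V *m y) a ord0|%R ^+ 2)%:E = \int[gauss m]_y (`|dotv (row a V)^T y|%R ^+ 2)%:E.
  by apply: eq_integral => y _; rewrite mulmx_dotv.
rewrite (gauss_dotv_norm_pow _ k2E) -EFinM; congr EFin; ring.
Qed.

Let ir3 : \int[gauss m]_y (r3 y)%:E = E3%:E.
Proof.
rewrite [LHS](gauss_integralZ (nn_measurable_sum (fun a => nn_pow a 3)))//.
rewrite (@gauss_integral_sum _ _ (fun a y => `|(V *m y) a ord0| ^+ 3)%R)//.
rewrite /E3 mulr_sumr EFinM -sumEFin; congr (_ * _); apply: eq_bigr => a _.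
have -> : \int[gauss m]_y (`|(V *m y) a ord0|%R ^+ 3)%:E = \int[gauss m]_y (`|dotv (row a V)^T y|%R ^+ 3)%:E.
  by apply: eq_integral => y _; rewrite mulmx_dotv.
by rewrite (gauss_dotv_norm_pow _ k3E) mulrC.
Qed.

Let g0 : (0 <= 2 * gumbelv x)%R. Proof. by rewrite mulr_ge0// gumbelv_ge0. Qed.

Let icst : \int[gauss m]_y (2 * gumbelv x)%:E = (2 * gumbelv x)%:E.
Proof. exact: integral_cst_probability. Qed.

Lemma gop_gumbelv_le : (2 * A + Q2 <= 2 * gumbelv x + Q1 + E3)%R.
Proof.
have nc := nn_measurable_cst m g0.
have ncq := nn_measurableD nc nnq1.
have lhs : \int[gauss m]_y (T y + q2 y)%:E = (2 * A + Q2)%:E.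
  by apply: etrans (gauss_integralD nnT nnq2) _; rewrite EFinD; exact: f_equal2.
have rhs : \int[gauss m]_y (2 * gumbelv x + q1 y + r3 y)%:E = (2 * gumbelv x + Q1 + E3)%:E.
  apply: etrans (gauss_integralD ncq nnr3) _; rewrite EFinD; apply: f_equal2 => //.
  by apply: etrans (gauss_integralD nc nnq1) _; rewrite EFinD; exact: f_equal2.
rewrite -lee_fin -lhs -rhs.
apply: gauss_integral_le; [exact: nn_measurableD|exact: nn_measurableD|].
by move=> y; have /norm_two_sided[] := taylor y.
Qed.

Lemma gop_gumbelv_ge : (2 * gumbelv x + Q1 <= 2 * A + Q2 + E3)%R.
Proof.
have nc := nn_measurable_cst m g0.
have ncq := nn_measurableD nnT nnq2.
have lhs : \int[gauss m]_y (2 * gumbelv x + q1 y)%:E = (2 * gumbelv x + Q1)%:E.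
  by apply: etrans (gauss_integralD nc nnq1) _; rewrite EFinD; exact: f_equal2.
have rhs : \int[gauss m]_y (T y + q2 y + r3 y)%:E = (2 * A + Q2 + E3)%:E.
  apply: etrans (gauss_integralD ncq nnr3) _; rewrite EFinD; apply: f_equal2 => //.
  by apply: etrans (gauss_integralD nnT nnq2) _; rewrite EFinD; exact: f_equal2.
rewrite -lee_fin -lhs -rhs.
apply: gauss_integral_le; [exact: nn_measurableD|exact: nn_measurableD|].
by move=> y; have /norm_two_sided[] := taylor y.
Qed.

End one_step.
End slepian.

Section slepian2.
Context {R : realType}.
Local Open Scope ereal_scope.
Local Notation gamma1 := (@normal_prob R 0 1).
Local Notation c := (@sqrt_half R).

Let sqr_l2norm_trmx_mul N m (V : 'M[R]_(N, m)) (e : 'cV[R]_N) :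
  (l2norm (V^T *m e) ^+ 2 = \sum_a \sum_b e a ord0 * e b ord0 * (V *m V^T) a b)%R.
Proof.
rewrite sqr_l2norm dotv_trmx_mul mulmxA dotvE; apply: eq_bigr => a _.
rewrite mxE mulr_sumr; apply: eq_bigr => b _; rewrite -mulrA; congr (_ * _)%R.
by rewrite mulrC.
Qed.

Let lin_combine (A B q2 f qv qw e : R) :
  (2 * A + q2 <= 2 * f + qv + e -> 2 * f + qw <= 2 * B + q2 + e -> qv <= qw -> A <= B + e)%R.
Proof. lra. Qed.

Lemma gop_gumbelv_compare N m m' (V : 'M[R]_(N, m)) (W : 'M[R]_(N, m')) x :
  (forall a, (V *m V^T) a a = (W *m W^T) a a) ->
  (forall a b, (V *m V^T) a b <= (W *m W^T) a b)%R ->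
  gop V (EFin \o @gumbelv R N) x <= gop W (EFin \o @gumbelv R N) x.
Proof.
move=> Hd Hle.
have [k2 k20 k2E] := @norm_pow_integral R 2 isT.
have [k3 k30 k3E] := @norm_pow_integral R 3 isT.
have sc (n : nat) (M : 'M[R]_(N, n)) (u : R) : ((u *: M) *m (u *: M)^T = u ^+ 2 *: (M *m M^T))%R.
  by rewrite linearZ /= -scalemxAl -scalemxAr scalerA expr2.
have rn (n : nat) (M : 'M[R]_(N, n)) (u : R) a : (0 <= u)%R ->
    (l2norm (row a (u *: M))^T = u * l2norm (row a M)^T)%R.
  move=> u0; apply/eqP; rewrite -(@eqrXn2 _ 2) ?l2norm_ge0 ?mulr_ge0 ?l2norm_ge0//.
  by rewrite exprMn !sqr_l2norm_row sc mxE.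
have VW a : (l2norm (row a V)^T = l2norm (row a W)^T)%R.
  by apply/eqP; rewrite -(@eqrXn2 _ 2) ?l2norm_ge0// !sqr_l2norm_row Hd.
pose K : R := (26 * (k3 * \sum_a l2norm (row a V)^T ^+ 3))%R.
have step (u : R) : (0 <= u)%R -> forall y,
    gop (u *: V) (EFin \o @gumbelv R N) y <= gop (u *: W) (EFin \o @gumbelv R N) y + (u ^+ 3 * K)%:E.
  move=> u0 y.
  have KE (n : nat) (M : 'M[R]_(N, n)) : (forall a, l2norm (row a V)^T = l2norm (row a M)^T)%R ->
     (26 * (k3 * \sum_a l2norm (row a (u *: M))^T ^+ 3) = u ^+ 3 * K)%R.
    move=> H; rewrite /K [RHS]mulrCA [X in (_ = _ * X)%R]mulrCA; congr (_ * (_ * _))%R.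
    by rewrite mulr_sumr; apply: eq_bigr => a _; rewrite rn// -H exprMn.
  have HA := gop_gumbelv_le (u *: V)%R y k2E k3E.
  have HB := gop_gumbelv_ge (u *: W)%R y k2E k3E.
  rewrite KE// in HA; rewrite KE// in HB.
  rewrite -(gop_gumbelv_fin (u *: V) y) -(gop_gumbelv_fin (u *: W) y) -EFinD lee_fin.
  set qv := (gumbelv y * (k2 * l2norm _ ^+ 2))%R in HA.
  set qw := (gumbelv y * (k2 * l2norm _ ^+ 2))%R in HB.
  set q2 := (gumbelv y * (k2 * _))%R in HA.
  set q2' := (gumbelv y * (k2 * _))%R in HB.
  have q2E : q2' = q2.
    rewrite /q2 /q2'; congr (_ * (_ * _))%R; apply: eq_bigr => a _.
    by rewrite !rn// VW.
  rewrite q2E in HB; apply: lin_combine HA HB _.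
  rewrite /qv /qw; apply: ler_wpM2l; first exact: gumbelv_ge0.
  apply: ler_wpM2l => //; rewrite !sqr_l2norm_trmx_mul; apply: ler_sum => a _; apply: ler_sum => b _.
  rewrite !sc !mxE; apply: ler_wpM2l; first by rewrite mulr_ge0// expR_ge0.
  by apply: ler_wpM2l; [exact: sqr_ge0|have := Hle a b; rewrite !mxE].
have c0 : (0 <= c)%R by exact: sqrtr_ge0.
have cE : (c ^+ 2 * 2 = 1)%R by rewrite mulr_natr mulr2n sqrt_half2.
have K0 : (0 <= K)%R by rewrite !mulr_ge0// sumr_ge0// => a _; rewrite exprn_ge0// l2norm_ge0.
have bound r : gop V (EFin \o @gumbelv R N) x <= gop W (EFin \o @gumbelv R N) x + (c ^+ r * K)%:E.
  have nF := @nnm_gumbelv R N.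
  rewrite -(iter_gop_half V r x nF) -(iter_gop_half W r x nF).
  have cr0 : (0 <= c ^+ r)%R by rewrite exprn_ge0.
  have e0 : (0 <= (c ^+ r) ^+ 3 * K)%R by rewrite mulr_ge0// exprn_ge0.
  have := iter_gop_le (2 ^ r) nF e0 (step _ cr0) x.
  move=> /le_trans; apply; apply: leeD => //; rewrite lee_fin.
  rewrite mulrA ler_wpM2r// le_eqVlt; apply/orP; left; apply/eqP.
  by rewrite natrX exprS mulrCA -exprM mulnC exprM -exprMn mulrC (mulrC 2%R) cE expr1n mul1r.
apply/lee_addgt0Pr => e e0.
have c1 : (`|c| < 1)%R.
  rewrite ger0_norm// -(@ltr_pXn2r _ 2)// ?nnegrE// expr1n; move: cE; lra.
have K1 : (0 < K + 1)%R by rewrite ltr_wpDl.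
have eK : (0 < e / (K + 1))%R by rewrite divr_gt0.
have /cvgr0_norm_lt/(_ _ eK)[r _ /(_ r (leqnn r)) /= Hr] := cvg_expr c1.
apply: le_trans (bound r) _; apply: leeD => //; rewrite lee_fin.
rewrite ger0_norm ?exprn_ge0// in Hr.
apply: (@le_trans _ _ (e / (K + 1) * K)%R); first by rewrite ler_wpM2r// ltW.
by rewrite mulrAC ler_pdivrMr// ler_wpM2l ?ltW// ltrDl.
Qed.

Let expR_ge_id (u : R) : (u <= expR u)%R.
Proof. by apply: le_trans (expR_ge1Dx u); rewrite lerDr. Qed.

(* Slepian's inequality. With [lam = (k+1)^2] and margin [1/(k+1)], the function
   [exp (- sum_a exp (lam * (y_a - t_a - 1/(k+1))))] approximates the indicator
   of the orthant. *)
Theorem slepian N m m' (V : 'M[R]_(N, m)) (W : 'M[R]_(N, m')) (t : 'I_N -> R) :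
  (forall a, (V *m V^T) a a = (W *m W^T) a a) ->
  (forall a b, (V *m V^T) a b <= (W *m W^T) a b)%R ->
  gauss m [set y | forall a, ((V *m y) a ord0 <= t a)%R] <=
  gauss m' [set y | forall a, ((W *m y) a ord0 <= t a)%R].
Proof.
move=> Hd Hle.
have mS n (M : 'M[R]_(N, n)) (u : 'I_N -> R) :
    measurable [set y : 'cV[R]_n | forall a, ((M *m y) a ord0 <= u a)%R].
  have mM : measurable_fun setT (fun y : 'cV[R]_n => M *m y)%R by exact: (measurable_mulmx M (@measurable_id _ _ _)).
  have mO := @measurable_orthant R N u.
  have -> : [set y : 'cV[R]_n | forall a, ((M *m y) a ord0 <= u a)%R] =
      [set: 'cV[R]_n] `&` (fun y => M *m y)%R @^-1` orthant u by rewrite setTI.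
  by apply: mM.
pose d k : R := (k.+1%:R^-1)%R.
have d0 k : (0 < d k)%R by rewrite invr_gt0.
pose O k := [set y : 'cV[R]_m' | forall a, ((W *m y) a ord0 <= t a + 2 * d k)%R].
set SV := [set y | forall a, _].
have gfin n (B : set 'cV[R]_n) : measurable B -> gauss n B = (fine (gauss n B))%:E.
  by move=> mB; rewrite fineK// fin_num_measure.
have key k : gauss m SV <= gauss m' (O k) + (N.+1%:R * expR (- k.+1%:R))%:E.
  pose lam : R := (k.+1%:R ^+ 2)%R.
  have lam0 : (0 <= lam)%R by rewrite exprn_ge0.
  have lamd : (lam * d k = k.+1%:R)%R by rewrite /lam /d expr2 mulfK.
  pose x : 'cV[R]_N := (\col_a (- lam * (t a + d k)))%R.
  have sc (n : nat) (M : 'M[R]_(N, n)) : ((lam *: M) *m (lam *: M)^T = lam ^+ 2 *: (M *m M^T))%R.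
    by rewrite linearZ /= -scalemxAl -scalemxAr scalerA expr2.
  have C := @gop_gumbelv_compare N m m' (lam *: V)%R (lam *: W)%R x.
  have {}C : gop (lam *: V) (EFin \o @gumbelv R N) x <= gop (lam *: W) (EFin \o @gumbelv R N) x.
    apply: C => [a|a b]; rewrite !sc !mxE; first by have := Hd a; rewrite !mxE => ->.
    by apply: ler_wpM2l; [exact: sqr_ge0|have := Hle a b; rewrite !mxE].
  have xE n (M : 'M[R]_(N, n)) y a : ((x + (lam *: M) *m y)%R a ord0 = lam * ((M *m y) a ord0 - t a - d k))%R.
    by rewrite -scalemxAl [LHS]mxE [x a ord0]mxE [X in (_ + X)%R]mxE; ring.
  have nG n (M : 'M[R]_(N, n)) : nn_measurable (fun y => gumbelv (x + M *m y)%R).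
    split => [|y]; last exact: gumbelv_ge0.
    exact: (measurableT_comp (@measurable_gumbelv R N) (measurable_translate M x)).
  have L : gauss m SV <= gop (lam *: V) (EFin \o @gumbelv R N) x + (N%:R * expR (- k.+1%:R))%:E.
    have nn := nnm_translate (lam *: V) x (@nnm_gumbelv R N).
    rewrite -(setIT SV) -integral_indic//; last exact: mS.
    rewrite -[X in _ <= _ + X](@integral_cst_probability R _ _ (gauss m)).
    have c0 : (0 <= N%:R * expR (- k.+1%:R) :> R)%R by rewrite mulr_ge0// expR_ge0.
    apply: (@le_trans _ _ (\int[gauss m]_y (gumbelv (x + (lam *: V) *m y)%R + N%:R * expR (- k.+1%:R))%:E)); last first.
      have := @gauss_integralD R m (fun y => gumbelv (x + (lam *: V) *m y)%R) (cst (N%:R * expR (- k.+1%:R))%R).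
      by move=> ->.
    apply: gauss_integral_le.
    - by split => [|y]; [by apply: measurable_indic; apply: mS|rewrite indicE].
    - by apply: nn_measurableD; [exact: nG|split].
    - move=> y; rewrite indicE; have [/set_mem ySV|_] := boolP (y \in SV); last first.
        by rewrite addr_ge0// gumbelv_ge0.
      rewrite -lerBlDr; apply: le_trans (expR_ge1Dx _).
      rewrite lerD2l lerN2 -[N in (N%:R * _)%R]card_ord -sum1_card natr_sum mulr_suml.
      apply: ler_sum => a _; rewrite mul1r ler_expR xE -lamd -mulrN; apply: ler_wpM2l => //.
      by rewrite lerBlDr addNr subr_le0; exact: ySV.
  have U : gop (lam *: W) (EFin \o @gumbelv R N) x <= gauss m' (O k) + (expR (- k.+1%:R))%:E.
    rewrite -(setIT (O k)) -integral_indic//; last exact: mS.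
    rewrite -[X in _ <= _ + X](@integral_cst_probability R _ _ (gauss m')).
    have c0 : (0 <= expR (- k.+1%:R) :> R)%R by rewrite expR_ge0.
    have nI : nn_measurable (\1_(O k) : _ -> R).
      by split => [|y]; [by apply: measurable_indic; apply: mS|rewrite indicE].
    have nE : nn_measurable (fun _ : 'cV[R]_m' => expR (- k.+1%:R) : R) by split.
    apply: (@le_trans _ _ (\int[gauss m']_y (\1_(O k) y + expR (- k.+1%:R))%:E)); last first.
      by have := @gauss_integralD R m' _ _ nI nE => ->.
    apply: gauss_integral_le => //; first exact: nn_measurableD.
    move=> y; rewrite indicE; have [_|/negP yO] := boolP (y \in O k).
      by apply: le_trans (gumbelv_le1 _) _; rewrite lerDl.
    have {}yO : ~ O k y by move=> H; apply: yO; exact: mem_set.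
    have [a ya] : exists a, (t a + 2 * d k < (W *m y) a ord0)%R.
      by apply: contra_notP yO => /forallNP H a; rewrite leNgt; apply/negP; exact: H.
    rewrite add0r ler_expR lerN2 (bigD1 a)//=; apply: le_trans (_ : _ <= expR ((x + (lam *: W) *m y)%R a ord0))%R _; last first.
      by rewrite lerDl sumr_ge0// => b _; exact: expR_ge0.
    apply: le_trans (expR_ge_id _); rewrite xE -lamd; apply: ler_wpM2l => //.
    by move: ya; lra.
  apply: le_trans L _; apply: le_trans (leeD (le_trans C U) (lexx _)) _.
  rewrite -addeA leeD2l// -EFinD lee_fin -(natr1 N) mulrDl mul1r addrC lexx//.
have -> : [set y | forall a, ((W *m y) a ord0 <= t a)%R] = \bigcap_k O k.
  apply/seteqP; split => y /= Hy.
    by move=> k _ a; apply: le_trans (Hy a) _; rewrite lerDl mulr_ge0// ltW.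
  move=> a; apply/ler_addgt0Pr => e e0.
  have [k ke] : exists k, (2 * d k <= e)%R.
    exists (Num.truncn (2 / e)).
    rewrite /d ler_pdivrMr// mulrC -ler_pdivrMr//; apply: ltW; exact: truncnS_gt.
  by apply: le_trans (Hy k I a) _; rewrite lerD2l.
have mO k : measurable (O k) by exact: (@mS m' W (fun a => t a + 2 * d k)%R).
have cvgO : gauss m' (O k) @[k --> \oo] --> gauss m' (\bigcap_k O k).
  apply: nonincreasing_cvg_mu.
  - by rewrite (le_lt_trans (probability_le1 _ _))// ?ltry//; exact: mO.
  - by move=> k; exact: mO.
  - by apply: bigcapT_measurable => k; exact: mO.
  - move=> i j ij; apply/subsetPset => y /= Hy a; apply: le_trans (Hy a) _.
    by rewrite lerD2l ler_wpM2l// lef_pV2 ?posrE// ler_nat ltnS.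
have cvgE : (N.+1%:R * expR (- k.+1%:R))%:E @[k --> \oo] --> (0 : R)%:E.
  apply: cvg_EFin; first by near=> k.
  rewrite (_ : fine \o _ = (fun k => N.+1%:R * expR (- k.+1%:R))%R); last exact/funext.
  rewrite -[X in _ --> X](mulr0 N.+1%:R); apply: cvgM; first exact: cvg_cst.
  have := @cvgn_expR R; rewrite -(cvg_shiftS (fun k => expR (- k%:R))); exact.
have cvgS : (gauss m' (O k) + (N.+1%:R * expR (- k.+1%:R))%:E) @[k --> \oo] --> gauss m' (\bigcap_k O k) + 0%:E.
  by apply: cvgeD => //; rewrite fin_num_adde_defl.
rewrite -[leRHS]adde0; apply: cvge_to_ge cvgS _.
by near=> k; exact: key.
Unshelve. all: by end_near. Qed.

End slepian2.

Lemma measure_exists_le {R : realType} d (T : measurableType d)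
    (mu : {measure set T -> \bar R}) (I : finType) (F : I -> set T) :
  (forall i, measurable (F i)) ->
  measurable [set x | exists i, F i x] /\
  (mu [set x | exists i, F i x] <= \sum_i mu (F i))%E.
Proof.
move=> mF.
have -> : [set x | exists i, F i x] = \big[setU/set0]_i F i.
  rewrite -bigcup_seq; apply/seteqP; split => x /=.
    by move=> [i Fi]; exists i => //=; rewrite mem_index_enum.
  by move=> [i _ Fi]; exists i.
elim/big_ind2 : _ => [|A a B b [mA lA] [mB lB]|i _]; first by rewrite measure0.
- split; first exact: measurableU.
  by apply: le_trans (measureU2 _ mA mB) _; exact: leeD.
- by split.
Qed.

Section gauss_consequences.
Context {R : realType}.
Local Open Scope ereal_scope.
Local Notation gamma1 := (@normal_prob R 0 1).

Lemma measurable_mulmx_self N m (V : 'M[R]_(N, m)) :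
  measurable_fun setT (fun y : 'cV[R]_m => V *m y)%R.
Proof. exact: (measurable_mulmx V (@measurable_id _ _ _)). Qed.

Lemma measurable_dotv_self m (u : 'cV[R]_m) : measurable_fun setT (dotv u).
Proof. exact: (measurable_dotv u (@measurable_id _ _ _)). Qed.

Lemma gauss_law_eq N m m' (V : 'M[R]_(N, m)) (W : 'M[R]_(N, m')) :
  (V *m V^T = W *m W^T)%R -> forall B : set 'cV[R]_N, measurable B ->
  gauss m ((fun y => V *m y)%R @^-1` B) = gauss m' ((fun y => W *m y)%R @^-1` B).
Proof.
move=> VW.
pose fV : {mfun 'cV[R]_m >-> 'cV[R]_N} := HB.pack (fun y : 'cV[R]_m => V *m y)%R
  (isMeasurableFun.Build _ _ _ _ _ (measurable_mulmx_self V)).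
pose fW : {mfun 'cV[R]_m' >-> 'cV[R]_N} := HB.pack (fun y : 'cV[R]_m' => W *m y)%R
  (isMeasurableFun.Build _ _ _ _ _ (measurable_mulmx_self W)).
apply: (@eq_measure_orthant R N (distribution (gauss m) fV) (distribution (gauss m') fW)).
  by rewrite (le_lt_trans (probability_le1 _ _))// ltry.
move=> t; apply/eqP; rewrite eq_le; apply/andP; split.
  by apply: (@slepian R N m m' V W t) => [a|a b]; rewrite VW.
by apply: (@slepian R N m' m W V t) => [a|a b]; rewrite VW.
Qed.

Lemma gauss_SE m (B : set 'cV[R]_m.+1) : gauss m.+1 B = (gamma1 \x gauss m) (@col_cons R m @^-1` B).
Proof. by rewrite /gauss -lock. Qed.

Lemma measurable_col_cons_pre m (B : set 'cV[R]_m.+1) : measurable B ->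
  measurable (@col_cons R m @^-1` B).
Proof.
by move=> mB; rewrite -[X in measurable X]setTI; exact: (@measurable_funPT _ _ _ _ (@col_cons R m)).
Qed.

Lemma gauss_rotate m (u : 'cV[R]_m) (B : set 'cV[R]_m) :
  dotv u u = 1%R -> measurable B ->
  gauss m B = \int[gamma1]_z gauss m [set y | B (z *: u + (1%:M - u *m u^T) *m y)%R].
Proof.
move=> uu mB.
pose W : 'M[R]_(m, 1 + m) := row_mx u (1%:M - u *m u^T)%R.
have uTu : (u^T *m u = 1%:M)%R.
  apply/matrixP => i j; rewrite !ord1 [RHS]mxE eqxx -uu /dotv.
  by rewrite !ord1.
have WW : (W *m W^T = 1%:M *m 1%:M^T :> 'M[R]_m)%R.
  rewrite trmx1 mulmx1 tr_row_mx mul_row_col.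
  have -> : ((1%:M - u *m u^T)^T = 1%:M - u *m u^T)%R.
    by rewrite linearB /= trmx1 trmx_mul trmxK.
  rewrite mulmxBl mul1mx mulmxBr mulmx1 -[(u *m u^T *m _)%R]mulmxA.
  rewrite [(u^T *m _)%R]mulmxA uTu mul1mx subrr subr0 addrC subrK//.
have -> : gauss m B = gauss m ((fun y => 1%:M *m y)%R @^-1` B).
  by congr (gauss m _); apply/seteqP; split => y /=; rewrite mul1mx.
rewrite -(gauss_law_eq WW mB) gauss_SE /=.
have mW : measurable ((fun y : 'cV[R]_m.+1 => W *m y)%R @^-1` B).
  by rewrite -[X in measurable X]setTI; exact: (measurable_mulmx_self W).
transitivity (\int[gamma1]_z (gauss m (xsection (@col_cons R m @^-1` ((fun y : 'cV[R]_m.+1 => W *m y)%R @^-1` B)) z))) => //.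
apply: eq_integral => z _; congr (gauss m _).
apply/seteqP; split => y; rewrite /xsection /= inE /= /col_cons mul_row_col mul_mx_scalar//.
Qed.

Let pr m (B : set 'cV[R]_m) : R := fine (gauss m B).

Lemma dotvC m (u v : 'cV[R]_m) : dotv u v = dotv v u.
Proof. by rewrite !dotvE; apply: eq_bigr => j _; rewrite mulrC. Qed.

Lemma dotvDr m (u v w : 'cV[R]_m) : (dotv u (v + w) = dotv u v + dotv u w)%R.
Proof. by rewrite /dotv mulmxDr mxE. Qed.

Lemma dotvZr m (u v : 'cV[R]_m) a : (dotv u (a *: v) = a * dotv u v)%R.
Proof. by rewrite /dotv -scalemxAr mxE. Qed.

Lemma dotvZl m (u v : 'cV[R]_m) a : (dotv (a *: u) v = a * dotv u v)%R.
Proof. by rewrite dotvC dotvZr dotvC. Qed.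

Lemma dotvBr m (u v w : 'cV[R]_m) : (dotv u (v - w) = dotv u v - dotv u w)%R.
Proof. by rewrite -scaleN1r dotvDr dotvZr mulN1r. Qed.

Lemma dotvBl m (u v w : 'cV[R]_m) : (dotv (v - w) u = dotv v u - dotv w u)%R.
Proof. by rewrite dotvC dotvBr ![dotv u _]dotvC. Qed.

Lemma dotv_ge0 m (u : 'cV[R]_m) : (0 <= dotv u u)%R.
Proof. by rewrite -sqr_l2norm sqr_ge0. Qed.

Lemma dotv_unit_le1 m (u v : 'cV[R]_m) : dotv u u = 1%R -> dotv v v = 1%R -> (dotv u v <= 1)%R.
Proof.
move=> uu vv; have := dotv_ge0 (u - v).
rewrite dotvBr !dotvBl uu vv [dotv v u]dotvC; lra.
Qed.

Lemma ereal_sum_le_prod (N : nat) (a b : 'I_N -> \bar R) (x y : \bar R) :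
  (forall i, 0 <= a i) -> (forall i, 0 <= b i) -> 0 <= x -> 0 <= y ->
  (forall i, a i * y <= x * b i) -> (\sum_i a i) * y <= x * \sum_i b i.
Proof.
move=> a0 b0 x0 y0 H; rewrite ge0_sume_distrl// ge0_sume_distrr//.
by apply: lee_sum => i _; exact: H.
Qed.

Let lt_shift (z z' c q : R) : (z' * c - z' <= z * c - z -> z * c + q < z -> z' * c + q < z')%R.
Proof. lra. Qed.
Let le_shift (z z' c q : R) : (z' * c - z' <= z * c - z -> z * c + q <= z -> z' * c + q <= z')%R.
Proof. lra. Qed.

Section anticoncentration.
Variables (m N : nat) (u : 'I_N -> 'cV[R]_m).
Hypothesis u1 : forall a, dotv (u a) (u a) = 1%R.

Let D (a : 'I_N) : set 'cV[R]_m := [set y | forall b : 'I_N,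
  (if (b < a)%N then dotv (u b) y < dotv (u a) y else dotv (u b) y <= dotv (u a) y)%R].

Let mset (f : 'cV[R]_m -> R) (J : set R) : measurable_fun setT f -> measurable J ->
  measurable (f @^-1` J).
Proof. by move=> mf mJ; rewrite -[X in measurable X]setTI; apply: mf. Qed.

Let mD a : measurable (D a).
Proof.
have -> : D a = \bigcap_(b in [set: 'I_N]) [set y |
  (if (b < a)%N then dotv (u b) y < dotv (u a) y else dotv (u b) y <= dotv (u a) y)%R].
  by apply/seteqP; split => [y Dy b _|y Dy b]; [exact: Dy|exact: (Dy b I)].
apply: fin_bigcap_measurable => // b _.
have mf : measurable_fun setT (fun y => dotv (u b) y - dotv (u a) y)%R.
  by apply: measurable_funB; exact: measurable_dotv_self.
case: (b < a)%N.
  have -> : [set y | (dotv (u b) y < dotv (u a) y)%R] =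
     (fun y => dotv (u b) y - dotv (u a) y)%R @^-1` `]-oo, 0%R[.
    by apply/seteqP; split => y /=; rewrite in_itv /= subr_lt0.
  by apply: mset.
have -> : [set y | (dotv (u b) y <= dotv (u a) y)%R] =
   (fun y => dotv (u b) y - dotv (u a) y)%R @^-1` `]-oo, 0%R].
  by apply/seteqP; split => y /=; rewrite in_itv /= subr_le0.
by apply: mset.
Qed.

Let h a (z : R) := gauss m [set y | D a (z *: u a + (1%:M - u a *m (u a)^T) *m y)%R].

Let dot_rot a b z y :
  (dotv (u b) (z *: u a + (1%:M - u a *m (u a)^T) *m y) =
   z * dotv (u b) (u a) + (dotv (u b) y - dotv (u b) (u a) * dotv (u a) y))%R.
Proof.
rewrite dotvDr dotvZr; congr (_ + _)%R.
rewrite mulmxBl mul1mx dotvBr; congr (_ - _)%R.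
rewrite -mulmxA (mx11_scalar ((u a)^T *m y)%R) mul_mx_scalar dotvZr mulrC.
by [].
Qed.

Let dot_rot_self a z y : dotv (u a) (z *: u a + (1%:M - u a *m (u a)^T) *m y)%R = z.
Proof. by rewrite dot_rot u1 mulr1 mul1r subrr addr0. Qed.

Let msec a z : measurable [set y | D a (z *: u a + (1%:M - u a *m (u a)^T) *m y)%R].
Proof.
rewrite -[X in measurable X]setTI.
by apply: (measurable_addmx (measurable_cst _) (measurable_mulmx_self _)).
Qed.

Let h_ge0 a z : 0 <= h a z. Proof. exact: measure_ge0. Qed.

Let h_mono a z z' : (z <= z')%R -> h a z <= h a z'.
Proof.
move=> zz; apply: le_measure; rewrite ?inE; [exact: msec|exact: msec|].
move=> y /= Dy b; have := Dy b; rewrite !dot_rot_self !dot_rot.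
have cle := dotv_unit_le1 (u1 b) (u1 a).
have H : (z' * dotv (u b) (u a) - z' <= z * dotv (u b) (u a) - z)%R.
  rewrite -subr_ge0 (_ : _ - _ = (z' - z) * (1 - dotv (u b) (u a)))%R; last by ring.
  by rewrite mulr_ge0// subr_ge0.
set q := (dotv (u b) y - _)%R.
by case: ifPn => _; [exact: lt_shift H|exact: le_shift H].
Qed.

Let split_int a J : measurable J ->
  gauss m (D a `&` dotv (u a) @^-1` J) = \int[gamma1]_(z in J) h a z.
Proof.
move=> mJ; rewrite (gauss_rotate (u1 a)); last first.
  by apply: measurableI => //; apply: mset => //; exact: measurable_dotv_self.
rewrite [RHS]integral_mkcond; apply: eq_integral => z _.
rewrite /patch /h; case: ifPn => [/set_mem zJ|/negP zJ].
  congr (gauss m _); apply/seteqP; split => y /=; rewrite dot_rot_self; tauto.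
rewrite (_ : [set y | _] = set0) ?measure0//.
apply/seteqP; split => y //= [_]; rewrite dot_rot_self => Jz; apply: zJ; exact: mem_set.
Qed.

Let mh a : measurable_fun setT (h a).
Proof.
pose B := [set zy : measurableTypeR R * 'cV[R]_m | D a (zy.1 *: u a + (1%:M - u a *m (u a)^T) *m zy.2)%R].
have mB : measurable B.
  rewrite -[X in measurable X]setTI.
  have mf : measurable_fun setT (fun zy : measurableTypeR R * 'cV[R]_m => zy.1 *: u a + (1%:M - u a *m (u a)^T) *m zy.2)%R.
    apply: measurable_addmx; last exact: measurable_mulmx measurable_snd.
    apply: measurable_mxP => i j; under eq_fun do rewrite mxE.
    by apply: measurable_funM => //; exact: measurable_fst.
  by apply: mf.
have := measurable_fun_xsection (gauss m) mB.
congr (measurable_fun _ _); apply/funext => z; rewrite /h /=; congr (gauss m _).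
by apply/seteqP; split => y; rewrite /xsection /= inE.
Qed.

Let ratio a (t t' : R) : (t <= t')%R ->
  gauss m (D a `&` dotv (u a) @^-1` `]t, t']) * gamma1 `]t', +oo[ <=
  gamma1 `]t, t'] * gauss m (D a `&` dotv (u a) @^-1` `]t', +oo[).
Proof.
move=> tt; rewrite !split_int//.
have mhI (J : set R) : measurable_fun J (h a) by exact: measurable_funTS.
have le1 : \int[gamma1]_(z in `]t, t']) h a z <= h a t' * gamma1 `]t, t'].
  rewrite -integral_cst//; apply: ge0_le_integral => //; first exact: mhI.
  by move=> z; rewrite /= ?in_itv/= => /andP[_ zt]; exact: h_mono.
have le2 : h a t' * gamma1 `]t', +oo[ <= \int[gamma1]_(z in `]t', +oo[) h a z.
  rewrite -integral_cst//; apply: ge0_le_integral => //; first exact: mhI.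
  by move=> z; rewrite /= ?in_itv/= ?andbT => zt; exact: (h_mono _ (ltW zt)).
apply: le_trans (lee_wpmul2r (measure_ge0 _ _) le1) _.
by rewrite muleAC muleC; apply: lee_wpmul2l => //; exact: measure_ge0.
Qed.

Let argmax_exists (a0 : 'I_N) (y : 'cV[R]_m) : exists a, D a y.
Proof.
have P : exists k : nat, [exists b : 'I_N, (nat_of_ord b == k) &&
    [forall b', (dotv (u b') y <= dotv (u b) y)%R]].
  have [a _ amax] := @arg_maxP _ _ _ a0 xpredT (fun a => dotv (u a) y) isT.
  by exists a; apply/existsP; exists a; rewrite eqxx; apply/forallP => b; exact: amax.
case: (ex_minnP P) => k /existsP[a /andP[/eqP ak /forallP amax]] kmin.
exists a => b; case: ifPn => [ba|_]; last exact: amax.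
rewrite ltNge; apply/negP => ab.
have : [exists c : 'I_N, (nat_of_ord c == b) && [forall b', (dotv (u b') y <= dotv (u c) y)%R]].
  apply/existsP; exists b; rewrite eqxx; apply/forallP => b'.
  by apply: le_trans ab; exact: amax.
by move=> /kmin; rewrite leqNgt -ak ba.
Qed.

Let D_disjoint : trivIset setT D.
Proof.
apply/trivIsetP => a b _ _ ab; apply/seteqP; split => y //= [Da Db].
have [ltab|ltba|/val_inj/eqP] := ltngtP a b; last by rewrite (negbTE ab).
- by have := Db a; have := Da b; rewrite ltab ltnNge (ltnW ltab)/= leNgt => /negP.
- by have := Da b; have := Db a; rewrite ltba ltnNge (ltnW ltba)/= leNgt => /negP.
Qed.

Lemma anticoncentration_fin (t t' : R) : (t <= t')%R ->
  gauss m [set y | forall a, (dotv (u a) y <= t')%R] * gamma1 `]t', +oo[ <=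
  gauss m [set y | forall a, (dotv (u a) y <= t)%R] * gamma1 `]t', +oo[ + gamma1 `]t, t'].
Proof.
move=> tt.
have mF x : measurable [set y | forall a, (dotv (u a) y <= x)%R].
  have -> : [set y | forall a, (dotv (u a) y <= x)%R] = \bigcap_(a in [set: 'I_N]) (dotv (u a) @^-1` `]-oo, x]).
    apply/seteqP; split => y /= H a; first by move=> _ /=; rewrite in_itv/=.
    by have := H a I; rewrite /= in_itv.
  by apply: fin_bigcap_measurable => // a _; apply: mset => //; exact: measurable_dotv_self.
have mE a J : measurable J -> measurable (D a `&` dotv (u a) @^-1` J).
  by move=> mJ; apply: measurableI => //; apply: mset => //; exact: measurable_dotv_self.
have mEI a := mE a `]t, t']%classic (measurable_itv _).
have mEK a := mE a `]t', +oo[%classic (measurable_itv _).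
have step1 : gauss m [set y | forall a, (dotv (u a) y <= t')%R] <=
    gauss m [set y | forall a, (dotv (u a) y <= t)%R] +
    \sum_(a < N) gauss m (D a `&` dotv (u a) @^-1` `]t, t']).
  have [mU leU] := measure_exists_le (gauss m) mEI.
  apply: le_trans (leeD (lexx _) leU); apply: le_trans (measureU2 _ (mF _) mU).
  apply: le_measure; rewrite ?inE; [exact: mF|by apply: measurableU => //; exact: mF|].
  move=> y /= yt'; have [yt|] := pselect (forall a, (dotv (u a) y <= t)%R); first by left.
  move=> /existsNP[b /negP]; rewrite -ltNge => tb; right.
  have [a Da] := argmax_exists b y.
  exists a; split => //=; rewrite in_itv/= yt' andbT; apply: lt_le_trans tb _.
  by have := Da b; case: ifPn => // _ /ltW.
have step2 : \sum_(a < N) gauss m (D a `&` dotv (u a) @^-1` `]t', +oo[) <= 1.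
  rewrite -measure_bigsetU_ord//; last first.
    apply/trivIsetP => a b _ _ ab; move/trivIsetP : D_disjoint => /(_ a b I I ab) Dab.
    by rewrite setIACA Dab set0I.
  by apply: probability_le1; apply: bigsetU_measurable => a _.
apply: le_trans (lee_wpmul2r (measure_ge0 _ _) step1) _.
rewrite ge0_muleDl ?measure_ge0 ?sume_ge0//.
apply: leeD => //.
have H1 : (\sum_a gauss m (D a `&` dotv (u a) @^-1` `]t, t'])) * gamma1 `]t', +oo[ <=
   gamma1 `]t, t'] * \sum_a gauss m (D a `&` dotv (u a) @^-1` `]t', +oo[).
  by apply: ereal_sum_le_prod => [a|a|||a]; try exact: measure_ge0; exact: ratio.
apply: le_trans H1 _; rewrite -[leRHS]mule1; apply: lee_wpmul2l => //.
Qed.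

End anticoncentration.

Definition below m (v : nat -> 'cV[R]_m) (t : R) : set 'cV[R]_m :=
  [set y | forall k, (dotv (v k) y <= t)%R].

Let below_fin m (v : nat -> 'cV[R]_m) N (t : R) : set 'cV[R]_m :=
  [set y | forall a : 'I_N, (dotv (v a) y <= t)%R].

Let measurable_below_fin m (v : nat -> 'cV[R]_m) N t : measurable (below_fin v N t).
Proof.
have -> : below_fin v N t = \bigcap_(a in [set: 'I_N]) (dotv (v a) @^-1` `]-oo, t]).
  apply/seteqP; split => y /= H a; first by move=> _ /=; rewrite in_itv/=.
  by have := H a I; rewrite /= in_itv.
apply: fin_bigcap_measurable => // a _.
by rewrite -[X in measurable X]setTI; apply: measurable_dotv_self.
Qed.

Let below_bigcap m (v : nat -> 'cV[R]_m) t : below v t = \bigcap_N below_fin v N t.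
Proof.
apply/seteqP; split => y /= H; first by move=> N _ a; exact: H.
by move=> k; exact: (H k.+1 I (@Ordinal k.+1 k (ltnSn k))).
Qed.

Lemma measurable_below m (v : nat -> 'cV[R]_m) t : measurable (below v t).
Proof. by rewrite below_bigcap; apply: bigcapT_measurable => N; exact: measurable_below_fin. Qed.

Let below_cvg m (v : nat -> 'cV[R]_m) t :
  gauss m (below_fin v N t) @[N --> \oo] --> gauss m (below v t).
Proof.
rewrite below_bigcap; apply: nonincreasing_cvg_mu.
- by rewrite (le_lt_trans (probability_le1 _ _))// ?ltry//; exact: measurable_below_fin.
- by move=> N; exact: measurable_below_fin.
- by apply: bigcapT_measurable => N; exact: measurable_below_fin.
- move=> i j ij; apply/subsetPset => y /= Hy a.
  exact: (Hy (widen_ord ij a)).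
Qed.

Let below_sub_fin m (v : nat -> 'cV[R]_m) N t : gauss m (below v t) <= gauss m (below_fin v N t).
Proof.
apply: le_measure; rewrite ?inE; [exact: measurable_below|exact: measurable_below_fin|].
by move=> y /= H a; exact: H.
Qed.

Lemma anticoncentration m (v : nat -> 'cV[R]_m) (t t' : R) :
  (forall k, dotv (v k) (v k) = 1%R) -> (t <= t')%R ->
  gauss m (below v t') * gamma1 `]t', +oo[ <=
  gauss m (below v t) * gamma1 `]t', +oo[ + gamma1 `]t, t'].
Proof.
move=> v1 tt.
have kfin : gamma1 `]t', +oo[ \is a fin_num by exact: fin_num_measure.
have ifin : gamma1 `]t, t'] \is a fin_num by exact: fin_num_measure.
have C : (gauss m (below_fin v N t) * gamma1 `]t', +oo[ + gamma1 `]t, t']) @[N --> \oo] -->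
    gauss m (below v t) * gamma1 `]t', +oo[ + gamma1 `]t, t'].
  apply: cvgeD; [exact: fin_num_adde_defl|apply: cvgeZr => //; exact: below_cvg|exact: cvg_cst].
apply: cvge_to_ge C _; near=> N.
apply: le_trans (lee_wpmul2r _ (below_sub_fin v N t')) _; first exact: measure_ge0.
exact: (@anticoncentration_fin m N (fun a => v a)).
Unshelve. all: by end_near. Qed.

(* Adding an independent common summand raises all correlations at once, which
   puts the two processes in the position of Slepian's inequality. *)
Lemma gauss_comparison m m' (u : nat -> 'cV[R]_m) (v : nat -> 'cV[R]_m') (eta t r : R) :
  (forall k, dotv (u k) (u k) = 1%R) -> (forall k, dotv (v k) (v k) = 1%R) ->
  (0 <= eta < 1)%R ->
  (forall j k, (1 - eta) * (1 - dotv (v j) (v k)) <= 1 - dotv (u j) (u k))%R ->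
  gauss m (below u t) <= gauss m' (below v ((t + r) / Num.sqrt (1 - eta))) +
    gamma1 [set z | (Num.sqrt eta * z < - r)%R].
Proof.
move=> u1 v1 /andP[eta0 eta1] H.
have e1 : (0 < Num.sqrt (1 - eta))%R by rewrite sqrtr_gt0 subr_gt0.
set s := ((t + r) / _)%R; set A := [set z | _].
have mA : measurable A.
  have -> : A = (fun z => Num.sqrt eta * z)%R @^-1` `]-oo, (- r)%R[.
    by apply/seteqP; split => z /=; rewrite in_itv.
  by rewrite -[X in measurable X]setTI; apply: measurable_funM.
have C : (gauss m' (below_fin v N s) + gamma1 A) @[N --> \oo] --> gauss m' (below v s) + gamma1 A.
  apply: cvgeD; [|exact: below_cvg|exact: cvg_cst].
  by apply: fin_num_adde_defl; exact: fin_num_measure.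
apply: cvge_to_ge C _; near=> N.
apply: le_trans (below_sub_fin u N t) _.
pose V : 'M[R]_(N, m) := \matrix_(a < N) (u a)^T.
pose W : 'M[R]_(N, 1 + m') := row_mx (const_mx (Num.sqrt eta)) (Num.sqrt (1 - eta) *: \matrix_(a < N) (v a)^T).
have VV a b : (V *m V^T)%R a b = dotv (u a) (u b).
  by rewrite mxE dotvE; apply: eq_bigr => j _; rewrite !mxE.
have WW a b : (W *m W^T)%R a b = (eta + (1 - eta) * dotv (v a) (v b))%R.
  rewrite tr_row_mx mul_row_col mxE; congr (_ + _)%R.
    by rewrite mxE big_ord1 !mxE -expr2 sqr_sqrtr.
  rewrite linearZ /= -scalemxAl -scalemxAr scalerA -expr2 sqr_sqrtr ?subr_ge0 ?ltW// mxE.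
  by congr (_ * _)%R; rewrite mxE dotvE; apply: eq_bigr => j _; rewrite !mxE.
have S := @slepian R N m m'.+1 V W (fun=> t).
have {}S : gauss m [set y | forall a, ((V *m y)%R a ord0 <= t)%R] <=
    gauss m'.+1 [set y | forall a, ((W *m y)%R a ord0 <= t)%R].
  apply: S => [a|a b]; rewrite VV WW; first by rewrite u1 v1 mulr1 addrC subrK.
  by have := H a b; rewrite mulrBr mulr1; move: (dotv _ _) (_ * _)%R => p q; lra.
have -> : below_fin u N t = [set y | forall a, ((V *m y)%R a ord0 <= t)%R].
  have E a y : (V *m y)%R a ord0 = dotv (u a) y.
    by rewrite mulmx_dotv; congr (dotv _ y); apply/matrixP => i j; rewrite !mxE ord1.
  by apply/seteqP; split => y /= Hy a; have := Hy a; rewrite E.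
apply: le_trans S _; rewrite gauss_SE.
have mB : measurable (below_fin v N s) by exact: measurable_below_fin.
have g1 : gamma1 setT = 1 by exact: probability_setT.
have -> : gauss m' (below_fin v N s) = (gamma1 \x gauss m') (setT `*` below_fin v N s).
  apply/esym; apply: etrans (product_measure1E gamma1 (gauss m') measurableT mB) _.
  by rewrite -[RHS]mul1e; congr (_ * _); exact: g1.
have -> : gamma1 A = (gamma1 \x gauss m') (A `*` setT).
  apply/esym; apply: etrans (product_measure1E gamma1 (gauss m') mA measurableT) _.
  by rewrite -[RHS]mule1; congr (_ * _); exact: probability_setT.
have mX1 : measurable (setT `*` below_fin v N s : set (measurableTypeR R * 'cV[R]_m')) by exact: measurableX.
have mX2 : measurable (A `*` setT : set (measurableTypeR R * 'cV[R]_m')) by exact: measurableX.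
apply: le_trans (measureU2 _ mX1 mX2).
apply: le_measure; rewrite ?inE; [|exact: measurableU|].
  apply: measurable_col_cons_pre.
  have -> : [set y | forall a, ((W *m y)%R a ord0 <= t)%R] =
      [set: 'cV[R]_m'.+1] `&` (fun y => W *m y)%R @^-1` orthant (fun=> t) by rewrite setTI.
  by apply: measurable_mulmx_self => //; exact: measurable_orthant.
move=> [z y] /= Hy; have [zr|rz] := ltP (Num.sqrt eta * z)%R (- r)%R; first by right.
left; split => // a; have := Hy a; rewrite /col_cons/= mul_row_col mxE.
rewrite mul_mx_scalar mxE mxE -scalemxAl mxE.
have -> : (\matrix_(a < N) (v a)^T *m y)%R a ord0 = dotv (v a) y.
  by rewrite mulmx_dotv; congr (dotv _ y); apply/matrixP => i j; rewrite !mxE ord1.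
by rewrite /s ler_pdivlMr// mulrC; move: rz; rewrite mulrC; lra.
Unshelve. all: by end_near. Qed.

End gauss_consequences.

Section linear_algebra.
Context {R : realType}.

Lemma cauchy_schwarz m (u v : 'cV[R]_m) : dotv u v ^+ 2 <= dotv u u * dotv v v.
Proof.
have := dotv_ge0 (dotv v v *: u - dotv u v *: v).
rewrite dotvBr !dotvBl !dotvZr !dotvZl [dotv v u]dotvC.
have [v0|v0] := eqVneq (dotv v v) 0; last first.
  have vp : 0 < dotv v v by rewrite lt_def v0 dotv_ge0.
  move=> H; rewrite -subr_ge0 -(pmulr_rge0 _ vp); apply: le_trans H _.
  by rewrite le_eqVlt; apply/orP; left; apply/eqP; ring.
move=> _; suff -> : dotv u v = 0 by rewrite expr0n mulr_ge0// dotv_ge0.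
have vz j : v j ord0 = 0.
  apply/eqP; rewrite -sqrf_eq0; apply/eqP; move/eqP: v0; rewrite dotvE psumr_eq0.
    by move=> /allP/(_ j); rewrite mem_index_enum => /(_ isT)/eqP; rewrite expr2.
  by move=> i _; rewrite -expr2 sqr_ge0.
by rewrite dotvE big1// => j _; rewrite vz mulr0.
Qed.

Lemma dotv_le_norm m (u v : 'cV[R]_m) : dotv u v <= l2norm u * l2norm v.
Proof.
apply: le_trans (ler_norm _) _.
rewrite -(@ler_pXn2r _ 2) ?nnegrE ?mulr_ge0 ?l2norm_ge0//.
by rewrite real_normK ?num_real// exprMn !sqr_l2norm cauchy_schwarz.
Qed.

Lemma dotv_trmx m q (A : 'M[R]_(q, m)) (c : 'cV[R]_q) (y : 'cV[R]_m) :
  dotv (A^T *m c) y = dotv c (A *m y).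
Proof. by rewrite /dotv trmx_mul trmxK mulmxA. Qed.

Lemma gram_schmidt m r (A : 'M[R]_(r, m)) :
  exists (B C : 'M[R]_r) (d : 'rV[R]_r),
    [/\ forall i, d ord0 i = 0 \/ d ord0 i = 1,
        A = C *m (B *m A), (B *m A) *m (B *m A)^T = diag_mx d & diag_mx d *m B = B].
Proof.
elim: r A => [A|r IH].
  exists 0, 0, 0; by split => [[]//|||]; apply/matrixP => -[].
rewrite -[r.+1]/(1 + r)%N => A.
have {IH}[B [C [d [d01 AE EE dB]]]] := IH (dsubmx (A : 'M[R]_(1 + r, m))).
set A' := dsubmx _ in AE EE; set a : 'rV[R]_m := usubmx (A : 'M[R]_(1 + r, m)).
set E := B *m A' in AE EE.
have AA : A = col_mx a A' by rewrite vsubmxK.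
have dE : diag_mx d *m E = E by rewrite /E mulmxA dB.
pose w := a - a *m E^T *m E.
have wE : w *m E^T = 0.
  rewrite mulmxBl -[(_ *m E *m E^T)]mulmxA EE -[(a *m E^T *m _)]mulmxA.
  have -> : E^T *m diag_mx d = (diag_mx d *m E)^T by rewrite [RHS]trmx_mul tr_diag_mx.
  by rewrite dE subrr.
have wA : w = (- (a *m E^T *m B)) *m A' + 1%:M *m a.
  by rewrite mul1mx mulNmx -!mulmxA -/E mulmxA addrC.
have aE : a = w + a *m E^T *m E by rewrite subrK.
clearbody w.
pose nw := Num.sqrt ((w *m w^T) ord0 ord0).
have ww0 : 0 <= (w *m w^T) ord0 ord0.
  by rewrite mxE sumr_ge0// => j _; rewrite mxE -expr2 sqr_ge0.
have wwE : w *m w^T = (nw ^+ 2)%:M.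
  by rewrite sqr_sqrtr// [LHS]mx11_scalar.
have [nw0|nw0] := eqVneq nw 0.
  have w0 : w = 0.
    apply/matrixP => i j; rewrite ord1 [RHS]mxE.
    have := congr1 (fun M : 'M[R]_1 => M ord0 ord0) wwE.
    rewrite nw0 expr0n !mxE mul0rn => /eqP; rewrite psumr_eq0.
      move=> /allP/(_ j); rewrite mem_index_enum => /(_ isT)/eqP/eqP.
      by rewrite mxE mulf_eq0 orbb => /eqP.
    by move=> k _; rewrite mxE -expr2 sqr_ge0.
  exists (block_mx 0 0 0 B : 'M[R]_(1 + r)), (block_mx 0 (a *m E^T) 0 C : 'M[R]_(1 + r)), (row_mx 0 d : 'M[R]_(1, 1 + r)).
  have BA : (block_mx 0 0 0 B : 'M[R]_(1 + r)) *m A = col_mx (0 : 'rV[R]_m) E.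
    by rewrite AA mul_block_col !mul0mx !add0r.
  split.
  - by move=> i; rewrite mxE; case: splitP => j _; [left; rewrite mxE|exact: d01].
  - rewrite BA mul_block_col !mul0mx !add0r -AE [LHS]AA; congr col_mx.
    by rewrite [LHS]aE w0 add0r.
  - rewrite BA tr_col_mx mul_col_row diag_mx_row EE trmx0 !mul0mx !mulmx0.
    by congr block_mx; apply/matrixP => i j; rewrite !mxE mul0rn.
  - rewrite diag_mx_row mulmx_block !mul0mx !mulmx0 !addr0 dB add0r.
    by congr block_mx; rewrite addr0.
pose e := nw^-1 *: w.
have eA : e = nw^-1 *: (- (a *m E^T *m B)) *m A' + (nw^-1)%:M *m a.
  by rewrite /e wA scalerDr -scalemxAl mul1mx mul_scalar_mx.
exists (block_mx (nw^-1)%:M (nw^-1 *: (- (a *m E^T *m B))) 0 B : 'M[R]_(1 + r)),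
  (block_mx nw%:M (a *m E^T) 0 C : 'M[R]_(1 + r)), (row_mx 1 d : 'M[R]_(1, 1 + r)).
have BA : (block_mx (nw^-1)%:M (nw^-1 *: (- (a *m E^T *m B))) 0 B : 'M[R]_(1 + r)) *m A = col_mx e E.
  by rewrite AA mul_block_col !mul0mx !add0r addrC eA.
split.
- move=> i; rewrite mxE; case: splitP => j _; last exact: d01.
  by right; rewrite !ord1 mxE eqxx.
- rewrite BA mul_block_col !mul0mx !add0r -AE [LHS]AA; congr col_mx.
  by rewrite mul_scalar_mx /e scalerA divff// scale1r -aE.
- rewrite BA tr_col_mx mul_col_row diag_mx_row EE.
  have eE : e *m E^T = 0 by rewrite /e -scalemxAl wE scaler0.
  rewrite eE -[E *m e^T]trmxK trmx_mul trmxK eE trmx0; congr block_mx.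
  rewrite /e linearZ /= -scalemxAl -scalemxAr scalerA wwE.
  apply/matrixP => i j; rewrite !ord1 !mxE eqxx !mulr1n.
  by rewrite expr2; field.
- rewrite diag_mx_row mulmx_block !mul0mx !mulmx0 !addr0 dB add0r.
  have -> : diag_mx (1 : 'rV[R]_1) = 1%:M by apply/matrixP => i j; rewrite !mxE !ord1.
  by rewrite !mul1mx.
Qed.

Definition select p s (f : {ffun 'I_s -> 'I_p}) : 'M[R]_(s, p) :=
  \matrix_(k, j) (j == f k)%:R.

Lemma select_mulE p s (f : {ffun 'I_s -> 'I_p}) (x : 'cV[R]_p) k :
  (select f *m x) k ord0 = x (f k) ord0.
Proof.
rewrite mxE (bigD1 (f k))//= mxE eqxx mul1r big1 ?addr0// => j /negbTE jf.
by rewrite mxE jf mul0r.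
Qed.

Lemma sparse_select p s (q : 'cV[R]_p) : (0 < p)%N -> (l0norm q <= s)%N ->
  exists (f : {ffun 'I_s -> 'I_p}) (c : 'cV[R]_s), q = (select f)^T *m c.
Proof.
move=> p0 qs; pose S := enum [pred j | q j ord0 != 0].
have sS : size S = l0norm q by rewrite -cardE.
pose j0 : 'I_p := Ordinal p0.
pose f := [ffun k : 'I_s => nth j0 S k].
exists f, (\col_k (if (k < size S)%N then q (f k) ord0 else 0)).
apply/matrixP => j z; rewrite ord1 mxE.
under eq_bigr do rewrite !mxE ffunE.
have [qj|qj] := eqVneq (q j ord0) 0.
  rewrite qj big1// => k _; have [<-|_] := eqVneq j (nth j0 S k); last by rewrite mul0r.
  by rewrite qj if_same mulr0.
have jS : j \in S by rewrite mem_enum inE.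
have kS : (index j S < size S)%N by rewrite index_mem.
have ks : (index j S < s)%N by rewrite (leq_trans kS)// sS.
rewrite (bigD1 (Ordinal ks))//= nth_index// eqxx kS mul1r big1 ?addr0// => k kn.
have [jk|_] := eqVneq j (nth j0 S k); last by rewrite mul0r.
have [kS'|] := ltnP k (size S); last by rewrite mulr0.
exfalso; move/eqP: kn; apply; apply: val_inj => /=.
by rewrite jk index_uniq// enum_uniq.
Qed.

End linear_algebra.

Section gauss_tail.
Context {R : realType}.
Local Open Scope ereal_scope.

Lemma integral_gauss_exp_norm m :
  \int[gauss m]_y (expR (l2norm y ^+ 2 / 4))%:E = (Num.sqrt 2 ^+ m)%:E :> \bar R.
Proof.
have mN n : measurable_fun setT (fun y : 'cV[R]_n => (expR (l2norm y ^+ 2 / 4))%:E).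
  apply/measurable_EFinP; apply: measurableT_comp => //; apply: measurable_funM => //.
  under eq_fun do rewrite sqr_l2norm dotvE.
  by apply: measurable_sum => j; apply: measurable_funM; exact: measurable_mx_entry.
have N0 n (y : 'cV[R]_n) : 0 <= (expR (l2norm y ^+ 2 / 4))%:E by rewrite lee_fin expR_ge0.
elim: m => [|m IH].
  rewrite -[RHS](@integral_cst_probability R _ _ (gauss 0)); apply: eq_integral => y _.
  by rewrite sqr_l2norm dotvE big_ord0 mul0r expR0 expr0.
rewrite [LHS](integral_gaussS (mN m.+1) (N0 m.+1)).
transitivity (\int[@normal_prob R 0 1]_z ((Num.sqrt 2 ^+ m)%:E * (expR (z ^+ 2 / 4))%:E)).
  apply: eq_integral => z _.
  transitivity (\int[gauss m]_y ((expR (z ^+ 2 / 4))%:E * (expR (l2norm y ^+ 2 / 4))%:E)).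
    apply: eq_integral => y _; rewrite -EFinM -expRD -mulrDl; congr (expR (_ / 4))%:E.
    rewrite !sqr_l2norm !dotvE big_ord_recl col_consE unlift_none /= expr2; congr (_ + _)%R.
    by apply: eq_bigr => i _; rewrite col_consE liftK.
  rewrite -IH [RHS]muleC; apply: (@ge0_integralZl _ _ _ (gauss m) setT measurableT _ (mN m)) => [y _|]; rewrite lee_fin expR_ge0//.
rewrite exprS [in RHS]mulrC EFinM -integral_expR_sqr4 -ge0_integralZl//.
- apply/measurable_EFinP; apply: measurableT_comp => //.
  by apply: measurable_funM => //; exact: measurable_funX.
Qed.

Lemma measurable_l2norm m : measurable_fun setT (@l2norm R m).
Proof.
apply: (measurableT_comp (continuous_measurable_fun (@sqrt_continuous R))).
by apply: measurable_sum => j; apply: measurable_funX; exact: measurable_mx_entry.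
Qed.

Lemma gauss_norm_tail m r (M : 'M[R]_(r, m)) (d : 'rV[R]_r) (T : R) :
  (forall i, d ord0 i = 0%R \/ d ord0 i = 1%R) -> (M *m M^T = diag_mx d)%R ->
  (0 <= T)%R ->
  gauss m [set y | (T < l2norm (M *m y))%R] <= (expR (- (T ^+ 2 / 4)) * Num.sqrt 2 ^+ r)%:E.
Proof.
move=> d01 MM T0.
have mO : measurable [set y : 'cV[R]_r | (T < l2norm y)%R].
  have -> : [set y : 'cV[R]_r | (T < l2norm y)%R] = @l2norm R r @^-1` `]T, +oo[.
    by apply/seteqP; split => y /=; rewrite in_itv/= andbT.
  by rewrite -[X in measurable X]setTI; apply: measurable_l2norm.
have DD : (M *m M^T = diag_mx d *m (diag_mx d)^T)%R.
  rewrite MM tr_diag_mx mulmx_diag; congr diag_mx; apply/rowP => i; rewrite !mxE.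
  by have [->|->] := d01 i; rewrite ?mul0r ?mul1r.
have -> : gauss m [set y | (T < l2norm (M *m y))%R] = gauss r [set y | (T < l2norm (diag_mx d *m y))%R].
  exact: (gauss_law_eq DD mO).
have mD : measurable [set y : 'cV[R]_r | (T < l2norm (diag_mx d *m y))%R].
  have -> : [set y : 'cV[R]_r | (T < l2norm (diag_mx d *m y))%R] = [set: 'cV[R]_r] `&` (fun y => diag_mx d *m y)%R @^-1` [set y | (T < l2norm y)%R] by rewrite setTI.
  exact: measurable_mulmx_self.
rewrite EFinM -integral_gauss_exp_norm -ge0_integralZl//; last first.
  apply/measurable_EFinP; apply: measurableT_comp => //; apply: measurable_funM => //.
  by apply: measurable_funX; exact: measurable_l2norm.
rewrite -[X in gauss r X]setIT -integral_indic//.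
apply: (@gauss_integral_le R r (\1_[set y : 'cV[R]_r | (T < l2norm (diag_mx d *m y))%R])
  (fun y => expR (- (T ^+ 2 / 4)) * expR (l2norm y ^+ 2 / 4))%R).
- by split => [|y]; [exact: measurable_indic|rewrite indicE].
- split => [|y]; last by rewrite mulr_ge0 ?expR_ge0.
  apply: measurable_funM => //; apply: measurableT_comp => //; apply: measurable_funM => //.
  by apply: measurable_funX; exact: measurable_l2norm.
move=> y; rewrite indicE; have [/set_mem/= Ty|_] := boolP (_ \in _); last by rewrite mulr_ge0 ?expR_ge0.
rewrite -expRD -[leLHS]expR0 ler_expR addrC subr_ge0 ler_pM2r ?invr_gt0//.
apply: (@le_trans _ _ (l2norm (diag_mx d *m y) ^+ 2)%R).
  by rewrite lerXn2r ?nnegrE ?l2norm_ge0// ltW.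
have : (l2norm (diag_mx d *m y) ^+ 2 <= l2norm y ^+ 2)%R.
  rewrite !sqr_l2norm !dotvE; apply: ler_sum => i _; rewrite mul_diag_mx !mxE.
  have [->|->] := d01 i; first by rewrite !mul0r -expr2 sqr_ge0.
  by rewrite !mul1r.
exact.
Qed.

End gauss_tail.

Section sup_tail.
Context {R : realType}.

Lemma diag_mulE r (d : 'rV[R]_r) (q : 'cV[R]_r) i :
  (diag_mx d *m q) i ord0 = d ord0 i * q i ord0.
Proof. by rewrite mul_diag_mx mxE. Qed.

Lemma gram_schmidt_coords m r (A : 'M[R]_(r, m)) (B C : 'M[R]_r) (d : 'rV[R]_r) (c : 'cV[R]_r) :
  (forall i, d ord0 i = 0 \/ d ord0 i = 1) ->
  A = C *m (B *m A) -> (B *m A) *m (B *m A)^T = diag_mx d ->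
  dotv (A^T *m c) (A^T *m c) = \sum_i d ord0 i * (C^T *m c) i ord0 ^+ 2.
Proof.
move=> d01 AE EE; rewrite {1 2}AE !trmx_mul -!mulmxA.
rewrite -[B^T *m _]/(B^T *m (C^T *m c)) !mulmxA -mulmxA -trmx_mul.
set q := C^T *m c; rewrite -[_ *m q]/((B *m A)^T *m q).
rewrite dotv_trmx mulmxA EE dotvE; apply: eq_bigr => i _.
by rewrite diag_mulE mulrCA expr2.
Qed.

Lemma dotv_le_gram_schmidt m r (A : 'M[R]_(r, m)) (B C : 'M[R]_r) (d : 'rV[R]_r)
    (c : 'cV[R]_r) (y : 'cV[R]_m) :
  (forall i, d ord0 i = 0 \/ d ord0 i = 1) ->
  A = C *m (B *m A) -> (B *m A) *m (B *m A)^T = diag_mx d -> diag_mx d *m B = B ->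
  dotv (A^T *m c) y <= l2norm (A^T *m c) * l2norm (B *m A *m y).
Proof.
move=> d01 AE EE dB; set W := B *m A *m y.
have dW : diag_mx d *m W = W by rewrite /W !mulmxA dB.
have -> : dotv (A^T *m c) y = dotv (diag_mx d *m (C^T *m c)) W.
  rewrite dotv_trmx {1}AE -(mulmxA C) -dotv_trmx -/W -[in LHS]dW.
  by rewrite -[X in dotv (X *m _) W](tr_diag_mx d) [RHS]dotv_trmx.
apply: le_trans (dotv_le_norm _ _) _; apply: ler_wpM2r; first exact: l2norm_ge0.
rewrite -(@ler_pXn2r _ 2) ?nnegrE ?l2norm_ge0// !sqr_l2norm.
rewrite (gram_schmidt_coords c d01 AE EE) dotvE; apply: ler_sum => i _.
rewrite diag_mulE; have [->|->] := d01 i; first by rewrite !mul0r.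
by rewrite !mul1r expr2.
Qed.

Lemma below_tail p m s (A : 'M[R]_(p, m)) (q : nat -> 'cV[R]_p) (v : nat -> 'cV[R]_m) (T : R) :
  (0 < p)%N -> 0 <= T -> (forall k, l0norm (q k) <= s)%N ->
  (forall k, exists2 a, 0 <= a & v k = a *: (A^T *m q k)) ->
  (forall k, dotv (v k) (v k) = 1) ->
  (1 - (p%:R ^+ s * (expR (- (T ^+ 2 / 4)) * Num.sqrt 2 ^+ s))%:E <= gauss m (below v T))%E.
Proof.
move=> p0 T0 qs vq v1.
have /choice[G HG] : forall f : {ffun 'I_s -> 'I_p}, exists g : 'M[R]_s * 'M[R]_s * 'rV[R]_s,
   [/\ forall i, g.2 ord0 i = 0 \/ g.2 ord0 i = 1,
       select f *m A = g.1.2 *m (g.1.1 *m (select f *m A)),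
       (g.1.1 *m (select f *m A)) *m (g.1.1 *m (select f *m A))^T = diag_mx g.2
     & diag_mx g.2 *m g.1.1 = g.1.1].
  move=> f; have [B [C [d ?]]] := gram_schmidt (select f *m A).
  by exists (B, C, d).
pose M f := (G f).1.1 *m (select f *m A).
pose F f := [set y : 'cV[R]_m | T < l2norm (M f *m y)].
have mF f : measurable (F f).
  have -> : F f = (fun y : 'cV[R]_m => l2norm (M f *m y)) @^-1` `]T, +oo[.
    by apply/seteqP; split => y /=; rewrite in_itv/= andbT.
  rewrite -[X in measurable X]setTI.
  have mf := measurableT_comp (@measurable_l2norm R s) (measurable_mulmx_self (M f)).
  by apply: mf.
have [mU leU] := measure_exists_le (gauss m) mF.
have cover : ~` [set y | exists f, F f y] `<=` below v T.
  move=> y /= Hy k; have [f [c qE]] := sparse_select p0 (qs k).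
  have [d01 AE EE dB] := HG f; have [a a0 vE] := vq k.
  have vE' : v k = (select f *m A)^T *m (a *: c).
    by rewrite vE qE trmx_mul -scalemxAr mulmxA.
  have := dotv_le_gram_schmidt (a *: c) y d01 AE EE dB.
  rewrite -vE' => /le_trans; apply.
  have -> : l2norm (v k) = 1.
    by apply/eqP; rewrite -(@eqrXn2 _ 2) ?l2norm_ge0// sqr_l2norm v1 expr1n.
  by rewrite mul1r leNgt; apply/negP => Tl; apply: Hy; exists f.
have tot : (\sum_f gauss m (F f) <= (p%:R ^+ s * (expR (- (T ^+ 2 / 4)) * Num.sqrt 2 ^+ s))%:E)%E.
  apply: (@le_trans _ _ (\sum_(f : {ffun 'I_s -> 'I_p}) (expR (- (T ^+ 2 / 4)) * Num.sqrt 2 ^+ s)%:E)%E).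
    by apply: lee_sum => f _; have [d01 _ EE _] := HG f; exact: gauss_norm_tail.
  rewrite sumEFin sumr_const card_ffun !card_ord lee_fin -[X in X <= _]mulr_natl.
  by rewrite natrX.
have cU := probability_setC (gauss m) mU.
apply: (@le_trans _ _ (gauss m (~` [set y | exists f, F f y]))).
  rewrite cU; apply: leeB => //.
  exact: le_trans leU tot.
apply: le_measure; rewrite ?inE; [exact: measurableC|exact: measurable_below|].
exact: cover.
Qed.

End sup_tail.

Section independence.
Context {R : realType}.
Local Open Scope ereal_scope.

Lemma indep_integral_prod d d' (T : measurableType d) (E : measurableType d')
    (P : probability T R) (I : finType) (Y : I -> T -> E) (f : I -> E -> R) :
  (forall i, measurable_fun setT (Y i)) -> indep_rv P Y ->
  (forall i, measurable_fun setT (f i)) -> (forall i y, 0 <= f i y)%R ->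
  (forall i, \int[P]_w (f i (Y i w))%:E < +oo) ->
  \int[P]_w (\prod_i f i (Y i w))%:E = \prod_i \int[P]_w (f i (Y i w))%:E.
Proof.
move=> mY ind mf f0 ffin.
pose good (g : I -> E -> R) := [/\ forall i, measurable_fun setT (g i),
  forall i y, (0 <= g i y)%R & forall i, \int[P]_w (g i (Y i w))%:E < +oo].
suff H (s : seq I) (g : I -> E -> R) : good g ->
    (forall i, i \notin s -> exists2 B, measurable B & g i = \1_B) ->
    \int[P]_w (\prod_i g i (Y i w))%:E = \prod_i \int[P]_w (g i (Y i w))%:E.
  by apply: (H (enum I)) => // i; rewrite mem_enum.
have prodm (h : I -> E -> R) (Q : pred I) : (forall i, measurable_fun setT (h i)) ->
    measurable_fun setT (fun w => \prod_(i | Q i) h i (Y i w))%R.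
  move=> mh; under eq_fun do rewrite big_mkcond.
  apply: measurable_prod => i _; case: (Q i) => //; exact: measurableT_comp.
elim: s g => [|j s IH] g gg gB.
  have /choice[B HB] : forall i, exists B, measurable B /\ g i = \1_B.
    by move=> i; have [B mB gE] := gB i isT; exists B.
  have mYB i : measurable (Y i @^-1` B i).
    by rewrite -[X in measurable X]setTI; apply: mY => //; have [] := HB i.
  have E1 i : \int[P]_w (g i (Y i w))%:E = P (Y i @^-1` B i).
    rewrite -(setIT (Y i @^-1` B i)) -integral_indic//.
    by apply: eq_integral => w _; have [_ ->] := HB i; rewrite !indicE.
  transitivity (P (\bigcap_(i in [set` [set: I]%SET]) (Y i @^-1` B i))).
    have mI : measurable (\bigcap_(i in [set` [set: I]%SET]) (Y i @^-1` B i)).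
      by apply: fin_bigcap_measurable => // i _; exact: mYB.
    rewrite -(setIT (\bigcap_(i in _) _)) -integral_indic//.
    apply: eq_integral => w _; congr EFin.
    rewrite indicE; have [/set_mem wB|wB] := boolP (w \in _).
      rewrite big1// => i _; have [_ ->] := HB i; rewrite indicE mem_set//.
      by apply: (wB i); rewrite /= inE.
    have [i iB] : exists i, ~ (Y i @^-1` B i) w.
      apply/existsNP => H; move/negP: wB; apply; apply: mem_set => i _; exact: H.
    rewrite (bigD1 i)//=; have [_ ->] := HB i; rewrite indicE memNset// mul0r//.
  rewrite ind => [|i]; last by have [] := HB i.
  by apply: eq_big => [i|i _]; [rewrite inE|rewrite E1].
have [mg g0 gfin] := gg.
pose G w := (\prod_(i | i != j) g i (Y i w))%R.
pose c := (\prod_(i | i != j) fine (\int[P]_w (g i (Y i w))%:E))%R.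
have G0 w : (0 <= G w)%R by apply: prodr_ge0.
have c0 : (0 <= c)%R.
  by apply: prodr_ge0 => i _; apply: fine_ge0; apply: integral_ge0 => w _; rewrite lee_fin.
have cE : c%:E = \prod_(i | i != j) \int[P]_w (g i (Y i w))%:E.
  rewrite /c -prodEFin; apply: eq_bigr => i _; rewrite fineK// ge0_fin_numE//.
  by apply: integral_ge0 => w _; rewrite lee_fin.
have := @ge0_integral_transfer R _ _ _ _ _ _ P P (Y j) (Y j) G (cst c) (EFin \o g j)
  (mY j) (mY j) (prodm _ _ mg) (measurable_cst _) G0 (fun=> c0).
move=> H; transitivity (\int[P]_w ((EFin \o g j) (Y j w) * (G w)%:E)).
  by apply: eq_integral => w _; rewrite (bigD1 j)//= EFinM.
rewrite H.
- rewrite (bigD1 j)//= -cE muleC -ge0_integralZl//.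
  + by apply: eq_integral => w _; rewrite muleC.
  + by apply/measurable_EFinP; exact: measurableT_comp.
  + by move=> w _; rewrite lee_fin.
- move=> B mB.
  have mYB : measurable (Y j @^-1` B) by rewrite -[X in measurable X]setTI; exact: mY.
  pose g' i := if i == j then (\1_B : E -> R) else g i.
  have IHg' := IH g'.
  have jB : \int[P]_w (g' j (Y j w))%:E = P (Y j @^-1` B).
    rewrite -(setIT (Y j @^-1` B)) -integral_indic//.
    by apply: eq_integral => w _; rewrite /g' eqxx !indicE.
  have gg' : good g'.
    split=> [i|i y|i].
    * by rewrite /g'; case: eqP => // _; exact: measurable_indic.
    * by rewrite /g'; case: eqP.
    * have [->|ij] := eqVneq i j; last by rewrite /g' (negbTE ij).
      by rewrite jB (le_lt_trans (probability_le1 _ _))// ltry.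
  have {}IHg' := IHg' gg' _.
  transitivity (\int[P]_w (\prod_i g' i (Y i w))%:E).
    rewrite [LHS]integral_mkcond epatch_indic; apply: eq_integral => w _.
    have -> : (\prod_i g' i (Y i w))%R = (\1_B (Y j w) * G w)%R.
      rewrite (bigD1 j)//=; congr (_ * _)%R; first by rewrite /g' eqxx.
      by apply: eq_bigr => i /negbTE ij; rewrite /g' ij.
    by rewrite EFinM [RHS]muleC.
  rewrite IHg'.
    rewrite (bigD1 j)//= jB muleC.
    rewrite (_ : \prod_(i | i != j) _ = c%:E).
      by rewrite (@integral_cst _ _ _ P _ mYB c%:E).
    by rewrite cE; apply: eq_bigr => i /negbTE ij; rewrite /g' ij.
  move=> i is_; rewrite /g'; have [_|ij] := eqVneq i j; first by exists B.
  by apply: gB; rewrite inE negb_or ij.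
- exact/measurable_EFinP.
- by move=> y; rewrite lee_fin.
Qed.

End independence.

Section bernstein.
Context {R : realType}.

Lemma expR_le_quad (x : R) : expR x <= 1 + x + x ^+ 2 * expR `|x|.
Proof.
have [x0|x0] := leP 0 x.
  rewrite ger0_norm//; have H : expR x <= 1 + x * expR x.
    have := expR_ge1Dx (- x); rewrite -(ler_pM2r (expR_gt0 x)) -expRD addNr expR0; nra.
  by have := ler_wpM2l x0 H; nra.
rewrite ltr0_norm//.
have h1 : 1 + x <= expR x by exact: expR_ge1Dx.
have h2 : 1 - x <= expR (- x) by exact: expR_ge1Dx.
have h3 : expR x * expR (- x) = 1 by rewrite -expRD subrr expR0.
have h4 : expR x <= 1 by rewrite expR_le1 ltW.
have := expR_gt0 x; have := expR_gt0 (- x); nra.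
Qed.

Lemma mgf_quad_bound (a lam v : R) : 0 < a -> `|lam| <= a / 2 ->
  expR (lam * v) <= 1 + lam * v + lam ^+ 2 * (8 / a ^+ 2) * expR (a * `|v|).
Proof.
move=> a0 la; apply: le_trans (expR_le_quad _) _; rewrite lerD2l.
set b := a / 2 * `|v|; have b0 : 0 <= b by rewrite mulr_ge0// divr_ge0// ltW.
have vE : v ^+ 2 = 8 / a ^+ 2 * (b ^+ 2 / 2).
  by rewrite /b exprMn real_normK ?num_real//; field; rewrite gt_eqF.
have h1 : b ^+ 2 / 2 <= expR b.
  by apply: le_trans (expR_ge1Dxn 1 b0); rewrite ler_wpDl.
have h2 : expR `|lam * v| <= expR b by rewrite ler_expR normrM ler_wpM2r.
have -> : a * `|v| = b + b by rewrite /b; field.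
have h3 : b ^+ 2 / 2 * expR `|lam * v| <= expR b * expR b.
  by apply: ler_pM => //; rewrite divr_ge0// exprn_ge0.
rewrite expRD exprMn vE (mulrA (lam ^+ 2)) -[X in X <= _]mulrA.
by apply: ler_wpM2l => //; rewrite mulr_ge0 ?sqr_ge0// divr_ge0 ?sqr_ge0.
Qed.

Lemma integrable_of_exp d (E : measurableType d) (mu : probability E R) (w : E -> R) (a C1 : R) :
  measurable_fun setT w -> 0 < a ->
  (\int[mu]_y (expR (a * `|w y|))%:E <= C1%:E)%E -> mu.-integrable setT (EFin \o w).
Proof.
move=> mw a0 wC; pose g y := (expR (a * `|w y|))%:E.
have mg : measurable_fun setT g.
  apply/measurable_EFinP; apply: (measurableT_comp (@measurable_expR R)).
  by apply: measurable_funM => //; exact: measurableT_comp.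
apply: (@le_integrable _ _ _ mu _ measurableT _ (fun y => (a^-1)%:E * g y)%E).
- exact/measurable_EFinP.
- move=> y _; rewrite -EFinM !abse_EFin lee_fin.
  rewrite [X in _ <= X]ger0_norm; last by rewrite mulr_ge0 ?expR_ge0// invr_ge0 ltW.
  rewrite -ler_pdivrMl ?invr_gt0// invrK; apply: le_trans (expR_ge1Dx _).
  by rewrite lerDr.
- apply: (integrableZl measurableT); apply/integrableP; split => //.
  rewrite (eq_integral g); first exact: le_lt_trans wC (ltry _).
  by move=> y _; rewrite gee0_abs// lee_fin expR_ge0.
Qed.

Lemma mgf_bound d (E : measurableType d) (mu : probability E R) (w : E -> R) (a C1 lam : R) :
  measurable_fun setT w -> 0 < a -> `|lam| <= a / 2 ->
  (\int[mu]_y (expR (a * `|w y|))%:E <= C1%:E)%E ->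
  (\int[mu]_y (w y)%:E = 0)%E ->
  (\int[mu]_y (expR (lam * w y))%:E <= (expR (8 * C1 / a ^+ 2 * lam ^+ 2))%:E)%E.
Proof.
move=> mw a0 la wC w0.
have mexp (c : R) (f : E -> R) : measurable_fun setT f -> measurable_fun setT (fun y => (expR (c * f y))%:E).
  move=> mf; apply/measurable_EFinP; apply: (measurableT_comp (@measurable_expR R)).
  exact: measurable_funM.
have mnw : measurable_fun setT (fun y => `|w y|) by apply: measurableT_comp.
have i3 : mu.-integrable setT (fun y => (expR (a * `|w y|))%:E).
  apply/integrableP; split; first exact: mexp.
  rewrite (eq_integral (fun y => (expR (a * `|w y|))%:E)); first exact: le_lt_trans wC (ltry _).
  by move=> y _; rewrite gee0_abs// lee_fin expR_ge0.
have i2 := integrable_of_exp mw a0 wC.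
have i1 : mu.-integrable setT (cst 1%E) by exact: finite_measure_integrable_cst.
pose K := 8 / a ^+ 2.
have K0 : 0 <= K by rewrite divr_ge0// exprn_ge0// ltW.
have i4 : mu.-integrable setT (fun y => (1 + lam%:E * (w y)%:E)%E).
  by apply: (integrableD measurableT) => //; exact: (integrableZl measurableT).
have i5 : mu.-integrable setT (fun y => (lam ^+ 2 * K)%:E * (expR (a * `|w y|))%:E)%E.
  exact: (integrableZl measurableT).
apply: (@le_trans _ _ (\int[mu]_y ((1 + lam%:E * (w y)%:E) + (lam ^+ 2 * K)%:E * (expR (a * `|w y|))%:E))%E).
  apply: le_integral => //.
  - apply: (@le_integrable _ _ _ mu _ measurableT _ (fun y => (expR (a * `|w y|))%:E)) => //; first exact: mexp.
    move=> y _; rewrite !abse_EFin lee_fin !(ger0_norm (expR_ge0 _)) ler_expR.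
    apply: le_trans (ler_norm _) _; rewrite normrM ler_wpM2r//.
    by apply: le_trans la _; rewrite ler_pdivrMr// ler_pMr// ler1n.
  - exact: (integrableD measurableT).
  - by move=> y _; rewrite -!EFinM -!EFinD lee_fin; exact: mgf_quad_bound.
have -> : (\int[mu]_y ((1 + lam%:E * (w y)%:E) + (lam ^+ 2 * K)%:E * (expR (a * `|w y|))%:E) =
    1 + (lam ^+ 2 * K)%:E * \int[mu]_y (expR (a * `|w y|))%:E)%E.
  rewrite (integralD measurableT i4 i5); congr (_ + _)%E; last exact: (integralZl measurableT).
  rewrite (integralD measurableT i1) ?(integralZl measurableT) ?w0 ?mule0 ?adde0//.
    by rewrite integral_cst//= mul1e; exact: probability_setT.
  exact: (integrableZl measurableT).
apply: (@le_trans _ _ (1 + (lam ^+ 2 * K)%:E * C1%:E)%E).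
  by apply: leeD => //; apply: lee_wpmul2l => //; rewrite lee_fin mulr_ge0// sqr_ge0.
rewrite -EFinM -EFinD lee_fin; apply: le_trans (expR_ge1Dx _); rewrite lerD2l.
by rewrite /K le_eqVlt; apply/orP; left; apply/eqP; ring.
Qed.

Lemma bernstein_upper d d' (T : measurableType d) (E : measurableType d')
    (P : probability T R) n (Y : 'I_n -> T -> E) (mu : probability E R) (w : E -> R) (a C1 x : R) :
  (forall i, measurable_fun setT (Y i)) -> iid P Y mu ->
  measurable_fun setT w -> 0 < a -> 0 < C1 ->
  (\int[mu]_y (expR (a * `|w y|))%:E <= C1%:E)%E ->
  (\int[mu]_y (w y)%:E = 0)%E -> 0 <= x <= 8 * C1 / a ->
  (P [set om | (n%:R * x < \sum_i w (Y i om))%R] <=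
   (expR (- (n%:R * x ^+ 2 / (32 * C1 / a ^+ 2))))%:E)%E.
Proof.
move=> mY [indY lawY] mw a0 C0 wC w0 /andP[x0 xK].
pose K := 8 * C1 / a ^+ 2; pose lam := x / (2 * K).
have K0 : 0 < K by rewrite divr_gt0// ?exprn_gt0// mulr_gt0.
have lam0 : 0 <= lam by rewrite divr_ge0// mulr_ge0// ltW.
have lama : `|lam| <= a / 2.
  rewrite ger0_norm// /lam ler_pdivrMr ?(mulr_gt0 _ K0)//; apply: le_trans xK _.
  by rewrite /K le_eqVlt; apply/orP; left; apply/eqP; field; rewrite gt_eqF.
pose f (y : E) := expR (lam * w y).
have mf : measurable_fun setT f.
  by apply: (measurableT_comp (@measurable_expR R)); exact: measurable_funM.
have f0 y : 0 <= f y by exact: expR_ge0.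
have intf i : (\int[P]_om (f (Y i om))%:E = \int[mu]_y (f y)%:E)%E.
  apply: (@eq_ge0_integral_law _ _ _ _ _ _ _ P mu (Y i) id (EFin \o f)) => //.
    by move=> B mB; exact: lawY.
  - exact/measurable_EFinP.
have bnd := mgf_bound mw a0 lama wC w0.
have mS : measurable_fun setT (fun om => \sum_i w (Y i om)).
  by apply: measurable_sum => i; exact: measurableT_comp.
have mA : measurable [set om | n%:R * x < \sum_i w (Y i om)].
  rewrite (_ : [set om | _] = (fun om => \sum_i w (Y i om)) @^-1` `]n%:R * x, +oo[).
    by rewrite -[X in measurable X]setTI; apply: mS.
  by apply/seteqP; split => om /=; rewrite in_itv/= andbT.
have prodf om : \prod_i f (Y i om) = expR (lam * \sum_i w (Y i om)).
  by rewrite mulr_sumr expR_sum.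
have mprod : measurable_fun setT (fun om => (\prod_i f (Y i om))%:E).
  apply/measurable_EFinP; under eq_fun do rewrite prodf.
  by apply: (measurableT_comp (@measurable_expR R)); exact: measurable_funM.
have ffin i : (\int[P]_om (f (Y i om))%:E < +oo)%E by rewrite intf (le_lt_trans bnd)// ltry.
have prodE := indep_integral_prod mY indY (fun=> mf) (fun _ => f0) ffin.
apply: (@le_trans _ _ (\int[P]_om ((expR (- (lam * (n%:R * x))))%:E * (\prod_i f (Y i om))%:E))%E).
  rewrite -(setIT [set om | _]) -integral_indic//; apply: ge0_le_integral => //.
  - by apply/measurable_EFinP; exact: measurable_indic.
  - exact: measurable_funeM.
  - move=> om _; rewrite -EFinM lee_fin prodf -expRD indicE.
    case: (boolP (om \in _)) => [/set_mem/= H|_]; last exact: expR_ge0.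
    rewrite -[X in X <= _]expR0 ler_expR addrC -mulrBr mulr_ge0// subr_ge0; exact: ltW.
have -> : (\int[P]_om ((expR (- (lam * (n%:R * x))))%:E * (\prod_i f (Y i om))%:E) =
    (expR (- (lam * (n%:R * x))))%:E * \int[P]_om (\prod_i f (Y i om))%:E)%E.
  apply: (ge0_integralZl P measurableT mprod) => [om _|]; last by rewrite lee_fin expR_ge0.
  by rewrite lee_fin prodf expR_ge0.
rewrite prodE.
have prodle : (\prod_(i < n) \int[P]_om (f (Y i om))%:E <= (expR (n%:R * (K * lam ^+ 2)))%:E)%E.
  have J0 : (0 <= \int[mu]_y (f y)%:E)%E by apply: integral_ge0 => y _; rewrite lee_fin.
  under eq_bigr do rewrite intf; move: bnd J0; rewrite -/f.
  case: (\int[mu]_y _)%E => // r; rewrite !lee_fin => rK r0.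
  by rewrite prodEFin prodr_const card_ord lee_fin expRM_natl lerXn2r ?nnegrE ?expR_ge0.
apply: le_trans (lee_wpmul2l _ prodle) _; first by rewrite lee_fin expR_ge0.
rewrite -EFinM lee_fin -expRD ler_expR le_eqVlt; apply/orP; left; apply/eqP.
by rewrite /lam /K; field; rewrite !gt_eqF.
Qed.

Lemma bernstein d d' (T : measurableType d) (E : measurableType d')
    (P : probability T R) n (Y : 'I_n -> T -> E) (mu : probability E R) (w : E -> R) (a C1 x : R) :
  (forall i, measurable_fun setT (Y i)) -> iid P Y mu ->
  measurable_fun setT w -> 0 < a -> 0 < C1 ->
  (\int[mu]_y (expR (a * `|w y|))%:E <= C1%:E)%E ->
  (\int[mu]_y (w y)%:E = 0)%E -> 0 <= x <= 8 * C1 / a ->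
  (P [set om | (n%:R * x < `|\sum_i w (Y i om)|)%R] <=
   (2 * expR (- (n%:R * x ^+ 2 / (32 * C1 / a ^+ 2))))%:E)%E.
Proof.
move=> mY hY mw a0 C0 wC w0 xK.
have mnw : measurable_fun setT (fun y => - w y) by exact: measurableT_comp.
have H1 := bernstein_upper mY hY mw a0 C0 wC w0 xK.
have {}w0 : (\int[mu]_y (- w y)%:E = 0)%E.
  have iw := integrable_of_exp mw a0 wC.
  rewrite (eq_integral (fun y => (-1)%:E * (w y)%:E)%E) => [|y _]; last by rewrite EFinN mulN1e.
  by rewrite (integralZl measurableT iw) w0 mule0.
have {}wC : (\int[mu]_y (expR (a * `|- w y|))%:E <= C1%:E)%E.
  by under eq_integral do rewrite normrN.
have H2 := bernstein_upper mY hY mnw a0 C0 wC w0 xK.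
have m1 (v : E -> R) : measurable_fun setT v ->
    measurable [set om | (n%:R * x < \sum_i v (Y i om))%R].
  move=> mv; rewrite (_ : [set om | _] = (fun om => \sum_i v (Y i om)) @^-1` `]n%:R * x, +oo[).
    rewrite -[X in measurable X]setTI.
    have mS : measurable_fun setT (fun om => \sum_i v (Y i om)).
      by apply: measurable_sum => i; exact: measurableT_comp.
    by apply: mS.
  by apply/seteqP; split => om /=; rewrite in_itv/= andbT.
rewrite [X in P X](_ : _ = [set om | (n%:R * x < \sum_i w (Y i om))%R] `|`
    [set om | (n%:R * x < \sum_i - w (Y i om))%R]); last first.
  by apply/seteqP; split => om /=; rewrite sumrN lter_normr => /orP.
apply: le_trans (measureU2 _ (m1 _ mw) (m1 _ mnw)) _.
by rewrite mulrDl mul1r EFinD leeD.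
Qed.

End bernstein.

Section psi2.
Context {R : realType}.

Lemma psi2_moment d (T : measurableType d) (P : probability T R) (V : T -> R) (K : R) r :
  0 <= K -> (psi2_norm P V <= K%:E)%E -> (0 < r)%N ->
  (\int[P]_x (V x ^+ (2 * r))%:E <= ((2 * r%:R * K ^+ 2) ^+ r)%:E)%E.
Proof.
move=> K0 VK r0; pose q : R := 2 * r%:R.
have q1 : 1 <= q by rewrite /q -natrM ler1n muln_gt0.
have q0 : 0 < q by rewrite (lt_le_trans ltr01).
have : ((q `^ (- 2^-1))%:E * 'N[P]_q%:E [EFin \o V] <= K%:E)%E.
  by apply: le_trans VK; apply: ereal_sup_ubound; exists q.
have NE := @poweR_Lnorm _ _ _ P (EFin \o V) q (lt0r_neq0 q0).
have VE x : (`|(EFin \o V) x| `^ q = (V x ^+ (2 * r))%:E)%E.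
  rewrite /= ?poweR_EFin /q -natrM powR_mulrn ?normr_ge0//.
  by rewrite !exprM real_normK ?num_real.
move: NE; under eq_integral do rewrite VE; move=> <-.
have := Lnorm_ge0 P q%:E (EFin \o V); case: ('N[P]_q%:E[_])%E => [y||]//.
- rewrite !lee_fin => y0.
  have s0 : 0 < q `^ 2^-1 by rewrite powR_gt0.
  rewrite powRN ler_pdivrMl// => yK.
  rewrite ?poweR_EFin ?lee_fin (_ : y `^ q = (y ^+ 2) ^+ r); last first.
    by rewrite /q -natrM powR_mulrn// exprM.
  rewrite -/q (_ : q * K ^+ 2 = (q `^ 2^-1 * K) ^+ 2); last first.
    by rewrite exprMn -[in RHS]powR_mulrn ?powR_ge0// -powRrM mulVf// powRr1// ltW.
  by rewrite !lerXn2r ?nnegrE ?exprn_ge0 ?mulr_ge0 ?powR_ge0//.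
- by move=> _; rewrite gt0_muley ?lte_fin ?powR_gt0// leye_eq.
Qed.

Lemma expR_series (x : R) : (expR x)%:E = (\sum_(0 <= r <oo) (x ^+ r / r`!%:R)%:E)%E.
Proof.
rewrite -EFin_lim; last exact: is_cvg_series_exp_coeff.
by apply/congr_lim/funext => N /=; rewrite /series/= sumEFin.
Qed.

Lemma psi2_exp d (T : measurableType d) (P : probability T R) (V : T -> R) (K : R) :
  measurable_fun setT V -> 0 < K -> (psi2_norm P V <= K%:E)%E ->
  (\int[P]_x (expR (V x ^+ 2 / (4 * expR 1 * K ^+ 2)))%:E <= 2%:E)%E.
Proof.
move=> mV K0 VK; set a := (4 * expR 1 * K ^+ 2)^-1.
have a0 : 0 < a by rewrite invr_gt0 mulr_gt0 ?exprn_gt0// mulr_gt0// expR_gt0.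
have f0 r x : (0 <= ((a * V x ^+ 2) ^+ r / r`!%:R)%:E)%E.
  by rewrite lee_fin divr_ge0// exprn_ge0// mulr_ge0 ?sqr_ge0// ltW.
rewrite (eq_integral (fun x => \sum_(0 <= r <oo) ((a * V x ^+ 2) ^+ r / r`!%:R)%:E)%E); last first.
  by move=> x _; rewrite mulrC expR_series.
have mf r : measurable_fun setT (fun x => ((a * V x ^+ 2) ^+ r / r`!%:R)%:E).
  apply/measurable_EFinP; apply: measurable_funM => //; apply: measurable_funX.
  by apply: measurable_funM => //; exact: measurable_funX.
rewrite integral_nneseries//.
have bnd r : (\int[P]_x ((a * V x ^+ 2) ^+ r / r`!%:R)%:E <= (2^-1 ^+ r)%:E)%E.
  have cE x : (((a * V x ^+ 2) ^+ r / r`!%:R)%:E = (a ^+ r / r`!%:R)%:E * (V x ^+ (2 * r))%:E)%E.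
    by rewrite -EFinM exprMn -exprM mulrAC.
  under eq_integral do rewrite cE.
  have c0 : 0 <= a ^+ r / r`!%:R by rewrite divr_ge0// exprn_ge0// ltW.
  rewrite [X in (X <= _)%E](_ : _ = (a ^+ r / r`!%:R)%:E * \int[P]_x (V x ^+ (2 * r))%:E)%E; last first.
    apply: (ge0_integralZl P measurableT) => //.
    - by apply/measurable_EFinP; exact: measurable_funX.
    - by move=> x _; rewrite lee_fin exprM exprn_ge0// sqr_ge0.
  have [->|r0] := posnP r.
    rewrite muln0; under eq_integral do rewrite expr0.
    by rewrite integral_cst//= (_ : P setT = 1%E) ?mule1 ?fact0 ?divr1 ?expr0//; exact: probability_setT.
  apply: le_trans (lee_wpmul2l _ (psi2_moment (ltW K0) VK r0)) _; first by rewrite lee_fin.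
  rewrite -EFinM lee_fin.
  have fe : r%:R ^+ r / r`!%:R <= expR 1 ^+ r :> R.
    rewrite -expRM_natl mulr1; case: r r0 {cE c0} => // r _.
    by apply: le_trans (expR_ge1Dxn r _); rewrite ?lerDr.
  rewrite [X in X <= _](_ : _ = (2 * a * K ^+ 2) ^+ r * (r%:R ^+ r / r`!%:R)); last first.
    by rewrite !exprMn; move: (r%:R ^+ r) (a ^+ r) (2 ^+ r) (K ^+ 2 ^+ r) => ? ? ? ?; ring.
  apply: le_trans (ler_wpM2l _ fe) _; first by rewrite exprn_ge0// !mulr_ge0 ?sqr_ge0// ltW.
  rewrite -exprMn /a le_eqVlt; apply/orP; left; apply/eqP; congr (_ ^+ _).
  by field; rewrite !gt_eqF ?expR_gt0.
apply: lime_le.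
  by apply: is_cvg_nneseries => r _ _; apply: integral_ge0 => x _; exact: f0.
apply: nearW => N; apply: (@le_trans _ _ (\sum_(0 <= r < N) (2^-1 ^+ r)%:E)%E).
  by apply: lee_sum => r _; exact: bnd.
rewrite sumEFin lee_fin.
have : \sum_(0 <= r < N) 2^-1 ^+ r + 2 * 2^-1 ^+ N = 2 :> R.
  elim: N => [|N IH]; first by rewrite big_geq// add0r expr0 mulr1.
  by rewrite big_nat_recr//= exprS -{}[RHS]IH; field.
have : 0 <= 2 * 2^-1 ^+ N :> R by rewrite mulr_ge0// exprn_ge0// invr_ge0.
lra.
Qed.

End psi2.

Section isotropic_moments.
Context {R : realType} {d : measure_display} {T : measurableType d} (Q : probability T R).
Context (p : nat) (U : T -> 'cV[R]_p) (K1 : R).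
Hypothesis mU : measurable_fun setT U.
Hypothesis U_mean : forall j, ('E_Q[fun w => U w j ord0] = 0)%E.
Hypothesis U_cov : forall j k,
  ('E_Q[fun w => (U w j ord0 * U w k ord0)%R] = ((j == k)%:R)%:E)%E.
Hypothesis U_psi2 : (psi2_norm_vec Q U <= K1%:E)%E.

Definition psi2_rate (K1 : R) : R := (4 * expR 1 * (`|K1| + 1) ^+ 2)^-1.
Let a := psi2_rate K1.

Lemma psi2_rate_gt0 K : 0 < psi2_rate K.
Proof.
rewrite /psi2_rate invr_gt0; apply: mulr_gt0; first by rewrite mulr_gt0// expR_gt0.
by rewrite exprn_gt0// ltr_wpDl.
Qed.

Lemma psi2_rate_le1 K : psi2_rate K <= 1.
Proof.
rewrite /psi2_rate invf_le1; last by rewrite -invr_gt0 psi2_rate_gt0.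
have h : 1 <= expR 1 :> R by rewrite -expR0 ler_expR.
rewrite -[X in X <= _]mulr1; apply: ler_pM => //.
  by apply: le_trans h _; rewrite ler_peMl ?expR_ge0// ler1n.
by rewrite -[X in X <= _](expr1n _ 2) lerXn2r ?nnegrE// ?lerDr// addr_ge0.
Qed.

Definition null_or_unit m (e : 'cV[R]_m) := dotv e e = 0 \/ dotv e e = 1.

Lemma dotv_eq0 m (e y : 'cV[R]_m) : dotv e e = 0 -> dotv e y = 0.
Proof.
move=> e0; apply/eqP; have := cauchy_schwarz e y.
by rewrite e0 mul0r -sqrf_eq0 eq_le sqr_ge0 andbT.
Qed.

Lemma measurable_dotvU (e : 'cV[R]_p) : measurable_fun setT (fun w => dotv e (U w)).
Proof. exact: measurable_dotv. Qed.

Lemma exp_sq_dotv (e : 'cV[R]_p) : null_or_unit e ->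
  (\int[Q]_w (expR (a * dotv e (U w) ^+ 2))%:E <= 2%:E)%E.
Proof.
case=> e1.
  under eq_integral do rewrite dotv_eq0// expr0n mulr0 expR0.
  by rewrite integral_cst_probability lee_fin ler1n.
have := @psi2_exp _ _ _ Q (fun w => dotv e (U w)) (`|K1| + 1) (measurable_dotvU e).
under eq_integral do rewrite mulrC; apply; first by rewrite ltr_wpDl.
apply: (@le_trans _ _ K1%:E); last first.
  by rewrite lee_fin; apply: le_trans (ler_norm _) _; rewrite lerDl.
apply: le_trans U_psi2; apply: ereal_sup_ubound; exists e => //=.
by apply/eqP; rewrite -(@eqrXn2 _ 2) ?l2norm_ge0// sqr_l2norm e1 expr1n.
Qed.

Let mexp (f : T -> R) : measurable_fun setT f -> measurable_fun setT (fun w => (expR (a * f w))%:E).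
Proof.
move=> mf; apply/measurable_EFinP; apply: (measurableT_comp (@measurable_expR R)).
exact: measurable_funM.
Qed.

Lemma exp_prod_dotv (e e' : 'cV[R]_p) : null_or_unit e -> null_or_unit e' ->
  (\int[Q]_w (expR (a * `|dotv e (U w) * dotv e' (U w)|))%:E <= 4%:E)%E.
Proof.
move=> he he'; have m1 := measurable_dotvU e; have m2 := measurable_dotvU e'.
have ma : measurable_fun setT (fun w => (expR (a * dotv e (U w) ^+ 2))%:E).
  by apply: mexp; exact: measurable_funX.
have mb : measurable_fun setT (fun w => (expR (a * dotv e' (U w) ^+ 2))%:E).
  by apply: mexp; exact: measurable_funX.
apply: (@le_trans _ _ (\int[Q]_w ((expR (a * dotv e (U w) ^+ 2))%:E +
   (expR (a * dotv e' (U w) ^+ 2))%:E))%E).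
  apply: ge0_le_integral => //.
  - apply: mexp; apply: measurableT_comp => //; exact: measurable_funM.
  - exact: emeasurable_funD.
  - move=> w _; rewrite -EFinD lee_fin; set y := dotv e _; set z := dotv e' _.
    have a0 := ltW (psi2_rate_gt0 K1).
    have [yz|zy] := leP `|y| `|z|.
      rewrite ler_wpDl ?expR_ge0// ler_expR ler_wpM2l// normrM.
      by rewrite -[X in _ <= X](real_normK (num_real z)) expr2 ler_wpM2r.
    rewrite ler_wpDr ?expR_ge0// ler_expR ler_wpM2l// normrM.
    by rewrite -[X in _ <= X](real_normK (num_real y)) expr2 ler_wpM2l// ltW.
rewrite [X in (X <= _)%E](ge0_integralD Q measurableT) => //.
apply: le_trans (leeD (exp_sq_dotv he) (exp_sq_dotv he')) _.
by rewrite -EFinD lee_fin -natrD.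
Qed.

Lemma exp_abs_dotv (e : 'cV[R]_p) : null_or_unit e ->
  (\int[Q]_w (expR (a * `|dotv e (U w)|))%:E <= (4 * expR 1)%:E)%E.
Proof.
move=> he; have m1 := measurable_dotvU e.
have ma : measurable_fun setT (fun w => (expR (a * dotv e (U w) ^+ 2))%:E).
  by apply: mexp; exact: measurable_funX.
apply: (@le_trans _ _ (\int[Q]_w ((expR 1)%:E * (expR (a * dotv e (U w) ^+ 2))%:E))%E).
  apply: ge0_le_integral => //.
  - by apply: mexp; apply: measurableT_comp.
  - exact: measurable_funeM.
  - move=> w _; rewrite -EFinM lee_fin -expRD ler_expR; set y := dotv e _.
    have a0 := ltW (psi2_rate_gt0 K1); have a1 := psi2_rate_le1 K1.
    have : `|y| <= 1 + y ^+ 2.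
      rewrite -(real_normK (num_real y)); have := normr_ge0 y; nra.
    by move=> /(ler_wpM2l a0); rewrite -/a mulrDr mulr1 => /le_trans; apply; rewrite lerD2r.
rewrite [X in (X <= _)%E](_ : _ =
    (expR 1)%:E * \int[Q]_w (expR (a * dotv e (U w) ^+ 2))%:E)%E; last first.
  by apply: (ge0_integralZl Q measurableT ma) => [w _|]; rewrite lee_fin expR_ge0.
apply: le_trans (lee_wpmul2l _ (exp_sq_dotv he)) _; first by rewrite lee_fin expR_ge0.
rewrite -EFinM lee_fin mulrC ler_wpM2r ?expR_ge0// ler_nat//.
Qed.

Let basis (j : 'I_p) : 'cV[R]_p := delta_mx j ord0.

Let dotv_basis j y : dotv (basis j) y = y j ord0.
Proof.
rewrite dotvE (bigD1 j)//= big1 ?addr0 => [|k kj]; first by rewrite mxE !eqxx mul1r.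
by rewrite mxE (negbTE kj) mul0r.
Qed.

Let basis_unit j : null_or_unit (basis j).
Proof. by right; rewrite dotv_basis mxE !eqxx. Qed.

Lemma integrable_coord j : Q.-integrable setT (fun w => (U w j ord0)%:E).
Proof.
rewrite -(funext (fun w => congr1 EFin (dotv_basis j (U w)))).
exact: integrable_of_exp (measurable_dotvU _) (psi2_rate_gt0 K1) (exp_abs_dotv (basis_unit j)).
Qed.

Lemma integrable_coord2 j k : Q.-integrable setT (fun w => (U w j ord0 * U w k ord0)%:E).
Proof.
have E w : (dotv (basis j) (U w) * dotv (basis k) (U w))%:E = (U w j ord0 * U w k ord0)%:E.
  by rewrite !dotv_basis.
rewrite -(funext E).
apply: integrable_of_exp (psi2_rate_gt0 K1) (exp_prod_dotv (basis_unit j) (basis_unit k)).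
by apply: measurable_funM; exact: measurable_dotvU.
Qed.

Lemma mean_dotv (e : 'cV[R]_p) : (\int[Q]_w (dotv e (U w))%:E = 0)%E.
Proof.
have E w : (dotv e (U w))%:E = (\sum_j (e j ord0)%:E * (U w j ord0)%:E)%E.
  by rewrite dotvE -sumEFin; apply: eq_bigr.
under eq_integral do rewrite E.
rewrite [LHS](integral_sum measurableT
  (fun j => integrableZl measurableT (e j ord0) (integrable_coord j))).
rewrite big1// => j _; rewrite [LHS](integralZl measurableT (integrable_coord j)).
by have := U_mean j; rewrite unlock => ->; rewrite mule0.
Qed.

Lemma mean_prod_dotv (e e' : 'cV[R]_p) :
  (\int[Q]_w (dotv e (U w) * dotv e' (U w))%:E = (dotv e e')%:E)%E.
Proof.
have E w : (dotv e (U w) * dotv e' (U w))%:E =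
    (\sum_j \sum_k (e j ord0 * e' k ord0)%:E * (U w j ord0 * U w k ord0)%:E)%E.
  rewrite !dotvE big_distrlr/= -sumEFin; apply: eq_bigr => j _.
  by rewrite -sumEFin; apply: eq_bigr => k _; rewrite -EFinM mulrACA.
have I2 j k := integrableZl measurableT (e j ord0 * e' k ord0) (integrable_coord2 j k).
have I1 j := integrable_sum measurableT (index_enum 'I_p) (P := xpredT) (fun k _ => I2 j k).
under eq_integral do rewrite E.
rewrite [LHS](integral_sum measurableT I1) dotvE -sumEFin; apply: eq_bigr => j _.
rewrite [LHS](integral_sum measurableT (I2 j)).
have Ik k : (\int[Q]_w ((e j ord0 * e' k ord0)%:E * (U w j ord0 * U w k ord0)%:E) =
    (e j ord0 * e' k ord0)%:E * ((j == k)%:R)%:E)%E.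
  rewrite (integralZl measurableT (integrable_coord2 j k)); congr (_ * _)%E.
  by have := U_cov j k; rewrite unlock.
rewrite (eq_bigr _ (fun k _ => Ik k)) (bigD1 j)//= eqxx mule1 big1 ?adde0// => k.
by rewrite eq_sym => /negbTE ->; rewrite mule0.
Qed.

End isotropic_moments.

Section concentration.
Context {R : realType} {d : measure_display} {T0 : measurableType d} (Q : probability T0 R).
Context (p : nat) (U X0 : {RV Q >-> 'cV[R]_p}) (S : 'M[R]_p) (K1 : R).
Hypothesis U_mean : forall j, ('E_Q[fun w => U w j ord0] = 0)%E.
Hypothesis U_cov : forall j k,
  ('E_Q[fun w => (U w j ord0 * U w k ord0)%R] = ((j == k)%:R)%:E)%E.
Hypothesis U_psi2 : (psi2_norm_vec Q U <= K1%:E)%E.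
Hypothesis X0E : forall w, X0 w = S *m U w.
Context {d' : measure_display} {T : measurableType d'} (P : probability T R).
Context (n : nat) (X : 'I_n -> {RV P >-> 'cV[R]_p}).
Hypothesis X_iid : iid P X (distribution Q X0).
Let a := psi2_rate K1.

Let mU : measurable_fun setT U := measurable_funPT U.
Let mX0 : measurable_fun setT X0 := measurable_funPT X0.
Let mX i : measurable_fun setT (X i) := measurable_funPT (X i).

Let dotX0 b w : dotv b (X0 w) = dotv (S^T *m b) (U w).
Proof. by rewrite X0E dotv_trmx. Qed.

Let unit_dot (e e' : 'cV[R]_p) : null_or_unit e -> null_or_unit e' -> `|dotv e e'| <= 1.
Proof.
move=> he he'; rewrite -(@ler_pXn2r _ 2) ?nnegrE// expr1n real_normK ?num_real//.
apply: le_trans (cauchy_schwarz _ _) _.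
by case: he he' => -> [->|->]; rewrite ?mul0r ?mulr0 ?mul1r.
Qed.

Lemma bernstein_prod (b b' : 'cV[R]_p) (x : R) :
  null_or_unit (S^T *m b) -> null_or_unit (S^T *m b') -> 0 <= x <= 32 * expR 1 / a ->
  (P [set w | (n%:R * x < `|\sum_i (dotv b (X i w) * dotv b' (X i w) - dotv (S^T *m b) (S^T *m b'))|)%R]
    <= (2 * expR (- (n%:R * x ^+ 2 / (128 * expR 1 / a ^+ 2))))%:E)%E.
Proof.
move=> hb hb' hx; set c := dotv (S^T *m b) _.
pose w (y : 'cV[R]_p) := dotv b y * dotv b' y - c.
have mw : measurable_fun setT w.
  by apply: measurable_funB => //; apply: measurable_funM; exact: measurable_dotv_self.
have C0 : 0 < 4 * expR 1 :> R by rewrite mulr_gt0// expR_gt0.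
have := @bernstein _ _ _ _ _ P n X (distribution Q X0) w a (4 * expR 1) x mX X_iid mw
  (psi2_rate_gt0 K1) C0.
have mG : measurable_fun setT (fun v => dotv (S^T *m b) (U v) * dotv (S^T *m b') (U v)).
  by apply: measurable_funM; exact: measurable_dotv.
have wU v : w (X0 v) = dotv (S^T *m b) (U v) * dotv (S^T *m b') (U v) - c.
  by rewrite /w !dotX0.
have mexpG : measurable_fun setT
    (fun v => (expR (a * `|dotv (S^T *m b) (U v) * dotv (S^T *m b') (U v)|))%:E).
  apply/measurable_EFinP; apply: (measurableT_comp (@measurable_expR R)).
  by apply: measurable_funM => //; exact: measurableT_comp.
have bnd := exp_prod_dotv mU U_psi2 hb hb'.
have iG := integrable_of_exp mG (psi2_rate_gt0 K1) bnd.
rewrite !mulrA -!natrM; apply => //.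
- rewrite ge0_integral_distribution; last 2 first.
  + apply/measurable_EFinP; apply: (measurableT_comp (@measurable_expR R)).
    by apply: measurable_funM => //; exact: measurableT_comp.
  + by move=> y; rewrite lee_fin expR_ge0.
  apply: (@le_trans _ _ (\int[Q]_v ((expR 1)%:E *
      (expR (a * `|dotv (S^T *m b) (U v) * dotv (S^T *m b') (U v)|))%:E))%E).
    apply: ge0_le_integral => //.
    + by move=> v _ /=; rewrite lee_fin expR_ge0.
    + apply/measurable_EFinP; apply: (measurableT_comp (@measurable_expR R)).
      apply: measurable_funM => //; apply: measurableT_comp => //.
      exact: measurableT_comp.
    + exact: measurable_funeM.
    + move=> v _ /=; rewrite -EFinM lee_fin -expRD ler_expR wU.
      have a0 := ltW (psi2_rate_gt0 K1); have a1 := psi2_rate_le1 K1.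
      have := ler_normB (dotv (S^T *m b) (U v) * dotv (S^T *m b') (U v)) c.
      move=> /le_trans/(_ (lerD (lexx _) (unit_dot hb hb'))).
      move=> /(ler_wpM2l a0) /le_trans; apply.
      by rewrite mulrDr mulr1 addrC lerD2r.
  rewrite [X in (X <= _)%E](_ : _ = (expR 1)%:E * \int[Q]_v
     (expR (a * `|dotv (S^T *m b) (U v) * dotv (S^T *m b') (U v)|))%:E)%E; last first.
    by apply: (ge0_integralZl Q measurableT mexpG) => [v _|]; rewrite lee_fin expR_ge0.
  apply: le_trans (lee_wpmul2l _ bnd) _; first by rewrite lee_fin expR_ge0.
  by rewrite -EFinM lee_fin mulrC.
- have icst : Q.-integrable setT (cst (- c)%:E) by exact: finite_measure_integrable_cst.
  have E v : (EFin \o w \o X0) v =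
     ((dotv (S^T *m b) (U v) * dotv (S^T *m b') (U v))%:E + cst (- c)%:E v)%E.
    by rewrite /= wU EFinB.
  have mwE : measurable_fun setT (EFin \o w) by exact/measurable_EFinP.
  have iw : Q.-integrable setT (EFin \o w \o X0).
    by rewrite (funext E); exact: (integrableD measurableT iG icst).
  rewrite [LHS](integral_distribution mwE iw).
  rewrite (eq_integral _ _ (fun v _ => E v)).
  rewrite [LHS](integralD measurableT iG icst).
  rewrite (mean_prod_dotv mU U_cov U_psi2).
  by rewrite integral_cst_probability -EFinD addrN.
Qed.

Lemma bernstein_mean (b : 'cV[R]_p) (x : R) :
  null_or_unit (S^T *m b) -> 0 <= x <= 32 * expR 1 / a ->
  (P [set w | (n%:R * x < `|\sum_i dotv b (X i w)|)%R]
    <= (2 * expR (- (n%:R * x ^+ 2 / (128 * expR 1 / a ^+ 2))))%:E)%E.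
Proof.
move=> hb hx.
have mw : measurable_fun setT (dotv b) := measurable_dotv_self b.
have C0 : 0 < 4 * expR 1 :> R by rewrite mulr_gt0// expR_gt0.
have := @bernstein _ _ _ _ _ P n X (distribution Q X0) _ a (4 * expR 1) x mX X_iid mw
  (psi2_rate_gt0 K1) C0.
have mG : measurable_fun setT (fun v => dotv (S^T *m b) (U v)) by exact: measurable_dotv.
have bnd := exp_abs_dotv mU U_psi2 hb.
have iG := integrable_of_exp mG (psi2_rate_gt0 K1) bnd.
rewrite !mulrA -!natrM; apply => //.
- rewrite ge0_integral_distribution; last 2 first.
  + apply/measurable_EFinP; apply: (measurableT_comp (@measurable_expR R)).
    by apply: measurable_funM => //; exact: measurableT_comp.
  + by move=> y; rewrite lee_fin expR_ge0.
  by apply: le_trans bnd; under eq_integral do rewrite /= dotX0.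
- have E v : (EFin \o dotv b \o X0) v = (dotv (S^T *m b) (U v))%:E by rewrite /= dotX0.
  have mwE : measurable_fun setT (EFin \o dotv b) by exact/measurable_EFinP.
  have iw : Q.-integrable setT (EFin \o dotv b \o X0) by rewrite (funext E).
  rewrite [LHS](integral_distribution mwE iw).
  by rewrite (eq_integral _ _ (fun v _ => E v)) (mean_dotv mU U_mean U_psi2).
Qed.

Lemma cov_concentration (I : finType) (b : I -> 'cV[R]_p) (x : R) :
  (forall i, null_or_unit (S^T *m b i)) -> 0 <= x <= 32 * expR 1 / a ->
  exists B, [/\ measurable B,
    (P B <= (#|I|%:R ^+ 2 * (4 * expR (- (n%:R * x ^+ 2 / (128 * expR 1 / a ^+ 2)))))%:E)%E &
    forall w, ~ B w ->
     (forall i j, `|\sum_k (dotv (b i) (X k w) * dotv (b j) (X k w) -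
                     dotv (S^T *m b i) (S^T *m b j))| <= n%:R * x) /\
     (forall i, `|\sum_k dotv (b i) (X k w)| <= n%:R * x)].
Proof.
move=> hb hx.
pose V (o : I * I * bool) (w : T) : R := if o.2
  then \sum_k (dotv (b o.1.1) (X k w) * dotv (b o.1.2) (X k w) -
                     dotv (S^T *m b o.1.1) (S^T *m b o.1.2))
  else \sum_k dotv (b o.1.1) (X k w).
pose F o := [set w | n%:R * x < `|V o w|].
have mV o : measurable_fun setT (V o).
  rewrite /V; case: o => [[i j] []]/=; apply: measurable_sum => k; last exact: measurable_dotv.
  by apply: measurable_funB => //; apply: measurable_funM; exact: measurable_dotv.
have mF o : measurable (F o).
  rewrite (_ : F o = (fun w => `|V o w|) @^-1` `]n%:R * x, +oo[).
    rewrite -[X in measurable X]setTI.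
    have mnV : measurable_fun setT (fun w => `|V o w|) by exact: measurableT_comp.
    by apply: mnV.
  by apply/seteqP; split => om /=; rewrite in_itv/= andbT.
have [mU' PU] := measure_exists_le P mF.
exists [set w | exists o, F o w]; split => //.
- apply: le_trans PU _.
  apply: (@le_trans _ _ (\sum_(o : I * I * bool)
     (2 * expR (- (n%:R * x ^+ 2 / (128 * expR 1 / a ^+ 2))))%:E)%E).
    by apply: lee_sum => -[[i j] []] _; [exact: bernstein_prod|exact: bernstein_mean].
  rewrite sumEFin lee_fin sumr_const !card_prod card_bool -[X in X <= _]mulr_natr.
  by rewrite !natrM le_eqVlt; apply/orP; left; apply/eqP; ring.
- move=> w Bw; split => [i j|i]; rewrite leNgt; apply/negP => h; apply: Bw.
    by exists (i, j, true).
  by exists (i, i, false).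
Qed.

End concentration.

Section sparse_isometry.
Context {R : realType}.

Lemma qform_sample_cov n p (x : 'I_n -> 'cV[R]_p) (z : 'cV[R]_p) :
  qform (sample_cov x) z = n%:R^-1 * \sum_k dotv z (x k - sample_mean x) ^+ 2.
Proof.
rewrite /qform /sample_cov -scalemxAl dotvZr; congr (_ * _).
rewrite mulmx_suml /dotv mulmx_sumr summxE; apply: eq_bigr => k _.
set y := x k - _; rewrite -mulmxA mulmxA mxE big_ord1 expr2.
by congr (_ * _); rewrite -[LHS]/(dotv y z) dotvC.
Qed.

Lemma dotv_sample_mean n p (x : 'I_n -> 'cV[R]_p) (z : 'cV[R]_p) :
  dotv z (sample_mean x) = n%:R^-1 * \sum_k dotv z (x k).
Proof.
rewrite /sample_mean dotvZr; congr (_ * _).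
by rewrite /dotv mulmx_sumr summxE.
Qed.

Lemma qform_sample_covE n p (x : 'I_n -> 'cV[R]_p) (z : 'cV[R]_p) : (0 < n)%N ->
  qform (sample_cov x) z =
  n%:R^-1 * \sum_k dotv z (x k) ^+ 2 - (n%:R^-1 * \sum_k dotv z (x k)) ^+ 2.
Proof.
move=> n0; have nn : n%:R != 0 :> R by rewrite pnatr_eq0 -lt0n.
rewrite qform_sample_cov; set M := n%:R^-1 * \sum_k dotv z (x k).
have SM : \sum_k dotv z (x k) = n%:R * M by rewrite /M mulrA divff// mul1r.
have E k : true -> dotv z (x k - sample_mean x) ^+ 2 = dotv z (x k) ^+ 2 - (2 * M * dotv z (x k) - M ^+ 2).
  by rewrite dotvBr dotv_sample_mean -/M => _; ring.
rewrite (eq_bigr _ E) sumrB sumrB -mulr_sumr SM sumr_const card_ord -[X in _ - (_ - X)]mulr_natl.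
by field.
Qed.

Lemma sum_norm_sqr r (q : 'cV[R]_r) : (\sum_i `|q i ord0|) ^+ 2 <= r%:R * \sum_i q i ord0 ^+ 2.
Proof.
have := cauchy_schwarz (\col_i `|q i ord0|) (const_mx 1 : 'cV[R]_r).
rewrite !dotvE; under eq_bigr do rewrite !mxE mulr1.
under [X in _ <= X * _]eq_bigr do rewrite mxE -expr2 real_normK ?num_real//.
under [X in _ <= _ * X]eq_bigr do rewrite !mxE mulr1.
by rewrite sumr_const card_ord mulrC.
Qed.

Lemma quad_form_close r (M : 'I_r -> 'I_r -> R) (q : 'cV[R]_r) t :
  (forall i j, `|M i j| <= t) ->
  `|\sum_i \sum_j q i ord0 * q j ord0 * M i j| <= t * (\sum_i `|q i ord0|) ^+ 2.
Proof.
move=> Mt; rewrite expr2 big_distrlr/= mulr_sumr; apply: le_trans (ler_norm_sum _ _ _) _.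
apply: ler_sum => i _; rewrite mulr_sumr; apply: le_trans (ler_norm_sum _ _ _) _.
by apply: ler_sum => j _; rewrite !normrM mulrC ler_wpM2r.
Qed.

Lemma whitened_qform_close n p r (x : 'I_n -> 'cV[R]_p) (D : 'M[R]_(r, p)) (S : 'M[R]_p)
    (B C : 'M[R]_r) (d : 'rV[R]_r) (t : R) (c : 'cV[R]_r) :
  (0 < n)%N -> 0 <= t <= 1 ->
  (forall i, d ord0 i = 0 \/ d ord0 i = 1) ->
  D *m S = C *m (B *m (D *m S)) -> (B *m (D *m S)) *m (B *m (D *m S))^T = diag_mx d ->
  diag_mx d *m B = B ->
  (forall k, D *m x k = C *m (B *m (D *m x k))) ->
  (forall i j, `|\sum_k ((B *m (D *m x k)) i ord0 * (B *m (D *m x k)) j ord0 - diag_mx d i j)|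
     <= n%:R * t) ->
  (forall i, `|\sum_k (B *m (D *m x k)) i ord0| <= n%:R * t) ->
  `|qform (sample_cov x) (D^T *m c) - dotv (S^T *m (D^T *m c)) (S^T *m (D^T *m c))| <=
  2 * r%:R * t * dotv (S^T *m (D^T *m c)) (S^T *m (D^T *m c)).
Proof.
move=> n0 /andP[t0 t1] d01 AE EE dB Dx M2 M1.
have nn : 0 < n%:R :> R by rewrite ltr0n.
set z := D^T *m c; have -> : S^T *m z = (D *m S)^T *m c by rewrite /z mulmxA -trmx_mul.
rewrite (gram_schmidt_coords c d01 AE EE).
pose q := diag_mx d *m (C^T *m c).
pose y k := B *m (D *m x k).
have qE i : q i ord0 = d ord0 i * (C^T *m c) i ord0 by rewrite /q diag_mulE.
have -> : \sum_i d ord0 i * (C^T *m c) i ord0 ^+ 2 = \sum_i q i ord0 ^+ 2.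
  apply: eq_bigr => i _; rewrite qE.
  by case: (d01 i) => ->; rewrite ?mul0r ?mul1r// expr0n.
have zx k : dotv z (x k) = \sum_i q i ord0 * y k i ord0.
  have dy : diag_mx d *m y k = y k by rewrite /y mulmxA dB.
  have qT : q = (diag_mx d)^T *m (C^T *m c) by rewrite tr_diag_mx.
  rewrite -dotvE qT (dotv_trmx (diag_mx d)) dy dotv_trmx.
  by rewrite /z dotv_trmx {1}Dx.
rewrite qform_sample_covE//; set W := \sum_i q i ord0 ^+ 2.
pose M i j : R := n%:R^-1 * \sum_k y k i ord0 * y k j ord0.
pose m i : R := n%:R^-1 * \sum_k y k i ord0.
have bnd (v : R) : `|v| <= n%:R * t -> `|n%:R^-1 * v| <= t.
  by move=> vt; rewrite normrM ger0_norm ?invr_ge0 ?(ltW nn)// ler_pdivrMl.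
have Mt i j : `|M i j - diag_mx d i j| <= t.
  rewrite (_ : _ - _ = n%:R^-1 * \sum_k (y k i ord0 * y k j ord0 - diag_mx d i j)); last first.
    by rewrite sumrB sumr_const card_ord mulrBr -[X in _ - _ * X]mulr_natl mulrA mulVf ?gt_eqF// mul1r.
  exact: bnd.
have mt i : `|m i| <= t by exact: bnd.
have E2 : n%:R^-1 * \sum_k dotv z (x k) ^+ 2 = \sum_i \sum_j q i ord0 * q j ord0 * M i j.
  rewrite mulr_sumr; under eq_bigr => k _.
    rewrite zx expr2 big_distrlr/= mulr_sumr; under eq_bigr do rewrite mulr_sumr; over.
  rewrite exchange_big/=; apply: eq_bigr => i _; rewrite exchange_big/=; apply: eq_bigr => j _.
  by rewrite /M !mulr_sumr; apply: eq_bigr => k _; ring.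
have E1 : n%:R^-1 * \sum_k dotv z (x k) = \sum_i q i ord0 * m i.
  rewrite mulr_sumr; under eq_bigr => k _ do rewrite zx mulr_sumr.
  rewrite exchange_big/=; apply: eq_bigr => i _.
  by rewrite /m !mulr_sumr; apply: eq_bigr => k _; ring.
have EW : W = \sum_i \sum_j q i ord0 * q j ord0 * diag_mx d i j.
  apply: eq_bigr => i _; rewrite (bigD1 i)//= big1 => [|j ji].
    by rewrite [diag_mx d _ _]mxE eqxx mulr1n addr0 qE; case: (d01 i) => ->; ring.
  by rewrite [diag_mx d _ _]mxE eq_sym (negbTE ji) mulr0n mulr0.
set N := \sum_i `|q i ord0|.
have NW : N ^+ 2 <= r%:R * W by exact: sum_norm_sqr.
have W0 : 0 <= W by apply: sumr_ge0 => i _; exact: sqr_ge0.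
have b2 : `|\sum_i \sum_j q i ord0 * q j ord0 * M i j - W| <= t * N ^+ 2.
  have -> : \sum_i \sum_j q i ord0 * q j ord0 * M i j - W =
      \sum_i \sum_j q i ord0 * q j ord0 * (M i j - diag_mx d i j).
    rewrite EW -sumrB; apply: eq_bigr => i _; rewrite -sumrB.
    by apply: eq_bigr => j _; rewrite mulrBr.
  exact: quad_form_close.
have b1 : (\sum_i q i ord0 * m i) ^+ 2 <= t * N ^+ 2.
  have h : `|\sum_i q i ord0 * m i| <= t * N.
    rewrite /N mulr_sumr; apply: le_trans (ler_norm_sum _ _ _) _; apply: ler_sum => i _.
    by rewrite normrM mulrC ler_wpM2r.
  rewrite -real_normK ?num_real//; apply: (@le_trans _ _ ((t * N) ^+ 2)).
    by rewrite lerXn2r ?nnegrE// (le_trans _ h).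
  by rewrite exprMn ler_wpM2r ?sqr_ge0// expr2 ler_piMr.
rewrite E2 E1; set u := \sum_i \sum_j _ in b2 *; set v := \sum_i q i ord0 * m i in b1 *.
rewrite addrAC; apply: le_trans (ler_normB _ _) _.
rewrite [`|v ^+ 2|]ger0_norm ?sqr_ge0//; apply: le_trans (lerD b2 b1) _.
have := ler_wpM2l t0 NW; lra.
Qed.

End sparse_isometry.

Section sparse_isometry_probability.
Context {R : realType} {d : measure_display} {T0 : measurableType d} (Q : probability T0 R).
Context (p : nat) (U X0 : {RV Q >-> 'cV[R]_p}) (S : 'M[R]_p) (K1 : R).
Hypothesis U_mean : forall j, ('E_Q[fun w => U w j ord0] = 0)%E.
Hypothesis U_cov : forall j k,
  ('E_Q[fun w => (U w j ord0 * U w k ord0)%R] = ((j == k)%:R)%:E)%E.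
Hypothesis U_psi2 : (psi2_norm_vec Q U <= K1%:E)%E.
Hypothesis X0E : forall w, X0 w = S *m U w.
Context {d' : measure_display} {T : measurableType d'} (P : probability T R).
Context (n : nat) (X : 'I_n -> {RV P >-> 'cV[R]_p}).
Hypothesis X_iid : iid P X (distribution Q X0).
Let a := psi2_rate K1.

Let mX i : measurable_fun setT (X i) := measurable_funPT (X i).

Lemma kernel_as r (D : 'M[R]_(r, p)) k : D *m S = 0 ->
  measurable [set w | D *m X k w <> 0] /\ P [set w | D *m X k w <> 0] = 0%E.
Proof.
move=> DS0; pose B := [set y : 'cV[R]_p | D *m y <> 0].
have mB : measurable B.
  rewrite (_ : B = (fun y => l2norm (D *m y)) @^-1` (~` [set 0])).
    rewrite -[X in measurable X]setTI.
    have mf := measurableT_comp (@measurable_l2norm R r) (measurable_mulmx_self D).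
    by apply: mf => //; apply: measurableC.
  apply/seteqP; split => y /= H H'; apply: H.
    apply/colP => i; rewrite [RHS]mxE; apply/eqP; rewrite -sqrf_eq0.
    have : l2norm (D *m y) ^+ 2 = 0 by rewrite H' expr0n.
    rewrite sqr_l2norm dotvE => /eqP; rewrite psumr_eq0 => [|j _]; last by rewrite -expr2 sqr_ge0.
    by move=> /allP/(_ i); rewrite mem_index_enum expr2 => /(_ isT).
  by rewrite H'; apply/eqP; rewrite -sqrf_eq0 sqr_l2norm dotvE big1// => i _; rewrite mxE mulr0.
have XB : [set w | D *m X k w <> 0] = X k @^-1` B by [].
split; rewrite XB; first by rewrite -[X in measurable X]setTI; exact: mX.
have [_ law] := X_iid; rewrite law// /distribution /pushforward.
rewrite (_ : _ @^-1` _ = set0) ?measure0//.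
by apply/seteqP; split => w //=; rewrite /B/= X0E mulmxA DS0 mul0mx.
Qed.

Lemma sparse_isometry_prob s (x : R) : (0 < p)%N -> (0 < n)%N ->
  0 <= x <= 1 -> x <= 32 * expR 1 / a ->
  exists Bad, [/\ measurable Bad,
    (P Bad <= ((p%:R ^+ s * p%:R ^+ s * (2 * s%:R)) ^+ 2 *
       (4 * expR (- (n%:R * x ^+ 2 / (128 * expR 1 / a ^+ 2)))))%:E)%E &
    forall w, ~ Bad w -> forall u v : 'cV[R]_p, (l0norm u <= s)%N -> (l0norm v <= s)%N ->
      `|qform (sample_cov (fun i => X i w)) (u + v) - dotv (S^T *m (u + v)) (S^T *m (u + v))| <=
      4 * s%:R * x * dotv (S^T *m (u + v)) (S^T *m (u + v))].
Proof.
move=> p0 n0 x01 xa.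
pose H := ({ffun 'I_s -> 'I_p} * {ffun 'I_s -> 'I_p})%type.
pose D (h : H) : 'M[R]_(s + s, p) := col_mx (select h.1) (select h.2).
have /choice[G HG] : forall h : H, exists g : 'M[R]_(s + s) * 'M[R]_(s + s) * 'rV[R]_(s + s),
   [/\ forall i, g.2 ord0 i = 0 \/ g.2 ord0 i = 1,
       D h *m S = g.1.2 *m (g.1.1 *m (D h *m S)),
       (g.1.1 *m (D h *m S)) *m (g.1.1 *m (D h *m S))^T = diag_mx g.2
     & diag_mx g.2 *m g.1.1 = g.1.1].
  move=> h; have [B [C [g ?]]] := gram_schmidt (D h *m S).
  by exists (B, C, g).
pose b (o : H * 'I_(s + s)) : 'cV[R]_p := (row o.2 ((G o.1).1.1 *m D o.1))^T.
have bdot o y : dotv (b o) y = ((G o.1).1.1 *m (D o.1 *m y)) o.2 ord0.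
  by rewrite /dotv /b trmxK -row_mul mxE mulmxA.
have bS o o' : o.1 = o'.1 -> dotv (S^T *m b o) (S^T *m b o') = diag_mx (G o.1).2 o.2 o'.2.
  move=> oE; have [_ _ EE _] := HG o.1.
  rewrite dotv_trmx bdot /b -oE rowE !trmx_mul trmx_delta !mulmxA.
  move: EE; rewrite !trmx_mul !mulmxA => ->.
  by rewrite -colE mxE.
have hb o : null_or_unit (S^T *m b o).
  rewrite /null_or_unit bS//; have [d01 _ _ _] := HG o.1.
  by rewrite mxE eqxx mulr1n; exact: d01.
have xb : 0 <= x <= 32 * expR 1 / a by case/andP: x01 => -> _.
have [B1 [mB1 PB1 HB1]] := cov_concentration U_mean U_cov U_psi2 X0E X_iid hb xb.
pose E h : 'M[R]_(s + s, p) := D h - (G h).1.2 *m ((G h).1.1 *m D h).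
have E0 h : E h *m S = 0.
  by rewrite /E mulmxBl -!mulmxA; have [_ <- _ _] := HG h; rewrite subrr.
pose F (o : H * 'I_n) := [set w | E o.1 *m X o.2 w <> 0].
have mF o : measurable (F o) by have [] := kernel_as o.2 (E0 o.1).
have PF o : P (F o) = 0%E by have [] := kernel_as o.2 (E0 o.1).
have [mU PU] := measure_exists_le P mF.
exists (B1 `|` [set w | exists o, F o w]); split.
- exact: measurableU.
- apply: le_trans (measureU2 _ mB1 mU) _.
  rewrite -[leRHS]adde0; apply: leeD; last first.
    by apply: le_trans PU _; rewrite (eq_bigr (fun=> 0%E)) ?big1// => o _; exact: PF.
  move: PB1; rewrite !card_prod !card_ffun !card_ord !natrM !natrX natrD.
  by rewrite (_ : s%:R + s%:R = 2 * s%:R :> R) //; ring.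
- move=> w /not_orP[nB nF] u v us vs.
  have [M2 M1] := HB1 _ nB.
  have [f [c uE]] := sparse_select p0 us; have [g [c' vE]] := sparse_select p0 vs.
  pose h : H := (f, g).
  have uvE : u + v = (D h)^T *m col_mx c c'.
    by rewrite /D tr_col_mx mul_row_col uE vE.
  have [d01 AE EE dB] := HG h.
  have Dx k : D h *m X k w = (G h).1.2 *m ((G h).1.1 *m (D h *m X k w)).
    apply/eqP; rewrite -subr_eq0; apply/eqP; apply: contrapT => ne; apply: nF.
    by exists (h, k); rewrite /F/= /E mulmxBl -!mulmxA.
  have := @whitened_qform_close _ _ _ _ (fun k => X k w) (D h) S _ _ _ x (col_mx c c') n0
    x01 d01 AE EE dB Dx.
  rewrite -uvE natrD (_ : 2 * (s%:R + s%:R) = 4 * s%:R :> R); last by ring.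
  apply.
  + move=> i j; have := M2 (h, i) (h, j).
    by rewrite bS//=; under eq_bigr do rewrite !bdot/=.
  + by move=> i; have := M1 (h, i); under eq_bigr do rewrite !bdot/=.
Qed.

End sparse_isometry_probability.

Section countable_sup.
Context {R : realType}.

Lemma qformZ p (A : 'M[R]_p) c (u : 'cV[R]_p) : qform A (c *: u) = c ^+ 2 * qform A u.
Proof. by rewrite /qform -scalemxAr dotvZr dotvZl mulrA expr2. Qed.

Lemma l0normZ p c (u : 'cV[R]_p) : c != 0 -> l0norm (c *: u) = l0norm u.
Proof.
move=> c0; apply: eq_card => j; rewrite !inE mxE mulf_eq0 negb_or c0//.
Qed.

Lemma l2normZ p c (u : 'cV[R]_p) : 0 <= c -> l2norm (c *: u) = c * l2norm u.
Proof.
move=> c0; apply/eqP; rewrite -(@eqrXn2 _ 2) ?l2norm_ge0 ?mulr_ge0 ?l2norm_ge0//.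
by rewrite exprMn !sqr_l2norm dotvZr dotvZl mulrA -expr2.
Qed.

Lemma l0norm_dotv_gt0 p (u : 'cV[R]_p) : (0 < l0norm u)%N -> 0 < dotv u u.
Proof.
move=> /card_gt0P[j]; rewrite inE => uj.
rewrite dotvE (bigD1 j)//= ltr_pwDl// -?expr2 ?exprn_even_gt0//.
by apply: sumr_ge0 => k _; rewrite -expr2 sqr_ge0.
Qed.

Lemma rat_approx (x : R) : exists r : nat -> rat,
  [/\ forall k, x != 0 -> r k != 0, x = 0 -> forall k, r k = 0 &
  (fun k => ratr (r k) : R) @ \oo --> x].
Proof.
have [->|x0] := eqVneq x 0.
  exists (fun=> 0); split => //; rewrite (_ : (fun=> _) = fun=> 0); first exact: cvg_cst.
  by apply/funext => k; rewrite rmorph0.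
have nx0 : 0 < `|x| by rewrite normr_gt0.
pose h k : R := `|x| * k.+1%:R^-1.
have h0 k : 0 < h k by rewrite mulr_gt0 ?invr_gt0.
have /choice[r Hr] : forall k, exists r : rat, (ratr r : R) \in `]x - h k, x + h k[.
  by move=> k; apply: rat_in_itvoo; have := h0 k; lra.
have rx k : `|ratr (r k) - x| < h k.
  by have := Hr k; rewrite in_itv/= ltr_distl.
exists r; split => [k _|x0'|]; last 2 first.
- by move: x0; rewrite x0' eqxx.
- have ch : h @ \oo --> (0 : R).
    rewrite -(mulr0 `|x|); apply: cvgM; [exact: cvg_cst|exact: cvg_harmonic].
  apply/cvgrPdist_lt => e e0; near=> k.
  rewrite distrC; apply: lt_trans (rx k) _.
  near: k; move/cvgrPdist_lt: ch => /(_ e e0); apply: filterS => k.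
  by rewrite sub0r normrN gtr0_norm.
- apply/eqP => rk; have := rx k; rewrite rk rmorph0 sub0r normrN /h.
  by rewrite ltNge ler_piMr// invf_le1// ler1n.
Unshelve. all: by end_near. Qed.

Lemma rational_sparse_dense p s : (1 <= s <= p)%N -> exists q : nat -> 'cV[R]_p,
  (forall k, l0norm (q k) = s) /\
  forall a : 'cV[R]_p, l0norm a = s -> exists i : nat -> nat,
    forall j, (fun k => q (i k) j ord0) @ \oo --> a j ord0.
Proof.
move=> /andP[s1 sp].
pose q0 : 'cV[R]_p := \col_j (j < s)%:R.
have q0s : l0norm q0 = s.
  rewrite /l0norm (eq_card (B := [pred j : 'I_p | (j < s)%N])); last first.
    by move=> j; rewrite !inE mxE pnatr_eq0; case: (j < s)%N.
  by rewrite -sum1_card (eq_bigl (fun j : 'I_p => (j < s)%N))// -(big_ord_widen _ (fun=> 1%N))//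
    sum1_card card_ord.
pose rv (u : 'cV[rat]_p) : 'cV[R]_p := map_mx ratr u.
pose q k : 'cV[R]_p := if @unpickle 'cV[rat]_p k is Some u then
  if l0norm (rv u) == s then rv u else q0 else q0.
exists q; split.
  by move=> k; rewrite /q; case: unpickle => // u; case: eqP.
move=> a as_.
have /choice[r Hr] : forall j, exists r : nat -> rat,
   [/\ forall k, a j ord0 != 0 -> r k != 0, a j ord0 = 0 -> forall k, r k = 0 &
   (fun k => ratr (r k) : R) @ \oo --> a j ord0] by move=> j; exact: rat_approx.
pose v k : 'cV[rat]_p := \col_j r j k.
exists (fun k => pickle (v k)) => j.
have qE k : q (pickle (v k)) = rv (v k).
  rewrite /q pickleK ifT//; apply/eqP; rewrite -as_; apply: eq_card => i.
  rewrite !inE !mxE fmorph_eq0; have [h1 h2 _] := Hr i.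
  by have [/h2->|/h1->] := eqVneq (a i ord0) 0; rewrite ?eqxx.
have -> : (fun k => q (pickle (v k)) j ord0) = (fun k => ratr (r j k)).
  by apply/funext => k; rewrite qE !mxE.
by have [] := Hr j.
Qed.

Lemma sup_stat_countable p s : (1 <= s <= p)%N -> exists q : nat -> 'cV[R]_p,
  (forall k, l0norm (q k) = s) /\
  forall (A : 'M[R]_p) z t c, 0 < c ->
    (forall k, c * dotv (q k) (q k) <= qform A (q k)) ->
    sup_stat s A z <= t <-> forall k, dotv (q k) z <= t * Num.sqrt (qform A (q k)).
Proof.
move=> hs; have [q [qs qd]] := rational_sparse_dense hs; have /andP[s1 sp] := hs.
exists q; split => // A z t c c0 cAq.
have cdot i (a : 'cV[R]_p) (y : 'cV[R]_p) :
    (forall j, (fun k => q (i k) j ord0) @ \oo --> a j ord0) ->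
    (fun k => dotv (q (i k)) y) @ \oo --> dotv a y.
  move=> qi; rewrite dotvE; under eq_fun do rewrite dotvE.
  by apply: (cvg_big add_continuous) => j _; apply: cvgM; [exact: qi|exact: cvg_cst].
have cq i (B : 'M[R]_p) (a : 'cV[R]_p) :
    (forall j, (fun k => q (i k) j ord0) @ \oo --> a j ord0) ->
    (fun k => qform B (q (i k))) @ \oo --> qform B a.
  move=> qi; rewrite /qform dotvE; under eq_fun do rewrite dotvE.
  apply: (cvg_big add_continuous) => j _; apply: cvgM; first exact: qi.
  rewrite mxE; under eq_fun do rewrite mxE.
  by apply: (cvg_big add_continuous) => l _; apply: cvgM; [exact: cvg_cst|exact: qi].
have cA u : l0norm u = s -> c * dotv u u <= qform A u.
  move=> us; have [i qi] := qd u us.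
  have c1 := cq i 1%:M u qi.
  have e1 v : dotv v v = qform 1%:M v by rewrite /qform mul1mx.
  have c2 : (fun k => c * qform 1%:M (q (i k))) @ \oo --> c * qform 1%:M u.
    by apply: cvgM => //; exact: cvg_cst.
  rewrite e1; apply: ler_cvg_to c2 (cq i A u qi) _; apply: nearW => k.
  by rewrite -e1.
have A0 u : l0norm u = s -> 0 < qform A u.
  move=> us; apply: lt_le_trans (cA u us); rewrite mulr_gt0// l0norm_dotv_gt0//.
  by rewrite us.
set E := [set dotv a z / Num.sqrt (qform A a) | a in sparse_sphere s].
have normalized u : l0norm u = s -> E (dotv u z / Num.sqrt (qform A u)).
  move=> us; have u0 : 0 < dotv u u by apply: l0norm_dotv_gt0; rewrite us.
  have l0 : 0 < l2norm u.
    by rewrite lt_neqAle l2norm_ge0 andbT eq_sym -sqrf_eq0 sqr_l2norm gt_eqF.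
  have li0 : 0 < (l2norm u)^-1 by rewrite invr_gt0.
  exists ((l2norm u)^-1 *: u).
    split; first by rewrite l2normZ ?ltW// mulVf// gt_eqF.
    by rewrite l0normZ// gt_eqF.
  rewrite qformZ dotvZl sqrtrM ?sqr_ge0// sqrtr_sqr gtr0_norm//.
  by rewrite invfM invrK mulrACA mulVf ?mul1r ?gt_eqF// .
have Eub : has_ubound E.
  exists (l2norm z / Num.sqrt c) => _ [a [a1 as_] <-].
  have sc : 0 < Num.sqrt c by rewrite sqrtr_gt0.
  rewrite ler_pdivrMr ?sqrtr_gt0 ?A0//; apply: le_trans (dotv_le_norm _ _) _.
  rewrite a1 mul1r mulrAC ler_pdivlMr// ler_wpM2l ?l2norm_ge0//.
  rewrite ler_wsqrtr//.
  by have := cA a as_; rewrite -sqr_l2norm a1 expr1n mulr1.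
split.
  move=> st k; have := normalized (q k) (qs k) => /(ub_le_sup Eub)/le_trans/(_ st).
  by rewrite ler_pdivrMr// sqrtr_gt0 A0.
move=> H; apply: ge_sup; first by exists (dotv (q 0%N) z / Num.sqrt (qform A (q 0%N))); exact: normalized.
move=> _ [a [a1 as_] <-]; rewrite ler_pdivrMr ?sqrtr_gt0 ?A0//.
have [i qi] := qd a as_.
have cs : (fun k => t * Num.sqrt (qform A (q (i k)))) @ \oo --> t * Num.sqrt (qform A a).
  by apply: cvgM; [exact: cvg_cst|]; apply: (cvg_comp _ _ (cq i A a qi)); exact: sqrt_continuous.
apply: ler_cvg_to (cdot i a z qi) cs _; exact: nearW.
Qed.

End countable_sup.

Section studentized_directions.
Context {R : realType}.

Lemma qform_mulmx_tr p m (A : 'M[R]_(p, m)) (u : 'cV[R]_p) :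
  qform (A *m A^T) u = dotv (A^T *m u) (A^T *m u).
Proof. by rewrite /qform dotv_trmx mulmxA. Qed.

Definition studentized p m (A : 'M[R]_(p, m)) (q : nat -> 'cV[R]_p) (k : nat) : 'cV[R]_m :=
  (l2norm (A^T *m q k))^-1 *: (A^T *m q k).

Lemma l2norm_gt0 m (u : 'cV[R]_m) : (0 < l2norm u) = (0 < dotv u u).
Proof.
rewrite -sqr_l2norm; apply/idP/idP => h; first by rewrite exprn_gt0.
by rewrite lt_neqAle l2norm_ge0 andbT eq_sym -sqrf_eq0 gt_eqF.
Qed.

Lemma studentized_unit p m (A : 'M[R]_(p, m)) q k :
  0 < dotv (A^T *m q k) (A^T *m q k) -> dotv (studentized A q k) (studentized A q k) = 1.
Proof.
move=> h; rewrite /studentized dotvZl dotvZr mulrA -sqr_l2norm -expr2 -exprMn.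
by rewrite mulVf ?expr1n// gt_eqF// l2norm_gt0.
Qed.

Lemma sup_stat_below p m (A : 'M[R]_(p, m)) (q : nat -> 'cV[R]_p) t :
  (forall k, 0 < dotv (A^T *m q k) (A^T *m q k)) ->
  [set y | forall k, dotv (q k) (A *m y) <= t * Num.sqrt (qform (A *m A^T) (q k))] =
  below (studentized A q) t.
Proof.
move=> hq; apply/seteqP; split => y /= H k; have := H k;
  rewrite /studentized dotvZl dotv_trmx qform_mulmx_tr -sqr_l2norm sqrtr_sqr
    (ger0_norm (l2norm_ge0 _)) ler_pdivrMl ?l2norm_gt0// mulrC//.
Qed.

Lemma correlation_compare p m m' (A : 'M[R]_(p, m)) (A' : 'M[R]_(p, m')) q j k (al be : R) :
  0 < al -> 0 < be ->
  (forall i, 0 < dotv (A^T *m q i) (A^T *m q i)) ->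
  (forall i, 0 < dotv (A'^T *m q i) (A'^T *m q i)) ->
  (forall x y, let z := x *: q j + y *: q k in
     al * dotv (A^T *m z) (A^T *m z) <= dotv (A'^T *m z) (A'^T *m z) <=
     be * dotv (A^T *m z) (A^T *m z)) ->
  al / be * (1 - dotv (studentized A' q j) (studentized A' q k)) <=
  1 - dotv (studentized A q j) (studentized A q k).
Proof.
move=> al0 be0 hA hA' H.
set u := studentized A q; set v := studentized A' q.
pose la i := (l2norm (A^T *m q i))^-1.
have la0 i : 0 < la i by rewrite invr_gt0 l2norm_gt0.
pose nu i := la i * l2norm (A'^T *m q i).
have nu0 i : 0 < nu i by rewrite mulr_gt0// l2norm_gt0.
have uE i : A^T *m (la i *: q i) = u i by rewrite -scalemxAr.
have vE i : A'^T *m (la i *: q i) = nu i *: v i.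
  by rewrite -scalemxAr /v /studentized scalerA /nu mulfK// gt_eqF// l2norm_gt0.
have u1 i : dotv (u i) (u i) = 1 by exact: studentized_unit.
have v1 i : dotv (v i) (v i) = 1 by exact: studentized_unit.
move: u v nu nu0 uE vE u1 v1 => u v nu nu0 uE vE u1 v1.
have nuge i : i = j \/ i = k -> al <= nu i ^+ 2.
  move=> ijk; have : al * dotv (u i) (u i) <= dotv (nu i *: v i) (nu i *: v i).
    rewrite -uE -vE; case: ijk => ->.
      by have /= := H (la j) 0; rewrite scale0r addr0 => /andP[].
    by have /= := H 0 (la k); rewrite scale0r add0r => /andP[].
  by rewrite u1 mulr1 dotvZl dotvZr v1 mulr1 -expr2.
have nunu : al <= nu j * nu k.
  rewrite -(@ler_pXn2r _ 2) ?nnegrE ?(ltW al0) ?mulr_ge0 ?(ltW (nu0 _))//.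
  by rewrite exprMn expr2; apply: ler_pM; rewrite ?(ltW al0)// nuge; auto.
have /= /andP[_] := H (la j) (- la k).
rewrite !mulmxDr !scaleNr !mulmxN uE uE vE vE.
rewrite !dotvBl !dotvBr u1 u1 !dotvZl !dotvZr !v1 (dotvC (u k)) (dotvC (v k)).
have c1 := dotv_unit_le1 (v1 j) (v1 k).
set c := dotv (v j) (v k) in c1 *; set c' := dotv (u j) (u k) => h.
have h2 : 2 * (nu j * nu k * (1 - c)) <= be * (2 * (1 - c')).
  have := sqr_ge0 (nu j - nu k); nra.
rewrite mulrAC ler_pdivrMr//.
have h3 : al * (1 - c) <= nu j * nu k * (1 - c) by rewrite ler_wpM2r// subr_ge0.
lra.
Qed.

Definition bootstrap_mx n p (x : 'I_n -> 'cV[R]_p) : 'M[R]_(p, n) :=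
  \matrix_(j, i) ((Num.sqrt n%:R)^-1 * (x i - sample_mean x) j ord0).

Lemma bootstrap_vecE n p (xi : 'I_n -> R) (x : 'I_n -> 'cV[R]_p) :
  bootstrap_vec xi x = bootstrap_mx x *m \col_i xi i.
Proof.
apply/colP => j; rewrite /bootstrap_vec [LHS]mxE summxE [RHS]mxE mulr_sumr.
apply: eq_bigr => i _; rewrite [bootstrap_mx _ _ _]mxE.
by move: (x i - sample_mean x) => y; rewrite !mxE; ring.
Qed.

Lemma sample_covE n p (x : 'I_n -> 'cV[R]_p) :
  sample_cov x = bootstrap_mx x *m (bootstrap_mx x)^T.
Proof.
apply/matrixP => j k; rewrite /sample_cov [LHS]mxE summxE [RHS]mxE mulr_sumr.
apply: eq_bigr => i _; rewrite [(bootstrap_mx x)^T _ _]mxE ![bootstrap_mx _ _ _]mxE.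
have -> : n%:R^-1 = (Num.sqrt n%:R)^-1 * (Num.sqrt n%:R)^-1 :> R.
  by rewrite -invfM -expr2 sqr_sqrtr.
by move: (x i - sample_mean x) => y; rewrite !mxE big_ord1 !mxE; ring.
Qed.

End studentized_directions.

Section cdf_comparison.
Context {R : realType}.
Local Open Scope ereal_scope.
Local Notation gamma1 := (@normal_prob R 0 1).
Local Notation peak := (@normal_peak R 1).

Let pdfE (z : R) : normal_pdf 0 1 z = (peak * expR (- z ^+ 2 / 2))%R.
Proof. by rewrite normal_pdf_neq0E ?oner_eq0// subr0 expr1n. Qed.

Let leb_oc (a b : R) : (a <= b)%R -> lebesgue_measure `]a, b]%classic = (b - a)%:E.
Proof.
move=> ab; rewrite lebesgue_measure_itv/= lte_fin.
by case: ltgtP ab => // -> _; rewrite subrr.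
Qed.

Let int_cst (a b c : R) : (a <= b)%R ->
  \int[lebesgue_measure]_(x in `]a, b]%classic) c%:E = (c * (b - a))%:E.
Proof. by move=> ab; rewrite integral_cst//= leb_oc. Qed.

Lemma normal_tail (w : R) : (0 <= w)%R ->
  gamma1 [set z | (z < - w)%R] <= (2 * expR (- (w ^+ 2 / 4)))%:E.
Proof.
move=> w0; have mA : measurable [set z : measurableTypeR R | (z < - w)%R].
  rewrite (_ : [set z | _] = `]-oo, (- w)%R[%classic); first exact: measurable_itv.
  by apply/seteqP; split => z /=; rewrite in_itv.
have mE : measurable_fun setT (fun z : measurableTypeR R => (expR (z ^+ 2 / 4))%:E).
  apply/measurable_EFinP; apply: (measurableT_comp (@measurable_expR R)).
  by apply: measurable_funM => //; exact: measurable_funX.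
apply: (@le_trans _ _ (\int[gamma1]_z ((expR (- (w ^+ 2 / 4)))%:E * (expR (z ^+ 2 / 4))%:E))).
  rewrite -(setIT [set z | _]) -integral_indic//; apply: ge0_le_integral => //.
  - by apply/measurable_EFinP; exact: measurable_indic.
  - exact: measurable_funeM.
  - move=> z _; rewrite -EFinM lee_fin -expRD indicE.
    case: (boolP (z \in _)) => [/set_mem/= H|_]; last exact: expR_ge0.
    rewrite -[X in (X <= _)%R]expR0 ler_expR; nra.
rewrite [X in X <= _](_ : _ = (expR (- (w ^+ 2 / 4)))%:E * \int[gamma1]_z (expR (z ^+ 2 / 4))%:E); last first.
  by apply: (ge0_integralZl gamma1 measurableT mE) => [z _|]; rewrite lee_fin expR_ge0.
rewrite integral_expR_sqr4 -EFinM lee_fin mulrC ler_wpM2r ?expR_ge0//.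
by rewrite -(@ler_pXn2r _ 2) ?nnegrE// sqr_sqrtr// expr2 ler_peMl// ler1n.
Qed.

Let mpdf (D : set (measurableTypeR R)) :
  measurable_fun D (fun z : measurableTypeR R => (normal_pdf 0 1 z)%:E).
Proof. by apply/measurable_EFinP; apply: measurable_funTS; exact: measurable_normal_pdf. Qed.

Lemma normal_ray_lower (t h : R) : (0 <= t)%R -> (0 < h)%R ->
  (peak * expR (- (t + h) ^+ 2 / 2) * h)%:E <= gamma1 `]t, +oo[.
Proof.
move=> t0 h0; set mn := (_ * expR _)%R.
have pk0 : (0 < peak)%R by rewrite normal_peak_gt0.
have mn0 : (0 < mn)%R by rewrite mulr_gt0// expR_gt0.
apply: (@le_trans _ _ (gamma1 `]t, (t + h)%R])).
  have -> : (mn * h)%:E = \int[lebesgue_measure]_(x in `]t, (t + h)%R]%classic) mn%:E.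
    by rewrite int_cst ?lerDl ?(ltW h0)// addrAC subrr add0r.
  rewrite /normal_prob; apply: ge0_le_integral => //.
  + by move=> z _; rewrite lee_fin ltW.
  + move=> z /=; rewrite in_itv/= => /andP[z1 z2]; rewrite lee_fin pdfE.
    rewrite ler_wpM2l ?(ltW pk0)// ler_expR; nra.
apply: le_measure; rewrite ?inE//.
by move=> z /=; rewrite !in_itv/= andbT => /andP[].
Qed.

Lemma normal_interval_ratio (t1 t2 h c : R) : (t1 <= t2)%R -> (0 < h)%R -> (0 <= t2)%R ->
  (forall z, (t1 <= z <= t2 -> (t2 + h) ^+ 2 - z ^+ 2 <= 2 * c)%R) ->
  gamma1 `]t1, t2] <= ((t2 - t1) / h * expR c)%:E * gamma1 `]t2, +oo[.
Proof.
move=> t12 h0 t20 H.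
pose mn : R := (peak * expR (- (t2 + h) ^+ 2 / 2))%R.
have pk0 : (0 < peak)%R by rewrite normal_peak_gt0.
have mn0 : (0 < mn)%R by rewrite mulr_gt0// expR_gt0.
have up : gamma1 `]t1, t2] <= (mn * expR c * (t2 - t1))%:E.
  rewrite -int_cst// /normal_prob; apply: ge0_le_integral => //.
  - by move=> z _; rewrite lee_fin normal_pdf_ge0.
  - move=> z /=; rewrite in_itv/= => /andP[/ltW z1 z2]; rewrite lee_fin pdfE.
    rewrite -mulrA -expRD ler_wpM2l ?(ltW pk0)// ler_expR.
    by have := H z; rewrite z1 z2 => /(_ isT); lra.
have lo : (mn * h)%:E <= gamma1 `]t2, +oo[ by exact: normal_ray_lower.
apply: le_trans up _.
have k0 : (0 <= (t2 - t1) / h * expR c)%R by rewrite mulr_ge0 ?expR_ge0// divr_ge0 ?subr_ge0// ltW.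
apply: le_trans (lee_wpmul2l _ lo); last by rewrite lee_fin.
rewrite -EFinM lee_fin le_eqVlt; apply/orP; left; apply/eqP.
by field; rewrite gt_eqF.
Qed.

Lemma gauss_cdf_increment m (u : nat -> 'cV[R]_m) (T e eps t1 t2 : R) :
  (forall k, dotv (u k) (u k) = 1%R) -> (0 <= T)%R -> (t1 <= t2)%R -> (0 <= t2)%R ->
  (0 <= e)%R -> (0 <= eps)%R -> (1 - e)%:E <= gauss m (below u T) ->
  (t1 <= T -> t2 - t1 <= eps)%R -> (eps * (T + 2) <= 1)%R ->
  gauss m (below u t2) <= gauss m (below u t1) + (e + (T + 2) * eps * expR 3)%:E.
Proof.
move=> u1 T0 t12 t20 e0 eps0 FT inc epsT.
have T2 : (0 < T + 2)%R by rewrite ltr_wpDl.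
have mono a b : (a <= b)%R -> gauss m (below u a) <= gauss m (below u b).
  move=> ab; apply: le_measure; rewrite ?inE; [exact: measurable_below|exact: measurable_below|].
  by move=> y /= H k; exact: le_trans (H k) ab.
have x0 : (0 <= (T + 2) * eps * expR 3)%R by rewrite !mulr_ge0 ?expR_ge0// ltW.
have [t1T|Tt1] := leP t1 T; last first.
  apply: (@le_trans _ _ 1%E); first by apply: probability_le1; exact: measurable_below.
  apply: (@le_trans _ _ (gauss m (below u T) + e%:E)).
    apply: le_trans (leeD2r e%:E FT).
    by rewrite -EFinD subrK.
  apply: leeD; first by apply: mono; exact: ltW.
  by rewrite lee_fin lerDl.
have {inc}inc := inc t1T.
pose h : R := ((T + 2)^-1)%R.
have h0 : (0 < h)%R by rewrite invr_gt0.
have hT : (h * (T + 2) = 1)%R by rewrite mulVf// gt_eqF.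
have eh : (eps <= h)%R by rewrite -[h]mul1r ler_pdivlMr.
have := @normal_interval_ratio t1 t2 h 3 t12 h0 t20.
have anti := anticoncentration u1 t12.
move=> rat.
have {}rat : gamma1 `]t1, t2] <= ((T + 2) * eps * expR 3)%:E * gamma1 `]t2, +oo[.
  apply: le_trans (rat _) _ => [z /andP[z1 z2]|].
    have f1 : (t2 + h - z <= 2 * h)%R by lra.
    have f2 : (t2 + h + z <= 2 * T + 3 * h)%R by lra.
    have f3 : (0 <= t2 + h + z)%R by lra.
    have f4 : (0 <= t2 + h - z)%R by lra.
    have -> : ((t2 + h) ^+ 2 - z ^+ 2 = (t2 + h - z) * (t2 + h + z))%R by ring.
    apply: le_trans (ler_pM f4 f3 f1 f2) _.
    have : (h <= 1 / 2)%R by nra.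
    nra.
  apply: lee_wpmul2r; first exact: measure_ge0.
  rewrite lee_fin ler_wpM2r ?expR_ge0// mulrC /h invrK ler_wpM2l// ltW//.
have g0 : 0 < gamma1 `]t2, +oo[.
  apply: lt_le_trans (normal_ray_lower t20 h0).
  by rewrite lte_fin !mulr_gt0 ?expR_gt0 ?normal_peak_gt0.
have gfin : gamma1 `]t2, +oo[ \is a fin_num by exact: fin_num_measure.
rewrite -(@lee_pmul2r _ (gamma1 `]t2, +oo[))// .
rewrite ge0_muleDl//; last by rewrite lee_fin addr_ge0.
apply: le_trans anti _; apply: leeD => //.
apply: le_trans rat _; apply: lee_wpmul2r; first exact: measure_ge0.
by rewrite lee_fin lerDr.
Qed.

Lemma gauss_cdf_close m m' (u : nat -> 'cV[R]_m) (v : nat -> 'cV[R]_m') (eta T w e eps t : R) :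
  (forall k, dotv (u k) (u k) = 1%R) -> (forall k, dotv (v k) (v k) = 1%R) ->
  (0 <= eta < 1)%R ->
  (forall j k, (1 - eta) * (1 - dotv (v j) (v k)) <= 1 - dotv (u j) (u k))%R ->
  (forall j k, (1 - eta) * (1 - dotv (u j) (u k)) <= 1 - dotv (v j) (v k))%R ->
  (0 <= T)%R -> (0 <= w)%R -> (0 <= e)%R -> (1 - e)%:E <= gauss m (below u T) ->
  (T * ((Num.sqrt (1 - eta))^-1 - 1) + Num.sqrt eta * w / Num.sqrt (1 - eta) <= eps)%R ->
  (eps * (T + 2) <= 1)%R -> (0 <= t)%R ->
  let b := (e + (T + 2) * eps * expR 3 + 2 * expR (- (w ^+ 2 / 4)))%:E in
  gauss m (below u t) <= gauss m' (below v t) + b /\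
  gauss m' (below v t) <= gauss m (below u t) + b.
Proof.
move=> u1 v1 /andP[eta0 eta1] Huv Hvu T0 w0 e0 FT epsE epsT t0 b.
set rho := Num.sqrt (1 - eta) in epsE *; pose r := (Num.sqrt eta * w)%R.
have rho0 : (0 < rho)%R by rewrite sqrtr_gt0 subr_gt0.
have rho1 : (rho <= 1)%R.
  by rewrite -sqrtr1 ler_wsqrtr// gerBl.
have irho : (1 <= rho^-1)%R by rewrite invf_ge1.
have r0 : (0 <= r)%R by rewrite mulr_ge0// sqrtr_ge0.
have eps0 : (0 <= eps)%R.
  by apply: le_trans epsE; rewrite addr_ge0 ?mulr_ge0 ?subr_ge0// invr_ge0 ltW.
have tail : gamma1 [set z | (Num.sqrt eta * z < - r)%R] <= (2 * expR (- (w ^+ 2 / 4)))%:E.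
  apply: le_trans (normal_tail w0); apply: le_measure; rewrite ?inE.
  - rewrite -[X in measurable X]setTI.
    have mf : measurable_fun setT (fun z : measurableTypeR R => (Num.sqrt eta * z)%R).
      exact: measurable_funM.
    have -> : [set z : R | (Num.sqrt eta * z < - r)%R] =
        (fun z => Num.sqrt eta * z)%R @^-1` `]-oo, (- r)%R[.
      by apply/seteqP; split => z /=; rewrite in_itv.
    by apply: mf.
  - rewrite (_ : [set z | _] = `]-oo, (- w)%R[%classic); first exact: measurable_itv.
    by apply/seteqP; split => z /=; rewrite in_itv.
  - move=> z /=; rewrite /r -mulrN => H; rewrite ltNge; apply/negP => wz.
    by move: H; rewrite ltNge ler_wpM2l// sqrtr_ge0.
have inc t1 : (t1 <= T -> (t1 + r) / rho - t1 <= eps)%R.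
  move=> t1T; apply: le_trans epsE; rewrite -/r.
  have : (t1 * (rho^-1 - 1) <= T * (rho^-1 - 1))%R by rewrite ler_wpM2r// subr_ge0.
  by rewrite mulrDl; lra.
have e01 : (0 <= eta < 1)%R by rewrite eta0.
split.
- pose t1 := (rho * t - r)%R.
  have tE : t = ((t1 + r) / rho)%R by rewrite /t1 subrK mulrC mulKf// gt_eqF.
  have t1t : (t1 <= t)%R by rewrite /t1; nra.
  have G := @gauss_comparison R m m' u v eta t1 r u1 v1 e01 Huv; rewrite -/rho -tE in G.
  have A := @gauss_cdf_increment m u T e eps t1 t u1 T0 t1t t0 e0 eps0 FT.
  have {}A := A (fun h => ltac:(rewrite [X in (X - _)%R]tE; exact: inc)) epsT.
  apply: le_trans A _.
  have -> : b = (2 * expR (- (w ^+ 2 / 4)))%:E + (e + (T + 2) * eps * expR 3)%:E.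
    by rewrite /b addrC EFinD.
  rewrite addeA; apply: leeD => //.
  by apply: le_trans G _; apply: leeD.
- pose t2 := ((t + r) / rho)%R.
  have tt2 : (t <= t2)%R by rewrite /t2 ler_pdivlMr//; nra.
  have G := @gauss_comparison R m' m v u eta t r v1 u1 e01 Hvu; rewrite -/rho -/t2 in G.
  have A := @gauss_cdf_increment m u T e eps t t2 u1 T0 tt2 (le_trans t0 tt2) e0 eps0 FT
    (inc t) epsT.
  apply: le_trans G _; apply: le_trans (leeD A tail) _.
  by rewrite /b -addeA -EFinD.
Qed.

End cdf_comparison.

Section right_continuity.
Context {R : realType}.
Local Open Scope ereal_scope.

Lemma rat_above (t : R) : exists r : nat -> rat,
  forall k, (t < ratr (r k) < t + k.+1%:R^-1)%R.
Proof.
suff /choice[r Hr] : forall k : nat, exists r : rat, (t < ratr r < t + k.+1%:R^-1)%R by exists r.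
move=> k; have [|r] := @rat_in_itvoo R t (t + k.+1%:R^-1)%R.
  by rewrite ltrDl invr_gt0.
by rewrite in_itv/=; exists r.
Qed.

Lemma cdf_right_cvg d (E : measurableType d) (mu : {measure set E -> \bar R})
    (B : R -> set E) (t : R) (r : nat -> R) :
  (forall x, measurable (B x)) -> (forall x y, (x <= y)%R -> B x `<=` B y) ->
  (\bigcap_k B (t + k.+1%:R^-1)%R `<=` B t) -> mu (B (t + 1)%R) < +oo ->
  (forall k, t < r k < t + k.+1%:R^-1)%R ->
  mu (B (r k)) @[k --> \oo] --> mu (B t).
Proof.
move=> mB monoB capB fin rt.
have capE : \bigcap_k B (t + k.+1%:R^-1)%R = B t.
  apply/seteqP; split => // y By k _; apply: monoB By; by rewrite lerDl invr_ge0.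
have := @nonincreasing_cvg_mu _ _ _ mu (fun k => B (t + k.+1%:R^-1)%R).
rewrite capE invr1 => /(_ fin (fun=> mB _) (mB t)) H.
have {}H : mu (B (t + k.+1%:R^-1)%R) @[k --> \oo] --> mu (B t).
  apply: H; apply/nonincreasing_seqP => k; apply/subsetPset; apply: monoB.
  by rewrite lerD2l lef_pV2 ?posrE// ler_nat.
apply: (squeeze_cvge _ (cvg_cst (mu (B t))) H); apply: nearW => k.
have /andP[/ltW h1 /ltW h2] := rt k.
by apply/andP; split; apply: le_measure; rewrite ?inE//; exact: monoB.
Qed.

Lemma measurable_ray (t : R) : measurable [set r : R | (r <= t)%R].
Proof.
rewrite (_ : [set r : R | _] = `]-oo, t]%classic); first exact: measurable_itv.
by apply/seteqP; split => r /=; rewrite in_itv.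
Qed.

Lemma ray_right_closed (t : R) :
  \bigcap_k [set x : R | (x <= t + k.+1%:R^-1)%R] `<=` [set x | (x <= t)%R].
Proof.
move=> x H; apply/ler_addgt0Pl => e e0.
have [k ke] : exists k : nat, (k.+1%:R^-1 <= e)%R.
  have ie0 : (0 <= e^-1)%R by rewrite invr_ge0 ltW.
  have h := archi_boundP ie0; exists (Num.bound (e^-1)).
  rewrite invf_ple ?posrE//; apply: le_trans (ltW h) _.
  by rewrite ler_nat.
by apply: le_trans (H k I) _; rewrite addrC lerD2r.
Qed.

Lemma below_right_closed m (v : nat -> 'cV[R]_m) (t : R) :
  \bigcap_k below v (t + k.+1%:R^-1)%R `<=` below v t.
Proof. by move=> y H j; apply: ray_right_closed => k _; exact: H. Qed.

Lemma cdf_dist_gtP (mu nu : set R -> \bar R) (e : R) :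
  (forall t, mu [set r | (r <= t)%R] \is a fin_num) ->
  (forall t, nu [set r | (r <= t)%R] \is a fin_num) ->
  (forall t (r : nat -> R), (forall k, t < r k < t + k.+1%:R^-1)%R ->
    mu [set x | (x <= r k)%R] @[k --> \oo] --> mu [set x | (x <= t)%R]) ->
  (forall t (r : nat -> R), (forall k, t < r k < t + k.+1%:R^-1)%R ->
    nu [set x | (x <= r k)%R] @[k --> \oo] --> nu [set x | (x <= t)%R]) ->
  (e%:E < `|cdf_dist mu nu|) <-> exists r : rat, (0 <= ratr r :> R)%R /\
    e%:E < `|mu [set x | (x <= ratr r)%R] - nu [set x | (x <= ratr r)%R]|.
Proof.
move=> mufin nufin muc nuc.
have ub t : (0 <= t)%R -> `|mu [set x | (x <= t)%R] - nu [set x | (x <= t)%R]| <= cdf_dist mu nu.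
  by move=> t0; apply: ereal_sup_ubound; exists t.
have D0 : 0 <= cdf_dist mu nu by apply: le_trans (ub 0%R (lexx _)).
rewrite gee0_abs//; split; last first.
  by move=> [r [r0 h]]; exact: lt_le_trans h (ub _ r0).
move=> h; apply: contrapT => /forallNP H; move: h; apply/negP; rewrite -leNgt.
apply: ge_ereal_sup => _ [t t0 <-]; have [r rt] := rat_above t.
have C : mu [set x | (x <= ratr (r k))%R] - nu [set x | (x <= ratr (r k))%R] @[k --> \oo] -->
    mu [set x | (x <= t)%R] - nu [set x | (x <= t)%R].
  apply: cvgeB; [by apply: fin_num_adde_defl; rewrite fin_numN|exact: muc|exact: nuc].
apply: cvge_to_le (cvg_abse C) _; apply: nearW => k; rewrite leNgt; apply/negP => h.
apply: (H (r k)); split => //.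
by have /andP[tr _] := rt k; apply: le_trans t0 (ltW tr).
Qed.

End right_continuity.

Section bootstrap_measurable.
Context {R : realType} {d : measure_display} {T : measurableType d}.
Context (n p : nat) (Y : 'I_n -> T -> 'cV[R]_p).
Hypothesis mY : forall i, measurable_fun setT (Y i).

Lemma measurable_bootstrap_mx j i :
  measurable_fun setT (fun w => bootstrap_mx (fun i => Y i w) j i).
Proof.
have mYj k : measurable_fun setT (fun w => Y k w j ord0).
  exact: measurableT_comp (measurable_mx_entry _ _) (mY k).
rewrite (_ : (fun w => _) = fun w => (Num.sqrt n%:R)^-1 *
    (Y i w j ord0 - n%:R^-1 * \sum_k Y k w j ord0)); last first.
  by apply/funext => w; rewrite mxE; congr (_ * _); rewrite !mxE summxE.
apply: measurable_funM => //; apply: measurable_funB => //; apply: measurable_funM => //.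
exact: measurable_sum.
Qed.

Lemma measurable_qform_sample_cov q :
  measurable_fun setT (fun w => qform (sample_cov (fun i => Y i w)) q).
Proof.
rewrite (_ : (fun w => _) = fun w =>
    \sum_i (\sum_j bootstrap_mx (fun i => Y i w) j i * q j ord0) ^+ 2); last first.
  apply/funext => w; rewrite sample_covE qform_mulmx_tr dotvE; apply: eq_bigr => i _.
  by rewrite -expr2; congr (_ ^+ 2); rewrite mxE; apply: eq_bigr => j _; rewrite mxE.
apply: measurable_sum => i; apply: measurable_funX; apply: measurable_sum => j.
apply: measurable_funM => //; exact: measurable_bootstrap_mx.
Qed.

End bootstrap_measurable.

Section bootstrap_kernel.
Context {R : realType} {d : measure_display} {T : measurableType d} (P : probability T R).
Context (n p s : nat) (X : 'I_n -> {RV P >-> 'cV[R]_p}) (xi : 'I_n -> {RV P >-> R}).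
Hypothesis xi_iid : iid P xi (normal_prob 0 1).
Hypothesis xi_X : indep_sigma P (g_sigma_preimage xi) (<<s g_sigma_preimage X >>).
Context (kappa : R.-pker (g_sigma_algebraType (g_sigma_preimage X)) ~> R).
Hypothesis kappaP : is_cond_law P
     (fun w => mb_stat s (fun i => xi i w) (fun i => X i w)) kappa.

Local Notation TX := (g_sigma_algebraType (g_sigma_preimage X)).

Let preimage_in_sigma d' (E : measurableType d') (Y : 'I_n -> T -> E) i B :
  measurable B -> g_sigma_preimage Y (Y i @^-1` B).
Proof.
move=> mB; apply: sub_sigma_algebra; rewrite (bigD1 i)//=; left.
by exists B => //; rewrite setTI.
Qed.

Lemma sub_sigma_preimage A : <<s g_sigma_preimage X >> A -> d.-measurable A.
Proof.
apply: smallest_sub; first exact: sigma_algebra_measurable.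
apply: smallest_sub; first exact: sigma_algebra_measurable.
elim/big_ind : _ => [//|A' B' hA hB C [/hA|/hB]//|i _ _ [B mB <-]].
exact: measurable_funP.
Qed.

Let idX : T -> TX := id.
Let midX : measurable_fun setT idX.
Proof. by move=> _ B mB; rewrite setTI; exact: sub_sigma_preimage. Qed.
HB.instance Definition _ := isMeasurableFun.Build _ _ T TX idX midX.
Let PX : probability TX R := distribution P idX.

Let measurable_X i : measurable_fun (setT : set TX) (X i : TX -> 'cV[R]_p).
Proof.
move=> _ B mB; rewrite setTI; apply: sub_sigma_algebra.
exact: (@preimage_in_sigma _ _ (fun i => X i)).
Qed.

Let joint : T -> TX * 'cV[R]_n := fun w => (w, \col_i xi i w).
Let mcol : measurable_fun setT (fun w : T => \col_i xi i w : 'cV[R]_n).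
Proof.
by apply/measurable_mxP => i j; under eq_fun do rewrite mxE; exact: measurable_funPT.
Qed.
Let mjoint : measurable_fun setT joint.
Proof. exact: (measurable_fun_pair midX mcol). Qed.
HB.instance Definition _ := isMeasurableFun.Build _ _ T (TX * 'cV[R]_n)%type joint mjoint.

Lemma joint_lawE W : measurable W -> P (joint @^-1` W) = (PX \x gauss n)%E W.
Proof.
move=> mW; symmetry.
apply: (@product_measure_unique _ _ _ _ _ PX (gauss n) (distribution P joint)) => // A B mA mB.
suff : P (joint @^-1` (A `*` B)) = (P A * gauss n B)%E by [].
have -> : joint @^-1` (A `*` B) = ((fun w : T => \col_i xi i w : 'cV[R]_n) @^-1` B) `&` A.
  by apply/seteqP; split => w [].
have mc : g_sigma_preimage xi ((fun w : T => \col_i xi i w : 'cV[R]_n) @^-1` B).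
  have idem : <<s g_sigma_preimage xi>> = g_sigma_preimage xi.
    by apply: sigma_algebra_id; exact: smallest_sigma_algebra.
  rewrite -idem.
  have mc' : measurable_fun (setT : set (g_sigma_algebraType (g_sigma_preimage xi)))
      (fun w : g_sigma_algebraType (g_sigma_preimage xi) => \col_i xi i w : 'cV[R]_n).
    apply/measurable_mxP => i j.
    rewrite (_ : (fun w => _) = xi i); last by apply/funext => w; rewrite mxE.
    move=> _ C mC; rewrite setTI; apply: sub_sigma_algebra.
    exact: (@preimage_in_sigma _ _ (fun i => xi i)).
  by have := mc' measurableT B mB; rewrite setTI.
by rewrite xi_X// (indep_rv_gauss xi_iid mB) muleC.
Qed.

Context (q : nat -> 'cV[R]_p) (c : R).
Hypothesis c0 : 0 < c.
Hypothesis q0 : forall k, 0 < dotv (q k) (q k).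
Hypothesis supP : forall (A : 'M[R]_p) z t c, 0 < c ->
    (forall k, c * dotv (q k) (q k) <= qform A (q k)) ->
    sup_stat s A z <= t <-> forall k, dotv (q k) z <= t * Num.sqrt (qform A (q k)).

Let Shat (w : T) := sample_cov (fun i => X i w).
Let V (w : T) := bootstrap_mx (fun i => X i w).

Let good : set TX := [set w | forall k, c * dotv (q k) (q k) <= qform (Shat w) (q k)].

Let good_dir w : good w -> forall k, 0 < dotv ((V w)^T *m q k) ((V w)^T *m q k).
Proof.
move=> gw k; rewrite -qform_mulmx_tr -sample_covE.
by apply: lt_le_trans (gw k); rewrite mulr_gt0.
Qed.

Let mgood : measurable good.
Proof.
rewrite (_ : good = \bigcap_k [set w | c * dotv (q k) (q k) <= qform (Shat w) (q k)]); last first.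
  by apply/seteqP; split => w H; [move=> k _; exact: H|move=> k; exact: (H k I)].
apply: bigcapT_measurable => k.
rewrite (_ : [set w | _] = (fun w : TX => qform (Shat w) (q k)) @^-1` `[c * dotv (q k) (q k), +oo[).
  have mf := measurable_qform_sample_cov measurable_X (q k).
  by rewrite -[X in measurable X]setTI; apply: mf.
by apply/seteqP; split => w /=; rewrite in_itv/= andbT.
Qed.

Let W t : set (TX * 'cV[R]_n) :=
  [set z | forall k, dotv (q k) (V z.1 *m z.2) <= t * Num.sqrt (qform (Shat z.1) (q k))].

Let mW t : measurable (W t).
Proof.
rewrite (_ : W t = \bigcap_k [set z | 0 <= t * Num.sqrt (qform (Shat z.1) (q k)) -
    dotv (q k) (V z.1 *m z.2)]); last first.
  apply/seteqP; split => z H; first by move=> k _ /=; rewrite subr_ge0; exact: H.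
  by move=> k; rewrite -subr_ge0; exact: (H k I).
apply: bigcapT_measurable => k.
pose f (z : TX * 'cV[R]_n) := t * Num.sqrt (qform (Shat z.1) (q k)) - dotv (q k) (V z.1 *m z.2).
have mf : measurable_fun setT f.
  apply: measurable_funB.
    apply: measurable_funM => //.
    apply: (measurableT_comp (continuous_measurable_fun (@sqrt_continuous R))).
    exact: (measurableT_comp (measurable_qform_sample_cov measurable_X (q k)) (@measurable_fst _ _ _ _)).
  rewrite (_ : (fun z => _) = fun z : TX * 'cV[R]_n =>
      \sum_j q k j ord0 * \sum_i V z.1 j i * z.2 i ord0); last first.
    by apply/funext => z; rewrite dotvE; apply: eq_bigr => j _; rewrite mxE.
  apply: measurable_sum => j; apply: measurable_funM => //; apply: measurable_sum => i.
  apply: measurable_funM.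
    exact: (measurableT_comp (measurable_bootstrap_mx measurable_X j i) (@measurable_fst _ _ _ _)).
  exact: (measurableT_comp (measurable_mx_entry i ord0) (@measurable_snd _ _ _ _)).
rewrite (_ : [set z | _] = f @^-1` `[0, +oo[); last first.
  by apply/seteqP; split => w /=; rewrite in_itv/= andbT.
by rewrite -[X in measurable X]setTI; apply: mf.
Qed.

Let G t w : \bar R := gauss n (xsection (W t) w).

Let GE t w : good w -> G t w = gauss n (below (studentized (V w) q) t).
Proof.
move=> gw; rewrite -(sup_stat_below _ (good_dir gw)) -sample_covE; congr (gauss n _).
by apply/seteqP; split => y; rewrite /xsection/= inE.
Qed.

Let ae_rat (t : R) : exists N : set T, [/\ measurable N, P N = 0%E &
  forall w, ~ N w -> good w -> kappa w [set r : R | (r <= t)%R] = G t w].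
Proof.
have mray := measurable_ray t.
have mk : measurable_fun setT (fun w : TX => kappa w [set r : R | (r <= t)%R]).
  exact: measurable_kernel.
have mG : measurable_fun setT (G t : TX -> \bar R) by exact: (measurable_fun_xsection _ (mW t)).
have kle1 w : (kappa w [set r : R | (r <= t)%R] <= 1)%E.
  by rewrite -(@prob_kernel _ _ _ _ _ kappa w); apply: le_measure; rewrite ?inE.
have intk : PX.-integrable good (fun w => kappa w [set r : R | (r <= t)%R]).
  apply: (@le_integrable _ _ _ PX _ mgood _ (cst 1%E)).
  - exact: measurable_funTS.
  - by move=> w _ /=; rewrite gee0_abs// normr1.
  - exact: finite_measure_integrable_cst.
have [|N [mN N0 subN]] := integral_ae_eq mgood intk (measurable_funTS mG).
  move=> E Eg mE.
  have -> : (\int[PX]_(x in E) kappa x [set r : R | (r <= t)%R] = \int[P]_(x in E) kappa x [set r : R | (r <= t)%R])%E.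
    apply: (@ge0_integral_pushforward _ _ _ _ _ idX (@measurable_funPT _ _ _ _ idX) _ E) => //.
    exact: measurable_funTS.
  rewrite -(kappaP mE mray).
  transitivity (P (joint @^-1` (W t `&` (E `*` setT)))).
    congr (P _); apply/seteqP; split => w [].
      move=> Ew; have gw : good w := Eg w Ew.
      rewrite /= /mb_stat bootstrap_vecE => /(supP _ _ c0 gw) H.
      by split => //=; exact: H.
    move=> Ww [Ew _]; have gw : good w := Eg w Ew; split => //.
    rewrite /= /mb_stat bootstrap_vecE; apply/(supP _ _ c0 gw); exact: Ww.
  rewrite joint_lawE; last by apply: measurableI => //; exact: measurableX.
  rewrite [RHS]integral_mkcond; apply: eq_integral => w _.
  rewrite patchE; case: ifPn => [/set_mem Ew|/negP Ew].
    congr (gauss n _); apply/seteqP; split => y; rewrite /xsection/= !inE//=.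
    by case.
  rewrite /= (_ : xsection _ _ = set0) ?measure0//.
  apply/seteqP; split => y //; rewrite /xsection/= inE => -[_ [/= Ew']].
  by move=> _; apply: Ew; exact: mem_set.
exists N; split => //; first exact: sub_sigma_preimage.
move=> w Nw gw; apply: contrapT => ne; apply: Nw; apply: subN => /= H.
by apply: ne; exact: H.
Qed.

Lemma bootstrap_kernel_ae : exists N : set T, [/\ measurable N, P N = 0%E &
  forall w, ~ N w -> (forall k, c * dotv (q k) (q k) <= qform (Shat w) (q k)) ->
    forall t, kappa w [set r : R | (r <= t)%R] = gauss n (below (studentized (V w) q) t)].
Proof.
have /choice[N HN] : forall r : rat, exists N : set T, [/\ measurable N, P N = 0%E &
  forall w, ~ N w -> good w -> kappa w [set x : R | (x <= ratr r)%R] = G (ratr r) w].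
  by move=> r; exact: ae_rat.
pose F k := if @unpickle rat k is Some r then N r else set0.
have mF k : measurable (F k) by rewrite /F; case: unpickle => // r; have [] := HN r.
have PF k : P (F k) = 0%E by rewrite /F; case: unpickle => [r|]; [have [] := HN r|exact: measure0].
have mU : measurable (\bigcup_k F k) by exact: bigcupT_measurable.
exists (\bigcup_k F k); split => //.
  have nF : P.-negligible (\bigcup_k F k).
    apply: negligible_bigcup => k; apply/negligibleP; [exact: mF|exact: PF].
  exact: measure_negligible mU nF.
move=> w Fw gw t; have [r rt] := rat_above t.
have E k : kappa w [set x : R | (x <= ratr (r k))%R] =
    gauss n (below (studentized (V w) q) (ratr (r k))).
  have [_ _ H] := HN (r k); rewrite -GE//; apply: H => // Nw.
  apply: Fw; exists (pickle (r k)); first exact: I.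
  rewrite /F pickleK; exact: Nw.
have kfin : (kappa w [set x : R | (x <= t + 1)%R] < +oo)%E.
  apply: le_lt_trans (ltry 1); rewrite -(@prob_kernel _ _ _ _ _ kappa w).
  by apply: le_measure; rewrite ?inE//; exact: measurable_ray.
have C1 : (kappa w [set x : R | (x <= ratr (r k))%R] @[k --> \oo] -->
    kappa w [set x : R | (x <= t)%R])%E.
  apply: (@cdf_right_cvg _ _ _ (kappa w) (fun t => [set x : R | (x <= t)%R])) => //.
  - exact: measurable_ray.
  - by move=> x y xy z /= /le_trans; apply.
  - exact: ray_right_closed.
have C2 : (gauss n (below (studentized (V w) q) (ratr (r k))) @[k --> \oo] -->
    gauss n (below (studentized (V w) q) t))%E.
  apply: (@cdf_right_cvg _ _ _ (gauss n) (below (studentized (V w) q))) => //.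
  - by move=> x; exact: measurable_below.
  - by move=> x y xy z /= H k; exact: le_trans (H k) xy.
  - exact: below_right_closed.
  - by apply: le_lt_trans (probability_le1 _ _) (ltry _); exact: measurable_below.
rewrite (funext E) in C1.
by rewrite -(cvg_lim (@ereal_hausdorff R) C1); exact: (cvg_lim (@ereal_hausdorff R) C2).
Qed.

Lemma cdf_dist_prob_le m (u : nat -> 'cV[R]_m) (mu : set R -> \bar R) (e : R) (Bad : set T) :
  (forall t, mu [set r | (r <= t)%R] = gauss m (below u t)) -> measurable Bad ->
  (forall w, ~ Bad w ->
    (forall k, c * dotv (q k) (q k) <= qform (Shat w) (q k)) /\
    forall t, 0 <= t ->
      (`|gauss m (below u t) - gauss n (below (studentized (V w) q) t)| <= e%:E)%E) ->
  (P [set w | e%:E < `|cdf_dist mu (kappa w)|] <= P Bad)%E.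
Proof.
move=> muE mBad HBad.
have [N [mN PN HN]] := bootstrap_kernel_ae.
have rayfin w t : (kappa w [set r : R | (r <= t)%R] \is a fin_num)%E.
  rewrite ge0_fin_numE//; apply: le_lt_trans (ltry 1).
  rewrite -(@prob_kernel _ _ _ _ _ kappa w).
  by apply: le_measure; rewrite ?inE//; exact: measurable_ray.
have mufin t : mu [set r | (r <= t)%R] \is a fin_num.
  by rewrite muE fin_num_measure//; exact: measurable_below.
pose D r := [set w : T | (0 <= ratr r :> R) /\ (e%:E < `|mu [set x | (x <= ratr r)%R] -
   kappa w [set x : R | (x <= ratr r)%R]|)%E].
have DE : [set w | (e%:E < `|cdf_dist mu (kappa w)|)%E] =
    \bigcup_k (if @unpickle rat k is Some r then D r else set0).
  apply/seteqP; split => w /=.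
    move=> /(cdf_dist_gtP _ mufin (rayfin w)) [||r Dr].
    - move=> t r rt; rewrite muE; under eq_fun do rewrite muE.
      apply: (@cdf_right_cvg _ _ _ (gauss m) (below u)) => //.
      + by move=> x; exact: measurable_below.
      + by move=> x y xy z /= H k; exact: le_trans (H k) xy.
      + exact: below_right_closed.
      + by apply: le_lt_trans (probability_le1 _ _) (ltry _); exact: measurable_below.
    - move=> t r rt.
      apply: (@cdf_right_cvg _ _ _ (kappa w) (fun t => [set x : R | (x <= t)%R])) => //.
      + exact: measurable_ray.
      + by move=> x y xy z /= /le_trans; apply.
      + exact: ray_right_closed.
      + by have := rayfin w (t + 1); rewrite ge0_fin_numE.
    - exists (pickle r); first exact: I.
      rewrite pickleK; exact: Dr.
  case=> k _; case: unpickle => // r [r0 h].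
  apply: lt_le_trans h _; apply: le_trans (lee_abs _).
  by apply: ereal_sup_ubound; exists (ratr r).
have mD r : measurable (D r).
  apply: sub_sigma_preimage.
  have [r0|r0] := boolP (0 <= ratr r :> R); last first.
    rewrite (_ : D r = set0); first exact: (@measurable0 _ TX).
    by apply/seteqP; split => w // [r0']; rewrite r0' in r0.
  have mf : measurable_fun setT (fun w : TX => `|mu [set x | (x <= ratr r)%R] -
      kappa w [set x : R | (x <= ratr r)%R]|%E).
    apply: measurableT_comp => //; apply: emeasurable_funB => //.
    by apply: measurable_kernel; exact: measurable_ray.
  rewrite (_ : D r = (fun w : TX => `|mu [set x | (x <= ratr r)%R] -
      kappa w [set x : R | (x <= ratr r)%R]|%E) @^-1` `]e%:E, +oo[%classic).
    by have := mf measurableT _ (emeasurable_itv `]e%:E, +oo[); rewrite setTI.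
  by apply/seteqP; split => w /=; rewrite in_itv/= andbT => // -[].
have mDU : measurable (\bigcup_k (if @unpickle rat k is Some r then D r else set0)).
  by apply: bigcupT_measurable => k; case: unpickle.
rewrite DE; apply: (@le_trans _ _ (P (Bad `|` N))).
  apply: le_measure; rewrite ?inE//; first exact: measurableU.
  move=> w [k _]; case: unpickle => // r [r0 h].
  apply: contrapT => /not_orP[nB nN]; have [gw close] := HBad w nB.
  by move: h; apply/negP; rewrite -leNgt muE HN//; exact: close.
apply: le_trans (measureU2 P mBad mN) _; rewrite -[leRHS]adde0.
by apply: leeD => //; rewrite -[leRHS]PN.
Qed.

End bootstrap_kernel.

Section sparse_eigenvalues.
Context {R : realType}.

Lemma qform_factor_le p m (A : 'M[R]_(p, m)) : exists2 C : R, 0 <= C &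
  forall u, qform (A *m A^T) u <= C * dotv u u.
Proof.
exists (\sum_i dotv (col i A) (col i A)); first by apply: sumr_ge0 => i _; exact: dotv_ge0.
move=> u; rewrite qform_mulmx_tr [X in X <= _]dotvE mulr_suml; apply: ler_sum => i _.
have -> : (A^T *m u) i ord0 = dotv (col i A) u.
  by rewrite mxE dotvE; apply: eq_bigr => j _; rewrite !mxE.
by rewrite -expr2; exact: cauchy_schwarz.
Qed.

Lemma phi_min_le p (S : 'M[R]_p) s (u : 'cV[R]_p) :
  (forall v : 'cV[R]_p, 0 <= qform S v) -> (1 <= l0norm u <= s)%N ->
  phi_min S s * dotv u u <= qform S u.
Proof.
move=> psdS us; have u0 : 0 < dotv u u by apply: l0norm_dotv_gt0; case/andP: us.
rewrite -ler_pdivlMr// -sqr_l2norm; apply: ge_inf; last by exists u.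
by exists 0 => _ [v _ <-]; rewrite divr_ge0// sqr_ge0.
Qed.

Lemma sparse_cond_ge1 p m (A : 'M[R]_(p, m)) s :
  (0 < s)%N -> (0 < p)%N -> (forall j, (A *m A^T) j j = 1) -> 0 < phi_min (A *m A^T) s ->
  1 <= sparse_cond (A *m A^T) s.
Proof.
move=> s0 p0 diag1 phi0; set S := A *m A^T.
pose u : 'cV[R]_p := delta_mx (Ordinal p0) ord0.
have uE (M : 'M[R]_p) : qform M u = M (Ordinal p0) (Ordinal p0).
  by rewrite /qform /dotv trmx_delta -rowE -colE !mxE.
have uu : dotv u u = 1 by rewrite -[u in X in dotv _ X]mul1mx -/(qform 1%:M u) uE mxE eqxx.
have us : l0norm u = 1%N.
  rewrite -[RHS](card1 (Ordinal p0)); apply: eq_card => j.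
  by rewrite !inE mxE andbT pnatr_eq0 eqb0 negbK.
have hu : (1 <= l0norm u <= s)%N by rewrite us.
have psdS v : 0 <= qform S v by rewrite qform_mulmx_tr dotv_ge0.
have h1 : phi_min S s <= 1.
  by have := phi_min_le psdS hu; rewrite uu mulr1 uE diag1.
have h2 : 1 <= phi_max S s.
  have [C C0 HC] := qform_factor_le A.
  have -> : 1 = qform S u / l2norm u ^+ 2 by rewrite sqr_l2norm uu uE diag1 divr1.
  apply: ub_le_sup; last by exists u.
  exists C => _ [v /andP[v1 _] <-]; rewrite sqr_l2norm ler_pdivrMr ?HC//.
  exact: l0norm_dotv_gt0.
rewrite /sparse_cond -[X in X <= _]sqrtr1; apply: ler_wsqrtr.
rewrite ler_pdivlMr// mul1r; exact: le_trans h1 h2.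
Qed.

End sparse_eigenvalues.

Section finite_sample.
Context {R : realType} {d0 : measure_display} {T0 : measurableType d0} (Q : probability T0 R).
Context (n p s : nat) (U X0 Z : {RV Q >-> 'cV[R]_p}) (Sigma Sigma12 : 'M[R]_p) (K1 : R).
Hypothesis n0 : (0 < n)%N.
Hypothesis hsp : (1 <= s <= p)%N.
Hypothesis U_mean : forall j, ('E_Q[fun w => U w j ord0] = 0)%E.
Hypothesis U_cov : forall j k,
  ('E_Q[fun w => (U w j ord0 * U w k ord0)%R] = ((j == k)%:R)%:E)%E.
Hypothesis U_psi2 : (psi2_norm_vec Q U <= K1%:E)%E.
Hypothesis root : is_psd_sqrt Sigma12 Sigma.
Hypothesis X0E : forall w, X0 w = Sigma12 *m U w.
Hypothesis phi0 : 0 < phi_min Sigma s.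
Hypothesis gaussZ : centered_gaussian Q Z Sigma.
Context {d : measure_display} {T : measurableType d} (P : probability T R).
Context (X : 'I_n -> {RV P >-> 'cV[R]_p}) (xi : 'I_n -> {RV P >-> R}).
Hypothesis X_iid : iid P X (distribution Q X0).
Hypothesis xi_iid : iid P xi (normal_prob 0 1).
Hypothesis xi_X : indep_sigma P (g_sigma_preimage xi) (<<s g_sigma_preimage X >>).
Context (kappa : R.-pker (g_sigma_algebraType (g_sigma_preimage X)) ~> R).
Hypothesis kappaP : is_cond_law P
     (fun w => mb_stat s (fun i => xi i w) (fun i => X i w)) kappa.

Lemma cdf_dist_prob_bound (x T1 w e eps : R) :
  let delta := 4 * s%:R * x in
  let eta := 2 * delta / (1 + delta) in
  let e1 := p%:R ^+ s * (expR (- (T1 ^+ 2 / 4)) * Num.sqrt 2 ^+ s) in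
  0 <= x <= 1 -> x <= 32 * expR 1 / psi2_rate K1 -> delta <= 1 / 2 ->
  0 <= T1 -> 0 <= w ->
  T1 * ((Num.sqrt (1 - eta))^-1 - 1) + Num.sqrt eta * w / Num.sqrt (1 - eta) <= eps ->
  eps * (T1 + 2) <= 1 ->
  e1 + (T1 + 2) * eps * expR 3 + 2 * expR (- (w ^+ 2 / 4)) <= e ->
  (P [set w | e%:E < `|cdf_dist (pushforward Q (fun v => sup_stat s Sigma (Z v))) (kappa w)|] <=
   ((p%:R ^+ s * p%:R ^+ s * (2 * s%:R)) ^+ 2 *
       (4 * expR (- (n%:R * x ^+ 2 / (128 * expR 1 / psi2_rate K1 ^+ 2)))))%:E)%E.
Proof.
move=> delta eta e1 x01 xa d12 T10 w0 epsE epsT be.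
have /andP[x0 x1] := x01; have /andP[s1 sp] := hsp.
have p0 : (0 < p)%N := leq_trans s1 sp.
have delta0 : 0 <= delta by rewrite !mulr_ge0.
have [[Str psdS12] SS] := root.
have [Bad [mBad PBad HBad]] := sparse_isometry_prob U_mean U_cov U_psi2 X0E X_iid s p0 n0 x01 xa.
have [m [A [d' [T' [P' [g [AA giid Zlaw]]]]]]] := gaussZ.
have SA z : dotv (Sigma12^T *m z) (Sigma12^T *m z) = dotv (A^T *m z) (A^T *m z).
  by rewrite -!qform_mulmx_tr AA Str SS.
have [q [qs supP]] := @sup_stat_countable R p s hsp.
have q0 k : 0 < dotv (q k) (q k) by apply: l0norm_dotv_gt0; rewrite qs.
pose c0 := phi_min Sigma s.
have qSig k : c0 * dotv (q k) (q k) <= qform Sigma (q k).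
  apply: phi_min_le; last by rewrite qs s1 leqnn.
  by move=> v; rewrite -AA qform_mulmx_tr dotv_ge0.
have Aq k : 0 < dotv (A^T *m q k) (A^T *m q k).
  rewrite -qform_mulmx_tr AA; apply: lt_le_trans (qSig k); exact: mulr_gt0.
have muE t : pushforward Q (fun v => sup_stat s Sigma (Z v)) [set r | r <= t] =
    gauss m (below (studentized A q) t).
  rewrite /pushforward.
  pose v k : 'cV[R]_p := (Num.sqrt (qform Sigma (q k)))^-1 *: q k.
  have qf0 k : 0 < qform Sigma (q k) by rewrite -AA qform_mulmx_tr.
  have E1 z : sup_stat s Sigma z <= t <-> below v t z.
    rewrite (supP Sigma z t c0 phi0 qSig); split => H k.
      by rewrite /v dotvZl ler_pdivrMl ?sqrtr_gt0// mulrC; exact: H.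
    by have := H k; rewrite /v dotvZl ler_pdivrMl ?sqrtr_gt0// mulrC.
  have -> : (fun v => sup_stat s Sigma (Z v)) @^-1` [set r | r <= t] = Z @^-1` (below v t).
    by apply/seteqP; split => o /E1.
  rewrite Zlaw; last exact: measurable_below.
  rewrite /pushforward.
  have mB : measurable (below (studentized A q) t) by exact: measurable_below.
  rewrite -(indep_rv_gauss giid mB); congr (P' _).
  rewrite -(sup_stat_below _ Aq) AA; apply/seteqP; split => o /= H k.
    by apply/(supP Sigma _ t c0 phi0 qSig).1; apply/E1.
  by apply: (E1 _).1; apply/(supP Sigma _ t c0 phi0 qSig).
have iso o : ~ Bad o -> forall j k (y z : R), let v := y *: q j + z *: q k in
    (1 - delta) * dotv (A^T *m v) (A^T *m v) <=
      dotv ((bootstrap_mx (fun i => X i o))^T *m v) ((bootstrap_mx (fun i => X i o))^T *m v)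
     <= (1 + delta) * dotv (A^T *m v) (A^T *m v).
  move=> nB j k y z /=; set v := _ + _.
  have lz (c : R) i : (l0norm (c *: q i) <= s)%N.
    have [->|c0'] := eqVneq c 0; last by rewrite l0normZ// qs.
    rewrite scale0r /l0norm eq_card0// => l; by rewrite inE mxE eqxx.
  have := HBad o nB (y *: q j) (z *: q k) (lz _ _) (lz _ _).
  rewrite SA sample_covE qform_mulmx_tr -/v -/delta ler_distl => /andP[h1 h2].
  by rewrite mulrBl mulrDl mul1r h1 h2.
have d1 : 0 < 1 - delta by lra.
have d1' : 0 < 1 + delta by lra.
have etaE : 1 - eta = (1 - delta) / (1 + delta) by rewrite /eta; field; rewrite gt_eqF.
have eta01 : 0 <= eta < 1.
  apply/andP; split; first by rewrite divr_ge0 ?mulr_ge0// ltW.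
  by rewrite -subr_gt0 etaE divr_gt0.
apply: le_trans PBad.
apply: (@cdf_dist_prob_le _ _ _ P _ _ _ X xi xi_iid xi_X kappa kappaP q (c0 / 2) _ q0 supP
  m (studentized A q)) => //.
  by rewrite divr_gt0.
move=> o nB; have isoo := iso o nB.
have low k : (c0 / 2) * dotv (q k) (q k) <= qform (sample_cov (fun i => X i o)) (q k).
  have /= := isoo k k 1 0; rewrite scale1r scale0r addr0 => /andP[h _].
  rewrite sample_covE qform_mulmx_tr; apply: le_trans h.
  have := qSig k; rewrite -AA qform_mulmx_tr; move: (Aq k) => M0.
  have d2 : 1 / 2 <= 1 - delta by lra.
  by have := ler_wpM2r (ltW M0) d2; lra.
split => // t t0.
have Vq k : 0 < dotv ((bootstrap_mx (fun i => X i o))^T *m q k) ((bootstrap_mx (fun i => X i o))^T *m q k).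
  by rewrite -qform_mulmx_tr -sample_covE; apply: lt_le_trans (low k); rewrite mulr_gt0// divr_gt0.
have u1 k := studentized_unit (Aq k).
have v1 k := studentized_unit (Vq k).
have FT : ((1 - e1)%:E <= gauss m (below (studentized A q) T1))%E.
  apply: (below_tail p0 T10 (A := A) (q := q)) => // k; first by rewrite qs.
  by exists (l2norm (A^T *m q k))^-1 => //; rewrite invr_ge0 l2norm_ge0.
have e10 : 0 <= e1 by rewrite !mulr_ge0 ?exprn_ge0 ?expR_ge0 ?sqrtr_ge0.
have [j k|j k|h1 h2] := @gauss_cdf_close R m n (studentized A q)
  (studentized (bootstrap_mx (fun i => X i o)) q) eta T1 w e1 eps t u1 v1 eta01 _ _
  T10 w0 e10 FT epsE epsT t0.
- by rewrite etaE; apply: correlation_compare.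
- have -> : 1 - eta = (1 + delta)^-1 / (1 - delta)^-1 by rewrite etaE invrK mulrC.
  apply: correlation_compare; rewrite ?invr_gt0//.
  move=> y z /=; have /= /andP[a1 a2] := isoo j k y z.
  by rewrite ler_pdivrMl// ler_pdivlMl// a1 a2.
have bE : ((e1 + (T1 + 2) * eps * expR 3 + 2 * expR (- (w ^+ 2 / 4)))%:E <= e%:E)%E.
  by rewrite lee_fin.
have fF : gauss m (below (studentized A q) t) \is a fin_num.
  by rewrite fin_num_measure//; exact: measurable_below.
have fG : gauss n (below (studentized (bootstrap_mx (fun i => X i o)) q) t) \is a fin_num.
  by rewrite fin_num_measure//; exact: measurable_below.
have {}h1 := le_trans h1 (leeD (lexx _) bE); have {}h2 := le_trans h2 (leeD (lexx _) bE).
move: h1 h2; rewrite -(fineK fF) -(fineK fG) -EFinB -!EFinD abse_EFin !lee_fin => h1 h2.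
by rewrite ler_norml; apply/andP; split; lra.
Qed.

End finite_sample.

Section rates.
Context {R : realType}.

Lemma increment_rate (delta T w r : R) :
  let eta := 2 * delta / (1 + delta) in
  0 <= delta <= 1 / 2 -> 2 <= T -> 0 <= w -> 0 <= r <= 1 -> delta * T ^+ 2 <= 12 * r ^+ 2 ->
  (T * ((Num.sqrt (1 - eta))^-1 - 1) + Num.sqrt eta * w / Num.sqrt (1 - eta)) * (T + 2) <=
  (96 + 21 * w) * r.
Proof.
move=> eta /andP[d0 d1] T2 w0 /andP[r0 r1] dT.
have etaE : eta * (1 + delta) = 2 * delta by rewrite /eta mulfVK// gt_eqF// ltr_wpDr.
have eta0 : 0 <= eta by rewrite /eta divr_ge0 ?mulr_ge0// addr_ge0.
have eta2 : eta <= 2 * delta by nra.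
have eta3 : eta <= 2 / 3 by nra.
clearbody eta.
set D := Num.sqrt delta; have D0 : 0 <= D := sqrtr_ge0 _.
have DD : D ^+ 2 = delta by rewrite sqr_sqrtr.
set H := Num.sqrt eta; have H0 : 0 <= H := sqrtr_ge0 _.
have HH : H ^+ 2 = eta by rewrite sqr_sqrtr.
set S := Num.sqrt (1 - eta); have S0 : 0 <= S := sqrtr_ge0 _.
have SS : S ^+ 2 = 1 - eta by rewrite sqr_sqrtr//; lra.
clearbody D H S.
have S2 : 1 / 2 <= S by rewrite leNgt; apply/negP => h; nra.
have S1 : S <= 1 by rewrite leNgt; apply/negP => h; nra.
have Sp : 0 < S by lra.
have iS2 : S^-1 <= 2 by rewrite invf_ple ?posrE// -div1r.
have iS : S^-1 - 1 <= 4 * delta.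
  have e1 : S^-1 * S = 1 by rewrite mulVf// gt_eqF.
  have : 0 < S^-1 by rewrite invr_gt0.
  by nra.
have iS0 : 0 <= S^-1 - 1 by rewrite subr_ge0 invf_ge1.
have H3 : H <= 3 / 2 * D by rewrite leNgt; apply/negP => h; nra.
have DT0 : 0 <= D * T by rewrite mulr_ge0//; lra.
have DT : D * T <= 7 / 2 * r.
  rewrite leNgt; apply/negP => h.
  have : (D * T) ^+ 2 <= 12 * r ^+ 2 by rewrite exprMn DD.
  by nra.
have T0 : 0 <= T by lra.
have t1 : T * (S^-1 - 1) <= 4 * (delta * T) by have := ler_wpM2l T0 iS; lra.
have t2 : H * w / S <= 3 * (D * w).
  have Hw : 0 <= H * w by rewrite mulr_ge0.
  have g1 := ler_wpM2l Hw iS2; have g2 := ler_wpM2r w0 H3; lra.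
have E0 : 0 <= T * (S^-1 - 1) + H * w / S.
  by rewrite addr_ge0 ?mulr_ge0// ?invr_ge0//; lra.
have T4 : T + 2 <= 2 * T by lra.
apply: le_trans (ler_wpM2l E0 T4) _.
have TT : 0 <= 2 * T by lra.
apply: le_trans (ler_wpM2r TT (lerD t1 t2)) _.
have g1 := ler_wpM2r w0 DT.
have rr : r ^+ 2 <= r by rewrite expr2 ler_piMr.
have -> : (4 * (delta * T) + 3 * (D * w)) * (2 * T) = 8 * (delta * T ^+ 2) + 6 * (D * T * w) by ring.
lra.
Qed.

Lemma exp_rate (n p s : nat) :
  (1 <= s <= p)%N -> (0 < n)%N -> 1 <= ln n%:R :> R ->
  let Lam : R := s%:R * ln (p%:R * n%:R) in
  [/\ 1 <= Lam, s%:R <= Lam, expR (- Lam) <= n%:R^-1,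
   p%:R ^+ s <= expR Lam & s%:R <= expR Lam].
Proof.
move=> /andP[s1 sp] n0 ln1 Lam.
have p0 : (0 < p)%N := leq_trans s1 sp.
have pR : 0 < p%:R :> R by rewrite ltr0n.
have nR : 0 < n%:R :> R by rewrite ltr0n.
have lnM' : ln (p%:R * n%:R) = ln p%:R + ln n%:R :> R by rewrite lnM ?posrE.
have lp0 : 0 <= ln p%:R :> R by rewrite ln_ge0// ler1n.
have sR : 1 <= s%:R :> R by rewrite ler1n.
have l1 : 1 <= ln (p%:R * n%:R) :> R by rewrite lnM'; lra.
have h1 : s%:R <= Lam by rewrite /Lam ler_peMr.
have h2 : ln n%:R <= Lam.
  apply: (@le_trans _ _ (ln (p%:R * n%:R))); first by rewrite lnM' lerDr.
  by rewrite /Lam ler_peMl//; lra.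
split => //.
- exact: le_trans sR h1.
- rewrite -[X in _ <= X]lnK ?posrE ?invr_gt0// ler_expR lnV ?posrE//; lra.
- rewrite -[X in X ^+ s]lnK ?posrE// -expRM_natl ler_expR /Lam ler_wpM2l// lnM'; lra.
- by apply: le_trans (expR_ge1Dx _); lra.
Qed.

Lemma tail_rate (p s : nat) (T Lam : R) :
  T ^+ 2 = 12 * Lam -> p%:R ^+ s <= expR Lam -> s%:R <= Lam ->
  p%:R ^+ s * (expR (- (T ^+ 2 / 4)) * Num.sqrt 2 ^+ s) <= expR (- Lam).
Proof.
move=> TT pL sL.
have s2L : Num.sqrt 2 ^+ s <= expR Lam :> R.
  apply: (@le_trans _ _ (expR 1 ^+ s)); last by rewrite -expRM_natl mulr1 ler_expR.
  rewrite lerXn2r ?nnegrE ?expR_ge0 ?sqrtr_ge0//.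
  apply: le_trans (expR_ge1Dx 1); rewrite -(@ler_pXn2r _ 2) ?nnegrE ?sqrtr_ge0// sqr_sqrtr//.
  by lra.
rewrite TT; apply: (@le_trans _ _ (expR Lam * (expR (- (12 * Lam / 4)) * expR Lam))).
  apply: ler_pM; [exact: exprn_ge0| |exact: pL|by rewrite ler_wpM2l ?expR_ge0].
  by apply: mulr_ge0; [exact: expR_ge0|apply: exprn_ge0; exact: sqrtr_ge0].
by rewrite -!expRD ler_expR; lra.
Qed.

Lemma failure_rate (p s : nat) (Lam : R) :
  p%:R ^+ s <= expR Lam -> s%:R <= expR Lam ->
  (p%:R ^+ s * p%:R ^+ s * (2 * s%:R)) ^+ 2 * (4 * expR (- (7 * Lam))) <= 16 * expR (- Lam).
Proof.
move=> pL sE.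
have b1 : (p%:R ^+ s * p%:R ^+ s * (2 * s%:R)) <= expR Lam * expR Lam * (2 * expR Lam).
  have p0 : 0 <= p%:R ^+ s :> R by exact: exprn_ge0.
  apply: ler_pM; [exact: mulr_ge0|exact: mulr_ge0|exact: ler_pM|by rewrite ler_wpM2l].
have b0 : 0 <= p%:R ^+ s * p%:R ^+ s * (2 * s%:R) :> R by rewrite !mulr_ge0 ?exprn_ge0.
have b2 : (p%:R ^+ s * p%:R ^+ s * (2 * s%:R)) ^+ 2 <= 4 * expR (6 * Lam).
  rewrite (_ : 4 * expR (6 * Lam) = (expR Lam * expR Lam * (2 * expR Lam)) ^+ 2).
    by rewrite lerXn2r ?nnegrE// !mulr_ge0 ?expR_ge0.
  rewrite (_ : 6 * Lam = Lam + Lam + Lam + (Lam + Lam + Lam)) ?expRD; first by ring.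
  by ring.
apply: (@le_trans _ _ (4 * expR (6 * Lam) * (4 * expR (- (7 * Lam))))).
  by rewrite ler_wpM2r// mulr_ge0 ?expR_ge0.
by rewrite mulrACA -expRD -natrM (_ : 6 * Lam + - (7 * Lam) = - Lam)//; ring.
Qed.

Lemma rate_choice (a B0 e : R) : 0 < a <= 1 -> 0 < B0 -> 0 < e ->
  exists w theta : R, [/\ 0 <= w, 0 < theta & forall n p s : nat,
    let Lam : R := s%:R * ln (p%:R * n%:R) in
    (1 <= s <= p)%N -> (0 < n)%N -> 1 <= ln n%:R :> R -> n%:R^-1 <= e / 3 ->
    Lam ^+ 5 <= theta * n%:R ->
    exists x T eps : R,
      let delta := 4 * s%:R * x in
      let eta := 2 * delta / (1 + delta) in
      let e1 := p%:R ^+ s * (expR (- (T ^+ 2 / 4)) * Num.sqrt 2 ^+ s) in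
      [/\ [/\ 0 <= x <= 1, x <= 32 * expR 1 / a, delta <= 1 / 2 & 0 <= T],
      T * ((Num.sqrt (1 - eta))^-1 - 1) + Num.sqrt eta * w / Num.sqrt (1 - eta) <= eps,
      eps * (T + 2) <= 1,
      e1 + (T + 2) * eps * expR 3 + 2 * expR (- (w ^+ 2 / 4)) <= e &
      (p%:R ^+ s * p%:R ^+ s * (2 * s%:R)) ^+ 2 *
       (4 * expR (- (n%:R * x ^+ 2 / B0))) <= 16 * n%:R^-1]].
Proof.
move=> /andP[a0 a1] B00 e0.
pose w := Num.sqrt (24 / e).
have w0 : 0 <= w := sqrtr_ge0 _.
have ww : w ^+ 2 = 24 / e by rewrite sqr_sqrtr// divr_ge0// ltW.
have we : 2 * expR (- (w ^+ 2 / 4)) <= e / 3.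
  rewrite ww expRN ler_pdivrMr ?expR_gt0//.
  have h := expR_ge1Dx (24 / e / 4).
  have ee : e * (24 / e / 4) = 6 by field; rewrite gt_eqF.
  have : e / 3 * (1 + 24 / e / 4) <= e / 3 * expR (24 / e / 4) by rewrite ler_wpM2l// divr_ge0// ltW.
  by rewrite mulrDr (_ : e / 3 * (24 / e / 4) = 2); [lra|field; rewrite gt_eqF].
have z0 : 0 <= (96 + 21 * w) by rewrite addr_ge0// mulr_ge0.
have y0 : 0 <= 3 * expR 3 / e by rewrite divr_ge0 ?mulr_ge0 ?expR_ge0// ltW.
pose c := (96 + 21 * w) * (1 + 3 * expR 3 / e) + 2.
have c2 : 2 <= c.
  by rewrite /c lerDr; apply: mulr_ge0 => //; exact: addr_ge0.
have c0 : 0 < c by lra.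
pose r := c^-1.
have rc : r * c = 1 by rewrite mulVf// gt_eqF.
have r0 : 0 < r by rewrite invr_gt0.
have r12 : r <= 1 / 2 by nra.
have cr1 : (96 + 21 * w) * r <= 1 by move: rc; rewrite /c; nra.
have cr2 : (96 + 21 * w) * r * expR 3 <= e / 3.
  have h : (96 + 21 * w) * r * (3 * expR 3 / e) <= 1 by move: rc; rewrite /c; nra.
  have := ler_wpM2l (ltW e0) h.
  rewrite (_ : e * ((96 + 21 * w) * r * (3 * expR 3 / e)) = 3 * ((96 + 21 * w) * r * expR 3)).
    by lra.
  by field; rewrite gt_eqF.
exists w, (r ^+ 4 / (112 * B0)); split => //; first by rewrite divr_gt0 ?exprn_gt0// mulr_gt0.
move=> n p s Lam hsp n0 ln1 ne Lam5.
have [L1 sL nL pL sE] := exp_rate hsp n0 ln1.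
rewrite -/Lam in L1 sL nL pL sE; clearbody Lam.
have nR : 0 < n%:R :> R by rewrite ltr0n.
have s1 : 1 <= s%:R :> R by rewrite ler1n; case/andP: hsp.
pose x := Num.sqrt (7 * B0 * Lam / n%:R).
have xx : x ^+ 2 = 7 * B0 * Lam / n%:R.
  by rewrite sqr_sqrtr// divr_ge0// ?mulr_ge0//; lra.
have x0 : 0 <= x := sqrtr_ge0 _.
pose T := Num.sqrt (12 * Lam).
have TT : T ^+ 2 = 12 * Lam by rewrite sqr_sqrtr//; lra.
have T0 : 0 <= T := sqrtr_ge0 _.
clearbody x T.
have T2 : 2 <= T by rewrite leNgt; apply/negP => h; nra.
pose delta := 4 * s%:R * x.
have d0 : 0 <= delta by rewrite !mulr_ge0//; lra.
have L0 : 0 <= Lam by lra.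
have r0w := ltW r0.
have dL : delta * Lam <= r ^+ 2.
  rewrite -(@ler_pXn2r _ 2) ?nnegrE ?mulr_ge0 ?sqr_ge0//.
  rewrite -exprM exprMn /delta !exprMn xx.
  have s2 : s%:R ^+ 2 <= Lam ^+ 2 by rewrite lerXn2r ?nnegrE//; lra.
  have B : 112 * B0 * Lam ^+ 5 / n%:R <= r ^+ 4.
    rewrite ler_pdivrMr// mulrC -ler_pdivlMr ?mulr_gt0//.
    by apply: le_trans Lam5 _; rewrite mulrAC.
  apply: le_trans B.
  have -> : 4 ^+ 2 * s%:R ^+ 2 * (7 * B0 * Lam / n%:R) * Lam ^+ 2 =
     (112 * B0 * Lam ^+ 3 / n%:R) * s%:R ^+ 2 by ring.
  have -> : 112 * B0 * Lam ^+ 5 / n%:R = (112 * B0 * Lam ^+ 3 / n%:R) * Lam ^+ 2 by ring.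
  apply: ler_wpM2l => //; apply: divr_ge0 => //.
  by rewrite mulr_ge0 ?exprn_ge0// mulr_ge0// ltW.
have ddL : delta <= delta * Lam by rewrite ler_peMr.
have r14 : r ^+ 2 <= 1 / 2 by clear -r0w r12; nra.
have d12 : delta <= 1 / 2 := le_trans ddL (le_trans dL r14).
have xd : x <= delta.
  by rewrite /delta ler_peMl// -[X in X <= _]mulr1; apply: ler_pM; rewrite // ler1n.
have r01 : 0 <= r <= 1 by rewrite r0w; clear -r12; lra.
have d01 : 0 <= delta <= 1 / 2 by rewrite d0.
have dT : delta * T ^+ 2 <= 12 * r ^+ 2.
  by rewrite TT mulrCA; clear -dL; lra.
have epsb := increment_rate d01 T2 w0 r01 dT.
exists x, T, (T * ((Num.sqrt (1 - 2 * delta / (1 + delta)))^-1 - 1) +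
   Num.sqrt (2 * delta / (1 + delta)) * w / Num.sqrt (1 - 2 * delta / (1 + delta))).
split => //.
- split => //; first by rewrite x0; clear -xd d12; lra.
  have e1 : 1 <= expR 1 :> R by rewrite -expR0 ler_expR.
  rewrite ler_pdivlMr//; apply: (@le_trans _ _ 1); last by clear -e1; lra.
  have x1 : x <= 1 by clear -xd d12; lra.
  by rewrite -[X in _ <= X]mulr1; apply: ler_pM => //; exact: ltW.
- exact: le_trans epsb cr1.
- set eps := (X in (T + 2) * X); rewrite -/eps in epsb.
  have h2 : (T + 2) * eps * expR 3 <= e / 3.
    by apply: le_trans cr2; rewrite ler_wpM2r ?expR_ge0// mulrC.
  have h1 := le_trans (tail_rate TT pL sL) (le_trans nL ne).
  by clear -h1 h2 we; lra.
- have -> : n%:R * x ^+ 2 / B0 = 7 * Lam.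
    by rewrite xx; field; rewrite !gt_eqF.
  exact: le_trans (failure_rate pL sE) (ler_wpM2l _ nL).
Qed.

End rates.

Theorem theorem3p2 (R : realType) (p s : nat -> nat)
  (hsp : forall n, (1 <= s n <= p n)%N)
  (* population variables, one probability space for each n *)
  (d0 : nat -> measure_display) (T0 : forall n, measurableType (d0 n))
  (Q : forall n, probability (T0 n) R)
  (eps0 : forall n, {RV (Q n) >-> R})
  (U X0 Z : forall n, {RV (Q n) >-> 'cV[R]_(p n)})
  (Sigma Sigma12 : forall n, 'M[R]_(p n)) (K0 K1 : R)
  (heps_mean : forall n, 'E_(Q n)[eps0 n]%E = 0%E)
  (heps_var : forall n, 'E_(Q n)[fun w => (eps0 n w ^+ 2)%R]%E = 1%E)
  (heps_psi2 : forall n, (psi2_norm (Q n) (eps0 n) <= K0%:E)%E)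
  (hU_mean : forall n j, 'E_(Q n)[fun w => U n w j ord0]%E = 0%E)
  (hU_cov : forall n j k,
     'E_(Q n)[fun w => (U n w j ord0 * U n w k ord0)%R]%E = ((j == k)%:R)%:E)
  (hU_psi2 : forall n, (psi2_norm_vec (Q n) (U n) <= K1%:E)%E)
  (hroot : forall n, is_psd_sqrt (Sigma12 n) (Sigma n))
  (hX0 : forall n w, X0 n w = Sigma12 n *m U n w)
  (hSigma : forall n j k,
     'E_(Q n)[fun w => (X0 n w j ord0 * X0 n w k ord0)%R]%E = (Sigma n j k)%:E)
  (hdiag : forall n j, Sigma n j j = 1)
  (hphi : forall n, 0 < phi_min (Sigma n) (s n))
  (hZ : forall n, centered_gaussian (Q n) (Z n) (Sigma n))
  (* samples of size n, one probability space for each n *)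
  (d : nat -> measure_display) (T : forall n, measurableType (d n))
  (P : forall n, probability (T n) R)
  (eps : forall n, 'I_n -> {RV (P n) >-> R})
  (X : forall n, 'I_n -> {RV (P n) >-> 'cV[R]_(p n)})
  (xi : forall n, 'I_n -> {RV (P n) >-> R})
  (heps_iid : forall n, iid (P n) (eps n) (distribution (Q n) (eps0 n)))
  (hX_iid : forall n, iid (P n) (X n) (distribution (Q n) (X0 n)))
  (heps_X : forall n,
     indep_sigma (P n) (g_sigma_preimage (eps n)) (g_sigma_preimage (X n)))
  (hxi_iid : forall n, iid (P n) (xi n) (normal_prob 0 1))
  (hxi_indep : forall n, indep_sigma (P n) (g_sigma_preimage (xi n))
     <<s g_sigma_preimage (eps n) `|` g_sigma_preimage (X n) >>)
  (kappa : forall n, R.-pker (g_sigma_algebraType (g_sigma_preimage (X n))) ~> R)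
  (hkappa : forall n, is_cond_law (P n)
     (fun w => mb_stat (s n) (fun i => xi n i w) (fun i => X n i w)) (kappa n))
  (hrate : (fun n => (s n)%:R *
      ln (sparse_cond (Sigma n) (s n) * (p n)%:R * n%:R) : R) =o_\oo
     (fun n => n%:R `^ 5^-1 : R)) :
  cvg_prob0 P (fun n w =>
    cdf_dist
      (pushforward (Q n) (fun v => sup_stat (s n) (Sigma n) (Z n v)))
      (kappa n w)).
Proof.
  (* your proof *)
Proof.
move=> e e0.
pose a := psi2_rate K1; pose B0 := 128 * expR 1 / a ^+ 2.
have a01 : 0 < a <= 1 by rewrite psi2_rate_gt0 psi2_rate_le1.
have B00 : 0 < B0.
  by rewrite divr_gt0 ?exprn_gt0 ?mulr_gt0 ?expR_gt0//; case/andP: a01.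
have [w [theta [w0 theta0 choice]]] := rate_choice a01 B00 e0.
pose eps1 := Num.min 1 theta.
have eps10 : 0 < eps1 by rewrite lt_min ltr01.
have c1 : (fun n : nat => 16 * harmonic n : R) @ \oo --> (16 * 0 : R).
  by apply: cvgM; [exact: cvg_cst|exact: cvg_harmonic].
have c0 : ((16 * n%:R^-1)%:E : \bar R) @[n --> \oo] --> 0%E.
  apply: cvg_EFin; first exact: nearW.
  rewrite mulr0 in c1; rewrite -(@cvg_shiftS R (fun n : nat => (16 * n%:R^-1 : R))).
  exact: c1.
apply: (squeeze_cvge _ (cvg_cst 0%E) c0); near=> n.
rewrite measure_ge0/=.
have ne : expR 1 <= n%:R :> R by near: n; exact: nbhs_infty_ger.
have n3 : 3 / e <= n%:R by near: n; exact: nbhs_infty_ger.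
have Ln : `|(s n)%:R * ln (sparse_cond (Sigma n) (s n) * (p n)%:R * n%:R)| <=
    eps1 * `|n%:R `^ 5^-1 : R|.
  near: n; move/eqoP : hrate => /(_ _ eps10); exact.
have nR : 0 < n%:R :> R := lt_le_trans (expR_gt0 1) ne.
have n0 : (0 < n)%N by rewrite -(ltr0n R).
have /andP[s1 sp] := hsp n.
have ln1 : 1 <= ln n%:R :> R by rewrite -[X in X <= _](expRK 1) ler_ln ?posrE ?expR_gt0.
have nie : n%:R^-1 <= e / 3.
  by rewrite -[e / 3]invrK lef_pV2 ?posrE ?invr_gt0 ?divr_gt0// invf_div.
have [[Str psdS12] SS] := hroot n.
have SE : Sigma n = Sigma12 n *m (Sigma12 n)^T by rewrite Str SS.
have g1 : 1 <= sparse_cond (Sigma n) (s n).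
  rewrite SE; apply: sparse_cond_ge1 => //; first exact: leq_trans s1 sp.
    by move=> j; rewrite -SE.
  by rewrite -SE.
have p0 : 0 < (p n)%:R :> R by rewrite ltr0n (leq_trans s1 sp).
have [L1 _ _ _ _] := @exp_rate R n (p n) (s n) (hsp n) n0 ln1.
have L5 : ((s n)%:R * ln ((p n)%:R * n%:R)) ^+ 5 <= theta * n%:R :> R.
  set Lam := _ * _ in L1 *.
  have LL : Lam <= eps1 * n%:R `^ 5^-1.
    rewrite -[X in _ <= _ * X]ger0_norm ?powR_ge0//; apply: le_trans Ln.
    apply: le_trans (ler_norm _); rewrite ler_wpM2l// ler_ln ?posrE ?mulr_gt0//; last first.
      exact: lt_le_trans g1.
    by rewrite -mulrA ler_peMl// mulr_ge0// ltW.
  apply: (@le_trans _ _ ((eps1 * n%:R `^ 5^-1) ^+ 5)).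
    have b0 : 0 <= eps1 * n%:R `^ 5^-1 by apply: mulr_ge0; [exact: ltW|exact: powR_ge0].
    have L0 := le_trans ler01 L1.
    by rewrite lerXn2r ?nnegrE.
  have nE : (n%:R `^ 5^-1) ^+ 5 = n%:R :> R.
    by rewrite -powR_mulrn ?powR_ge0// -powRrM mulVf// powRr1.
  rewrite exprMn nE.
  rewrite ler_wpM2r//; apply: (@le_trans _ _ eps1); last by rewrite ge_min lexx orbT.
  by rewrite exprS ler_piMr ?(ltW eps10)// exprn_ile1 ?(ltW eps10)// ge_min lexx.
have [x [T1 [eps2 [[x01 xa d12 T10] epsE epsT be fail]]]] := choice n (p n) (s n) (hsp n) n0 ln1 nie L5.
have xiX : indep_sigma (P n) (g_sigma_preimage (xi n)) <<s g_sigma_preimage (X n) >>.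
  move=> A B hA hB; apply: hxi_indep => //; move: B hB.
  by apply: sub_sigma_algebra2 => B hB; right.
have bound := cdf_dist_prob_bound n0 (hsp n) (hU_mean n) (hU_cov n) (hU_psi2 n) (hroot n)
  (hX0 n) (hphi n) (hZ n) (hX_iid n) (hxi_iid n) xiX (hkappa n) x01 xa d12 T10 w0 epsE epsT be.
by apply: le_trans bound _; rewrite lee_fin.
Unshelve. all: by end_near. Qed.
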